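(* Let $H$ be a Hopf $^*$-algebra over $\mathsf{C}$ and consider unital $^*$-algebras over $\mathsf{C}$ with $^*$-actions of $H$. The $H$-covariant strong Picard groupoid acts on $\mathsf{Proj}^{\mathrm{str}}_H$ from the right by semigroup isomorphisms, via $$\mathsf{S}:\mathsf{Proj}^{\mathrm{str}}_H(\mathcal{B})\times\mathsf{Pic}^{\mathrm{str}}_H(\mathcal{B},\mathcal{A})\ni([\mathcal{P}],[\mathcal{E}])\longmapsto[\mathcal{P}\,\widehat{\otimes}_{\mathcal{B}}\,\mathcal{E}]\in\mathsf{Proj}^{\mathrm{str}}_H(\mathcal{A}),$$ and hence it also acts on the $H$-equivariant strong $K_0$-groups by group isomorphisms $$\mathsf{S}:\mathsf{K}^{\mathrm{str}}_{0,H}(\mathcal{B})\times\mathsf{Pic}^{\mathrm{str}}_H(\mathcal{B},\mathcal{A})\longrightarrow\mathsf{K}^{\mathrm{str}}_{0,H}(\mathcal{A}).$$ The analogous result holds for $\mathsf{Pic}^*_H$, $\mathsf{Proj}^*_H$ and $\mathsf{K}^*_{0,H}$.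
   Context: **Ground ring.** $\mathsf{R}$ is an ordered ring (commutative, unital), $\mathsf{C}=\mathsf{R}(i)$ with $i^2=-1$, with complex conjugation. A $^*$-algebra over $\mathsf{C}$ is an associative $\mathsf{C}$-algebra with a $\mathsf{C}$-antilinear involutive antiautomorphism. Modules over unital algebras are unital and carry a compatible $\mathsf{C}$-module structure. **Hopf $^*$-algebra.** $H$ is a Hopf algebra over $\mathsf{C}$ ($\Delta(g)=g_{(1)}\otimes g_{(2)}$, counit $\epsilon$, antipode $S$) which is also a $^*$-algebra such that $\Delta,\epsilon$ are $^*$-homomorphisms and $S(S(g)^* )^*=g$. A $^*$-action of $H$ on a unital $\mathcal{A}$ is a left $H$-module structure with $1_H\triangleright a=a$, $g\triangleright(ab)=(g_{(1)}\triangleright a)(g_{(2)}\triangleright b)$, $(g\triangleright a)^*=S(g)^*\triangleright a^*$, $g\triangleright1=\epsilon(g)1$. **Inner products.** $\omega:\mathcal{A}\to\mathsf{C}$ linear is positive if $\omega(a^*a)\ge0$; $a$ is positive if $\omega(a)\ge0$ for all positive $\omega$. An $\mathcal{A}$-valued inner product on a right $\mathcal{A}$-module is $\mathsf{C}$-sesquilinear (linear in the second argument) with $\langle x,y\cdot a\rangle=\langle x,y\rangle a$, $\langle x,y\rangle=\langle y,x\rangle^*$ (on left modules: left linear in the first argument). Non-degenerate: $\langle x,\cdot\rangle=0$ implies $x=0$. Full: its values span the algebra. Completely positive: $(\langle x_i,x_j\rangle)$ is positive in $M_n$ of the algebra for all $n$, $x_1,\dots,x_n$. Strongly non-degenerate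 (right module $\mathcal{P}$): $x\mapsto\langle x,\cdot\rangle\in\mathrm{Hom}_{\mathcal{A}}(\mathcal{P},\mathcal{A})$ is bijective. $H$-covariant: $\mathcal{P}$ is an $H$-module with $g\triangleright\langle x,y\rangle=\langle S(g_{(1)})^*\triangleright x,g_{(2)}\triangleright y\rangle$ (then $g\triangleright(x\cdot a)=(g_{(1)}\triangleright x)\cdot(g_{(2)}\triangleright a)$). **Projective modules.** $\mathsf{Proj}^{\mathrm{str}}_H(\mathcal{A})$ (resp. $\mathsf{Proj}^*_H(\mathcal{A})$) is the set of $H$-equivariant isometric isomorphism classes of finitely generated projective right $\mathcal{A}$-modules with an $H$-covariant, strongly non-degenerate, completely positive (resp. not necessarily completely positive) $\mathcal{A}$-valued inner product; it is an abelian semigroup under orthogonal direct sum. $\mathsf{K}^{\mathrm{str}}_{0,H}(\mathcal{A})$ and $\mathsf{K}^*_{0,H}(\mathcal{A})$ are the Grothendieck groups. **Picard groupoid.** An $H$-covariant $^*$-equivalence bimodule is a $(\mathcal{B},\mathcal{A})$-bimodule $\mathcal{E}$ with full non-degenerate inner products ${}_{\mathcal{B}}\langle\cdot,\cdot\rangle$ (left $\mathcal{B}$-linear) and $\langle\cdot,\cdot\rangle_{\mathcal{A}}$ (right $\mathcal{A}$-linear) with $\langle b\cdot x,y\rangle_{\mathcal{A}}=\langle x,b^*\cdot y\rangle_{\mathcal{A}}$, ${}_{\mathcal{B}}\langle x\cdot a,y\rangle={}_{\mathcal{B}}\langle x,y\cdot a^*\rangle$, ${}_{\mathcal{B}}\langle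 x,y\rangle\cdot z=x\cdot\langle y,z\rangle_{\mathcal{A}}$, and an $H$-module structure with $g\triangleright\langle x,y\rangle_{\mathcal{A}}=\langle S(g_{(1)})^*\triangleright x,g_{(2)}\triangleright y\rangle_{\mathcal{A}}$, $g\triangleright{}_{\mathcal{B}}\langle x,y\rangle={}_{\mathcal{B}}\langle g_{(1)}\triangleright x,S(g_{(2)})^*\triangleright y\rangle$; *strong* if both inner products are completely positive. $\mathsf{Pic}^*_H(\mathcal{B},\mathcal{A})$, $\mathsf{Pic}^{\mathrm{str}}_H(\mathcal{B},\mathcal{A})$ are the sets of isomorphism classes (isomorphisms preserve all structures) of $^*$-, resp. strong, equivalence bimodules; these are the arrows $\mathcal{A}\to\mathcal{B}$ of groupoids with composition $[\mathcal{F}]\circ[\mathcal{E}]=[\mathcal{F}\widetilde{\otimes}\mathcal{E}]$ and units $[{}_{\mathcal{A}}\mathcal{A}_{\mathcal{A}}]$ ($\langle a,b\rangle_{\mathcal{A}}=a^*b$, ${}_{\mathcal{A}}\langle a,b\rangle=ab^*$). A right action means $([\mathcal{P}]\cdot[\mathcal{F}])\cdot[\mathcal{E}]=[\mathcal{P}]\cdot[\mathcal{F}\widetilde{\otimes}\mathcal{E}]$ and units act as identities. **Tensor products.** $\mathcal{P}\widehat{\otimes}_{\mathcal{B}}\mathcal{E}$ is $\mathcal{P}\otimes_{\mathcal{B}}\mathcal{E}$ with $\langle p\otimes x,p'\otimes x'\rangle_{\mathcal{A}}=\langle x,\langle p,p'\rangle_{\mathcal{B}}\cdot x'\rangle_{\mathcal{A}}$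 and $g\triangleright(p\otimes x)=g_{(1)}\triangleright p\otimes g_{(2)}\triangleright x$, divided by the degeneracy space. $\widetilde{\otimes}$ is the same for two equivalence bimodules, with the additional inner product ${}_{\mathcal{C}}\langle y\otimes x,y'\otimes x'\rangle={}_{\mathcal{C}}\langle y\cdot{}_{\mathcal{B}}\langle x,x'\rangle,y'\rangle$. *)

(* Defs.v *)
From HB Require Import structures.
From mathcomp Require Import all_boot all_order all_algebra.
From mathcomp Require Import boolp.
From mathcomp Require Import ring.

Set Implicit Arguments.
Unset Strict Implicit.
Unset Printing Implicit Defensive.

Import Order.TTheory GRing.Theory Num.Theory.
Local Open Scope ring_scope.
Local Open Scope quotient_scope.

(* R[i] of mathcomp-real-closed is a ring only over a field, whereas here R is
   an arbitrary ordered ring.  A (commutative, unital) ordered ring is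
   automatically an integral domain, i.e. a realDomainType. *)

Record cplx (R : realDomainType) := Cplx { Re : R; Im : R }.

Section Cplx.
Variable R : realDomainType.
Local Notation C := (cplx R).

Definition cplx_pair (z : C) : R * R := (Re z, Im z).
Definition pair_cplx (p : R * R) : C := Cplx p.1 p.2.
Lemma cplx_pairK : cancel cplx_pair pair_cplx. Proof. by case. Qed.

HB.instance Definition _ := Choice.copy C (can_type cplx_pairK).

Definition cadd (z w : C) := Cplx (Re z + Re w) (Im z + Im w).
Definition copp (z : C) := Cplx (- Re z) (- Im z).
Definition cmul (z w : C) :=
  Cplx (Re z * Re w - Im z * Im w) (Re z * Im w + Im z * Re w).

Lemma caddA : associative cadd.
Proof. by move=> z w v; rewrite /cadd /= !addrA. Qed.
Lemma caddC : commutative cadd.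
Proof. by move=> z w; rewrite /cadd addrC [Im z + _]addrC. Qed.
Lemma cadd0 : left_id (Cplx 0 0) cadd.
Proof. by case=> a b; rewrite /cadd /= !add0r. Qed.
Lemma caddN : left_inverse (Cplx 0 0) copp cadd.
Proof. by case=> a b; rewrite /cadd /= !addNr. Qed.

HB.instance Definition _ :=
  GRing.isZmodule.Build C caddA caddC cadd0 caddN.

Lemma cmulA : associative cmul.
Proof. by move=> [a b] [c d] [e f]; rewrite /cmul /=; congr Cplx; ring. Qed.
Lemma cmulC : commutative cmul.
Proof. by move=> [a b] [c d]; rewrite /cmul /=; congr Cplx; ring. Qed.
Lemma cmul1 : left_id (Cplx 1 0) cmul.
Proof. by case=> a b; rewrite /cmul /= !mul1r !mul0r subr0 addr0. Qed.
Lemma cmulDl : left_distributive cmul cadd.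
Proof.
by move=> [a b] [c d] [e f]; rewrite /cmul /cadd /=; congr Cplx; ring.
Qed.
Lemma cone_neq0 : Cplx 1 0 != 0 :> C.
Proof. by apply/eqP => -[] /eqP; rewrite oner_eq0. Qed.

HB.instance Definition _ :=
  GRing.Zmodule_isComNzRing.Build C cmulA cmulC cmul1 cmulDl cone_neq0.

Definition cconj (z : C) : C := Cplx (Re z) (- Im z).
Definition cnneg (z : C) : bool := (Im z == 0) && (0 <= Re z).

Lemma cconjD z w : cconj (z + w) = cconj z + cconj w.
Proof. by case: z w => [a b] [c d]; congr Cplx; rewrite /= opprD. Qed.
Lemma cconjM z w : cconj (z * w) = cconj z * cconj w.
Proof.
case: z w => [a b] [c d]; congr Cplx; rewrite /= ?mulrNN //.
by rewrite mulrN mulNr opprD.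
Qed.
Lemma cconjK : involutive cconj.
Proof. by case=> a b; congr Cplx; rewrite /= opprK. Qed.
End Cplx.

(* Unital star-algebras over R[i].  The carrier is a pzRingType rather than an
   algType so that the zero algebra is not excluded. *)
Record starAlg (R : realDomainType) := StarAlg {
  sa_ring : pzRingType;
  sa_scale : cplx R -> sa_ring -> sa_ring;
  sa_star : sa_ring -> sa_ring;
  sa_scaleA : forall c d a, sa_scale c (sa_scale d a) = sa_scale (c * d) a;
  sa_scale1 : left_id 1 sa_scale;
  sa_scaleDr : right_distributive sa_scale +%R;
  sa_scaleDl : forall a, {morph sa_scale^~ a : c d / c + d};
  sa_scaleAl : forall c a b, sa_scale c (a * b) = sa_scale c a * b;
  sa_scaleAr : forall c a b, sa_scale c (a * b) = a * sa_scale c b;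
  sa_starD : forall a b, sa_star (a + b) = sa_star a + sa_star b;
  sa_starZ : forall c a, sa_star (sa_scale c a) = sa_scale (cconj c) (sa_star a);
  sa_starM : forall a b, sa_star (a * b) = sa_star b * sa_star a;
  sa_starK : involutive sa_star
}.

Definition sa_car R (A : starAlg R) : Type := sa_ring A.
Coercion sa_car : starAlg >-> Sortclass.
HB.instance Definition _ R (A : starAlg R) :=
  GRing.PzRing.copy (sa_car A) (sa_ring A).
HB.instance Definition _ R (A : starAlg R) :=
  GRing.Zmodule_isLmodule.Build (cplx R) (sa_car A)
    (@sa_scaleA R A) (@sa_scale1 R A) (@sa_scaleDr R A) (@sa_scaleDl R A).

Definition star R (A : starAlg R) : A -> A := @sa_star R A.

Section StarAlg.
Variables (R : realDomainType) (A : starAlg R).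
Implicit Types (a b : A) (c : cplx R).
Lemma starD a b : star (a + b) = star a + star b. Proof. exact: sa_starD. Qed.
Lemma starZ c a : star (c *: a) = cconj c *: star a. Proof. exact: sa_starZ. Qed.
Lemma starM a b : star (a * b) = star b * star a. Proof. exact: sa_starM. Qed.
Lemma star_involutive : involutive (@star R A). Proof. exact: sa_starK. Qed.
Lemma star0 : star (0 : A) = 0.
Proof. by apply: (addrI (star 0)); rewrite -starD !addr0. Qed.
End StarAlg.

Section Modules.
Variable R : realDomainType.
Local Notation C := (cplx R).

Record is_ract (A : starAlg R) (V : lmodType C) (act : V -> A -> V) : Prop :=
  IsRact {
    ractDl : forall x y a, act (x + y) a = act x a + act y a;
    ractDr : forall x a b, act x (a + b) = act x a + act x b;
    ractZl : forall c x a, act (c *: x) a = c *: act x a;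
    ractZr : forall c x a, act x (c *: a) = c *: act x a;
    ractM : forall x a b, act x (a * b) = act (act x a) b;
    ract1 : forall x, act x 1 = x
  }.

Record is_lact (B : starAlg R) (V : lmodType C) (act : B -> V -> V) : Prop :=
  IsLact {
    lactDl : forall a b x, act (a + b) x = act a x + act b x;
    lactDr : forall b x y, act b (x + y) = act b x + act b y;
    lactZl : forall c b x, act (c *: b) x = c *: act b x;
    lactZr : forall c b x, act b (c *: x) = c *: act b x;
    lactM : forall a b x, act (a * b) x = act a (act b x);
    lact1 : forall x, act 1 x = x
  }.

Record rightMod (A : starAlg R) := RightMod {
  rm_car :> lmodType C;
  ract : rm_car -> A -> rm_car;
  ractP : is_ract ract
}.

Record leftMod (B : starAlg R) := LeftMod {
  lm_car :> lmodType C;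
  lact : B -> lm_car -> lm_car;
  lactP : is_lact lact
}.

Record bimod (B A : starAlg R) := Bimod {
  bm_car :> lmodType C;
  bm_lact : B -> bm_car -> bm_car;
  bm_ract : bm_car -> A -> bm_car;
  bm_lactP : is_lact bm_lact;
  bm_ractP : is_ract bm_ract;
  bm_actA : forall b x a, bm_ract (bm_lact b x) a = bm_lact b (bm_ract x a)
}.

Definition bm_left B A (E : bimod B A) : leftMod B := LeftMod (bm_lactP E).
Definition bm_right B A (E : bimod B A) : rightMod A := RightMod (bm_ractP E).

(* R[i] as a star-algebra over itself, with the lmodType structure on both
   sides, so that the tensor product over R[i] is an instance of the tensor
   product over a star-algebra. *)
Definition cplxAlg : starAlg R :=
  @StarAlg R C (fun c d => c * d) (@cconj R)
    (fun c d a => mulrA c d a) (@mul1r _) (@mulrDr _)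
    (fun a c d => mulrDl c d a) (fun c a b => mulrA c a b)
    (fun c a b => mulrCA c a b) (@cconjD R) (@cconjM R)
    (fun a b => etrans (cconjM a b) (mulrC _ _)) (@cconjK R).

Lemma scalar_ractP (V : lmodType C) :
  @is_ract cplxAlg V (fun x c => c *: x).
Proof.
split=> [x y a|x a b|c x a|c x a|x a b|x].
- exact: scalerDr.
- exact: scalerDl.
- by rewrite !scalerA mulrC.
- by rewrite scalerA.
- by rewrite scalerA mulrC.
- exact: scale1r.
Qed.

Lemma scalar_lactP (V : lmodType C) :
  @is_lact cplxAlg V (fun c x => c *: x).
Proof.
split=> [a b x|b x y|c b x|c b x|a b x|x].
- exact: scalerDl.
- exact: scalerDr.
- by rewrite scalerA.
- by rewrite !scalerA mulrC.
- by rewrite scalerA.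
- exact: scale1r.
Qed.

Definition scalar_right (V : lmodType C) : rightMod cplxAlg :=
  RightMod (scalar_ractP V).
Definition scalar_left (V : lmodType C) : leftMod cplxAlg :=
  LeftMod (scalar_lactP V).

End Modules.

(* P (x)_B E is the set of finite formal sums of pairs (p, x), i.e. lists up to
   order, modulo the congruence generated by biadditivity and balancedness.
   The scalars act through the second factor. *)
Section Tensor.
Variables (R : realDomainType) (B : starAlg R).
Variables (P : rightMod B) (E : leftMod B).
Local Notation C := (cplx R).

Inductive teq : seq (P * E) -> seq (P * E) -> Prop :=
| teq_refl s : teq s s
| teq_sym s t : teq s t -> teq t s
| teq_trans s t u : teq s t -> teq t u -> teq s u
| teq_cat s s' t t' : teq s s' -> teq t t' -> teq (s ++ t) (s' ++ t')
| teq_catC s t : teq (s ++ t) (t ++ s)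
| teq_Dl p p' x : teq [:: (p + p', x)] [:: (p, x); (p', x)]
| teq_Dr p x x' : teq [:: (p, x + x')] [:: (p, x); (p, x')]
| teq_0l x : teq [:: (0, x)] [::]
| teq_bal p b x : teq [:: (ract p b, x)] [:: (p, lact b x)].

Definition teqb : rel (seq (P * E)) := fun s t => `[< teq s t >].

Lemma teqb_equiv : equiv_class_of teqb.
Proof.
split=> [s|s t|t s u].
- by apply/asboolP; exact: teq_refl.
- by apply/asboolP/asboolP; exact: teq_sym.
- by move=> /asboolP st /asboolP tu; apply/asboolP/(teq_trans st tu).
Qed.

Canonical teqb_equiv_rel := EquivRelPack teqb_equiv.
Canonical teqb_encModRel := defaultEncModRel teqb.

Definition tensor := {eq_quot teqb}.
HB.instance Definition _ : EqQuotient _ teqb tensor := EqQuotient.on tensor.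
HB.instance Definition _ := Choice.on tensor.

Definition tcls (s : seq (P * E)) : tensor := \pi_tensor s.
Definition pure (p : P) (x : E) : tensor := tcls [:: (p, x)].

Lemma tclsP s t : tcls s = tcls t <-> teq s t.
Proof.
by split=> [/eqquotP/asboolP|st] //; apply/eqquotP/asboolP.
Qed.

Lemma teq_repr s : teq (repr (tcls s)) s.
Proof. by apply/tclsP; rewrite /tcls reprK. Qed.

Lemma tensorW (K : tensor -> Prop) : (forall s, K (tcls s)) -> forall t, K t.
Proof. by move=> Ks t; rewrite -[t]reprK; exact: Ks. Qed.

Definition topp_seq (s : seq (P * E)) := [seq (- q.1, q.2) | q <- s].
Definition tscale_seq (c : C) (s : seq (P * E)) := [seq (q.1, c *: q.2) | q <- s].

Lemma teq_opp s t : teq s t -> teq (topp_seq s) (topp_seq t).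
Proof.
elim=> {s t} [s|s t _|s t u _ + _|s s' t t' _ + _|s t|p p' x|p x x'|x|p b x].
- exact: teq_refl.
- exact: teq_sym.
- exact: teq_trans.
- by rewrite /topp_seq !map_cat; exact: teq_cat.
- by rewrite /topp_seq !map_cat; exact: teq_catC.
- by rewrite /= opprD; exact: teq_Dl.
- exact: teq_Dr.
- by rewrite /= oppr0; exact: teq_0l.
- suff -> : topp_seq [:: (ract p b, x)] = [:: (ract (- p) b, x)].
    exact: teq_bal.
  congr [:: (_, _)] => /=; apply/eqP; rewrite eq_sym -addr_eq0.
  rewrite -(ractDl (ractP P)) addNr; apply/eqP.
  by rewrite -(addrK (ract 0 b) (ract 0 b)) -(ractDl (ractP P)) addr0 subrr.
Qed.

Lemma teq_scale c s t : teq s t -> teq (tscale_seq c s) (tscale_seq c t).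
Proof.
elim=> {s t} [s|s t _|s t u _ + _|s s' t t' _ + _|s t|p p' x|p x x'|x|p b x].
- exact: teq_refl.
- exact: teq_sym.
- exact: teq_trans.
- by rewrite /tscale_seq !map_cat; exact: teq_cat.
- by rewrite /tscale_seq !map_cat; exact: teq_catC.
- exact: teq_Dl.
- by rewrite /= scalerDr; exact: teq_Dr.
- exact: teq_0l.
- by rewrite /= -(lactZr (lactP E)); exact: teq_bal.
Qed.

Definition tadd (t u : tensor) : tensor := tcls (repr t ++ repr u).
Definition topp (t : tensor) : tensor := tcls (topp_seq (repr t)).
Definition tscale (c : C) (t : tensor) : tensor := tcls (tscale_seq c (repr t)).

Lemma tadd_cls s t : tadd (tcls s) (tcls t) = tcls (s ++ t).
Proof. by apply/tclsP/teq_cat; exact: teq_repr. Qed.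
Lemma topp_cls s : topp (tcls s) = tcls (topp_seq s).
Proof. by apply/tclsP/teq_opp/teq_repr. Qed.
Lemma tscale_cls c s : tscale c (tcls s) = tcls (tscale_seq c s).
Proof. by apply/tclsP/teq_scale/teq_repr. Qed.

Lemma taddA : associative tadd.
Proof.
by elim/tensorW=> s; elim/tensorW=> t; elim/tensorW=> u; rewrite !tadd_cls catA.
Qed.
Lemma taddC : commutative tadd.
Proof.
elim/tensorW=> s; elim/tensorW=> t; rewrite !tadd_cls.
by apply/tclsP; exact: teq_catC.
Qed.
Lemma tadd0 : left_id (tcls [::]) tadd.
Proof. by elim/tensorW=> s; rewrite tadd_cls. Qed.
Lemma taddN : left_inverse (tcls [::]) topp tadd.
Proof.
elim/tensorW; elim=> [|[p x] s IH]; rewrite topp_cls tadd_cls //=.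
have -> : (- p, x) :: topp_seq s ++ (p, x) :: s =
  ([:: (- p, x)] ++ topp_seq s) ++ ([:: (p, x)] ++ s) by rewrite -!catA.
rewrite -!tadd_cls -taddA (taddC _ (tadd (tcls [:: (p, x)]) _)) -!taddA.
rewrite (taddC (tcls s)) -topp_cls IH taddA (taddC _ (tcls [::])) tadd0.
rewrite tadd_cls; apply/tclsP/(teq_trans (teq_sym (teq_Dl _ _ _))).
by rewrite addNr; exact: teq_0l.
Qed.

HB.instance Definition _ :=
  GRing.isZmodule.Build tensor taddA taddC tadd0 taddN.

Lemma tcls_cat s t : tcls (s ++ t) = tcls s + tcls t.
Proof. by rewrite -tadd_cls. Qed.

Lemma tscaleA c d t : tscale c (tscale d t) = tscale (c * d) t.
Proof.
elim/tensorW: t => s; rewrite !tscale_cls /tscale_seq -map_comp.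
by congr tcls; apply: eq_map => q /=; rewrite scalerA.
Qed.
Lemma tscale1 : left_id 1 tscale.
Proof.
elim/tensorW=> s; rewrite tscale_cls /tscale_seq.
by congr tcls; elim: s => //= -[p x] s ->; rewrite scale1r.
Qed.
Lemma tscaleDr : right_distributive tscale +%R.
Proof.
move=> c; elim/tensorW=> s; elim/tensorW=> t.
by rewrite -tcls_cat !tscale_cls /tscale_seq map_cat tcls_cat.
Qed.
Lemma tscaleDl t : {morph tscale^~ t : c d / c + d}.
Proof.
move=> c d; elim/tensorW: t; elim=> [|[p x] s IH].
  by rewrite !tscale_cls /= addr0.
rewrite -cat1s tcls_cat !tscaleDr IH addrACA; congr (_ + _).
rewrite !tscale_cls -tcls_cat /= scalerDl; apply/tclsP; exact: teq_Dr.
Qed.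

HB.instance Definition _ :=
  GRing.Zmodule_isLmodule.Build C tensor tscaleA tscale1 tscaleDr tscaleDl.

Record balanced (V : zmodType) (f : P -> E -> V) : Prop := Balanced {
  balDl : forall p p' x, f (p + p') x = f p x + f p' x;
  balDr : forall p x x', f p (x + x') = f p x + f p x';
  bal_act : forall p b x, f (ract p b) x = f p (lact b x)
}.

Lemma pure_balanced : balanced pure.
Proof.
split=> [p p' x|p x x'|p b x].
- by rewrite /pure -tcls_cat; apply/tclsP; exact: teq_Dl.
- by rewrite /pure -tcls_cat; apply/tclsP; exact: teq_Dr.
- by apply/tclsP; exact: teq_bal.
Qed.

(* The map induced by f on the tensor product; by tlift_pure below it does not
   depend on representatives when f is balanced. *)
Definition tlift (V : zmodType) (f : P -> E -> V) (t : tensor) : V :=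
  \sum_(q <- repr t) f q.1 q.2.

Lemma tlift_cls (V : zmodType) (f : P -> E -> V) : balanced f ->
  forall s, tlift f (tcls s) = \sum_(q <- s) f q.1 q.2.
Proof.
move=> bf s0; rewrite /tlift; move: (repr _) (teq_repr s0) => r.
elim=> {r s0} //.
- by move=> s t u _ -> _ ->.
- by move=> s s' t t' _ IH1 _ IH2; rewrite !big_cat /= IH1 IH2.
- by move=> s t; rewrite !big_cat /= addrC.
- by move=> p p' x; rewrite !big_cons big_nil /= !addr0; exact: balDl.
- by move=> p x x'; rewrite !big_cons big_nil /= !addr0; exact: balDr.
- move=> x; rewrite big_cons !big_nil /= addr0.
  by apply: (addrI (f 0 x)); rewrite -(balDl bf) !addr0.
- by move=> p b x; rewrite !big_cons !big_nil /= (bal_act bf).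
Qed.

Lemma tlift_pure (V : zmodType) (f : P -> E -> V) : balanced f ->
  forall p x, tlift f (pure p x) = f p x.
Proof. by move=> bf p x; rewrite tlift_cls // big_cons big_nil addr0. Qed.

Lemma tliftD (V : zmodType) (f : P -> E -> V) : balanced f ->
  {morph tlift f : t u / t + u}.
Proof.
move=> bf; elim/tensorW=> s; elim/tensorW=> t.
by rewrite -tcls_cat !tlift_cls // big_cat.
Qed.

Lemma tlift0 (V : zmodType) (f : P -> E -> V) : balanced f -> tlift f 0 = 0.
Proof. by move=> bf; rewrite -[0 in LHS]/(tcls [::]) tlift_cls // big_nil. Qed.

Lemma scale_pure c p x : c *: pure p x = pure p (c *: x).
Proof. exact: tscale_cls. Qed.

Lemma tensor_ind (K : tensor -> Prop) :
  K 0 -> (forall p x t, K t -> K (pure p x + t)) -> forall t, K t.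
Proof.
move=> K0 KD; elim/tensorW; elim=> [|[p x] s IH]; first exact: K0.
by rewrite -cat1s tcls_cat; exact: KD.
Qed.

End Tensor.

Section Hopf.
Variable R : realDomainType.
Local Notation C := (cplx R).

Definition tensC (V W : lmodType C) := tensor (scalar_right V) (scalar_left W).
Definition pureC (V W : lmodType C) (v : V) (w : W) : tensC V W :=
  @pure _ _ (scalar_right V) (scalar_left W) v w.

Section HopfAxioms.
Variables (H : starAlg R) (Delta : H -> tensC H H).
Variables (eps : H -> C) (S : H -> H).

Definition sweedler (V : zmodType) (f : H -> H -> V) (g : H) : V :=
  @tlift _ _ (scalar_right H) (scalar_left H) V f (Delta g).

Record is_hopf_star : Prop := IsHopfStar {
  coprodD : forall g h, Delta (g + h) = Delta g + Delta h;
  coprodZ : forall c g, Delta (c *: g) = c *: Delta g;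
  coprodM : forall g h, Delta (g * h) =
    sweedler (fun g1 g2 =>
      sweedler (fun h1 h2 => pureC (g1 * h1) (g2 * h2)) h) g;
  coprod1 : Delta 1 = pureC (1 : H) (1 : H);
  coprod_star : forall g,
    Delta (star g) = sweedler (fun g1 g2 => pureC (star g1) (star g2)) g;
  (* (Delta (x) id) Delta = (id (x) Delta) Delta, in H (x) (H (x) H) *)
  coassoc : forall g,
    sweedler (fun g1 g2 =>
      sweedler (fun a b => pureC a (pureC b g2)) g1) g =
    sweedler (fun g1 g2 => pureC g1 (Delta g2)) g;
  counitD : forall g h, eps (g + h) = eps g + eps h;
  counitZ : forall c g, eps (c *: g) = c * eps g;
  counitM : forall g h, eps (g * h) = eps g * eps h;
  counit1 : eps 1 = 1;
  counit_star : forall g, eps (star g) = cconj (eps g);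
  counit_l : forall g, sweedler (fun g1 g2 => eps g1 *: g2) g = g;
  counit_r : forall g, sweedler (fun g1 g2 => eps g2 *: g1) g = g;
  antipodeD : forall g h, S (g + h) = S g + S h;
  antipodeZ : forall c g, S (c *: g) = c *: S g;
  antipode_l : forall g, sweedler (fun g1 g2 => S g1 * g2) g = eps g *: (1 : H);
  antipode_r : forall g, sweedler (fun g1 g2 => g1 * S g2) g = eps g *: (1 : H);
  antipode_star : forall g, star (S (star (S g))) = g
}.
End HopfAxioms.

Record hopfStarAlg := HopfStarAlg {
  hopf_alg :> starAlg R;
  coprod : hopf_alg -> tensC hopf_alg hopf_alg;
  counit : hopf_alg -> C;
  antipode : hopf_alg -> hopf_alg;
  hopfP : is_hopf_star coprod counit antipode
}.

Section Actions.
Variable H : hopfStarAlg.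

(* \sum f g_(1) g_(2) *)
Definition sw (V : zmodType) (f : H -> H -> V) (g : H) : V :=
  sweedler (@coprod H) f g.

Record is_hact (V : lmodType C) (act : H -> V -> V) : Prop := IsHact {
  hactDl : forall g h x, act (g + h) x = act g x + act h x;
  hactDr : forall g x y, act g (x + y) = act g x + act g y;
  hactZl : forall c g x, act (c *: g) x = c *: act g x;
  hactZr : forall c g x, act g (c *: x) = c *: act g x;
  hactM : forall g h x, act (g * h) x = act g (act h x);
  hact1 : forall x, act 1 x = x
}.

Record hstarAlg := HStarAlg {
  ha_alg :> starAlg R;
  ha_act : H -> ha_alg -> ha_alg;
  ha_actP : is_hact ha_act;
  ha_act_mul : forall g a b,
    ha_act g (a * b) = sw (fun g1 g2 => ha_act g1 a * ha_act g2 b) g;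
  ha_act_star : forall g a,
    star (ha_act g a) = ha_act (star (antipode g)) (star a);
  ha_act_unit : forall g, ha_act g (1 : ha_alg) = counit g *: (1 : ha_alg)
}.

End Actions.
End Hopf.

Section Positivity.
Variables (R : realDomainType) (A : starAlg R).
Local Notation C := (cplx R).

(* Positive linear functionals on, and positive elements of, the star-algebra
   M_n(A).  It is spelled out because the scalar multiplication that mathcomp
   puts on 'M[A]_n is that of A, not that of R[i]. *)
Record mx_pos_functional (n : nat) (w : 'M[A]_n -> C) : Prop :=
  MxPosFunctional {
    mpfD : forall M N : 'M[A]_n, w (M + N) = w M + w N;
    mpfZ : forall (c : C) (M : 'M[A]_n), w (map_mx (fun a : A => c *: a) M) = c * w M;
    mpf_ge0 : forall M : 'M[A]_n, cnneg (w ((map_mx (@star R A) M)^T *m M))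
  }.

Definition mx_positive (n : nat) (M : 'M[A]_n) : Prop :=
  forall w, mx_pos_functional w -> cnneg (w M).

Definition completely_positive (X : Type) (ip : X -> X -> A) : Prop :=
  forall (n : nat) (x : 'I_n -> X), mx_positive (\matrix_(i, j) ip (x i) (x j)).

Definition full (X : Type) (ip : X -> X -> A) : Prop :=
  forall a, exists s : seq (C * (X * X)),
    a = \sum_(q <- s) q.1 *: ip q.2.1 q.2.2.

Definition nondegenerate (X : zmodType) (ip : X -> X -> A) : Prop :=
  forall x, (forall y, ip x y = 0) -> x = 0.

Record is_rip (P : rightMod A) (ip : P -> P -> A) : Prop := IsRip {
  ripDr : forall x y z, ip x (y + z) = ip x y + ip x z;
  ripZr : forall c x y, ip x (c *: y) = c *: ip x y;
  ripMr : forall x y a, ip x (ract y a) = ip x y * a;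
  ripC : forall x y, ip x y = star (ip y x)
}.

Record is_lip (E : leftMod A) (ip : E -> E -> A) : Prop := IsLip {
  lipDl : forall x y z, ip (x + y) z = ip x z + ip y z;
  lipZl : forall c x y, ip (c *: x) y = c *: ip x y;
  lipMl : forall a x y, ip (lact a x) y = a * ip x y;
  lipC : forall x y, ip x y = star (ip y x)
}.

Definition right_linear (P Q : rightMod A) (f : P -> Q) : Prop :=
  (forall x y, f (x + y) = f x + f y) /\ (forall x a, f (ract x a) = ract (f x) a).

Definition fin_generated (P : rightMod A) : Prop :=
  exists (n : nat) (e : 'I_n -> P),
    forall x, exists a : 'I_n -> A, x = \sum_i ract (e i) (a i).

Definition projective (P : rightMod A) : Prop :=
  forall (M N : rightMod A) (f : M -> N) (g : P -> N),
    right_linear f -> (forall y, exists x, f x = y) -> right_linear g ->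
    exists2 h : P -> M, right_linear h & forall x, f (h x) = g x.

Lemma regular_ractP : @is_ract R A A (fun a b => a * b).
Proof.
split=> [x y a|x a b|c x a|c x a|x a b|x].
- exact: mulrDl.
- exact: mulrDr.
- by symmetry; exact: sa_scaleAl.
- by symmetry; exact: sa_scaleAr.
- exact: mulrA.
- exact: mulr1.
Qed.

Lemma regular_lactP : @is_lact R A A (fun a b => a * b).
Proof.
split=> [a b x|b x y|c b x|c b x|a b x|x].
- exact: mulrDl.
- exact: mulrDr.
- by symmetry; exact: sa_scaleAl.
- by symmetry; exact: sa_scaleAr.
- by rewrite mulrA.
- exact: mul1r.
Qed.

Definition regular_right : rightMod A := RightMod regular_ractP.

(* Bijectivity of P -> Hom_A(P, A), x |-> <x, .> *)
Definition strongly_nondegenerate (P : rightMod A) (ip : P -> P -> A) : Prop :=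
  forall phi : P -> regular_right, right_linear phi ->
    exists! x : P, forall y, phi y = ip x y.

Definition regular_bimod : bimod A A :=
  @Bimod R A A A _ _ regular_lactP regular_ractP
    (fun b x a => esym (mulrA b x a)).

End Positivity.

Section Objects.
Variables (R : realDomainType) (H : hopfStarAlg R).
Local Notation C := (cplx R).

(* The operation of H is only data here; that it is an H-module structure and
   that the inner products are covariant is part of is_proj and is_pic below. *)
Record ipMod (A : hstarAlg H) := IpMod {
  ipm_mod :> rightMod A;
  ip : ipm_mod -> ipm_mod -> A;
  ipP : is_rip ip;
  hact : H -> ipm_mod -> ipm_mod
}.

Record ipBimod (B A : hstarAlg H) := IpBimod {
  ipb_bimod :> bimod B A;
  lip : ipb_bimod -> ipb_bimod -> B;
  rip : ipb_bimod -> ipb_bimod -> A;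
  bhact : H -> ipb_bimod -> ipb_bimod
}.

Definition right_covariant (A : hstarAlg H) (X : Type)
    (act : H -> X -> X) (ip : X -> X -> A) : Prop :=
  forall g x y, ha_act g (ip x y) =
    sw (fun g1 g2 => ip (act (star (antipode g1)) x) (act g2 y)) g.

Definition left_covariant (B : hstarAlg H) (X : Type)
    (act : H -> X -> X) (ip : X -> X -> B) : Prop :=
  forall g x y, ha_act g (ip x y) =
    sw (fun g1 g2 => ip (act g1 x) (act (star (antipode g2)) y)) g.

(* Throughout, str = true is the strong version (complete positivity
   required) and str = false is the star-version. *)
Record is_proj (str : bool) (A : hstarAlg H) (P : ipMod A) : Prop := IsProj {
  proj_hact : is_hact (@hact _ P);
  proj_cov : right_covariant (@hact _ P) (@ip _ P);
  proj_fg : fin_generated P;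
  proj_proj : projective P;
  proj_nondeg : strongly_nondegenerate (@ip _ P);
  proj_cp : str -> completely_positive (@ip _ P)
}.

Record is_pic (str : bool) (B A : hstarAlg H) (E : ipBimod B A) : Prop := IsPic {
  pic_lip : @is_lip _ B (bm_left E) (@lip _ _ E);
  pic_rip : @is_rip _ A (bm_right E) (@rip _ _ E);
  pic_lfull : full (@lip _ _ E);
  pic_rfull : full (@rip _ _ E);
  pic_lnondeg : nondegenerate (@lip _ _ E);
  pic_rnondeg : nondegenerate (@rip _ _ E);
  pic_ladj : forall b (x y : E), rip (bm_lact b x) y = rip x (bm_lact (star b) y);
  pic_radj : forall a (x y : E), lip (bm_ract x a) y = lip x (bm_ract y (star a));
  pic_compat : forall x y z : E, bm_lact (lip x y) z = bm_ract x (rip y z);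
  pic_hact : is_hact (@bhact _ _ E);
  pic_rcov : right_covariant (@bhact _ _ E) (@rip _ _ E);
  pic_lcov : left_covariant (@bhact _ _ E) (@lip _ _ E);
  pic_lcp : str -> completely_positive (@lip _ _ E);
  pic_rcp : str -> completely_positive (@rip _ _ E)
}.

Record projObj (str : bool) (A : hstarAlg H) := ProjObj {
  proj_mod :> ipMod A;
  projP : is_proj str proj_mod
}.

Record picObj (str : bool) (B A : hstarAlg H) := PicObj {
  pic_bimod :> ipBimod B A;
  picP : is_pic str pic_bimod
}.

Definition proj_iso (A : hstarAlg H) (P Q : ipMod A) : Prop :=
  exists f : P -> Q,
    [/\ bijective f,
        right_linear f,
        forall g x, f (hact g x) = hact g (f x)
      & forall x y, ip (f x) (f y) = ip x y].

Record pic_iso_map (B A : hstarAlg H) (E F : ipBimod B A) (f : E -> F) : Prop :=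
  PicIsoMap {
    pim_bij : bijective f;
    pim_D : forall x y, f (x + y) = f x + f y;
    pim_lact : forall b x, f (bm_lact b x) = bm_lact b (f x);
    pim_ract : forall x a, f (bm_ract x a) = bm_ract (f x) a;
    pim_hact : forall g x, f (bhact g x) = bhact g (f x);
    pim_lip : forall x y, lip (f x) (f y) = lip x y;
    pim_rip : forall x y, rip (f x) (f y) = rip x y
  }.

Definition pic_iso (B A : hstarAlg H) (E F : ipBimod B A) : Prop :=
  exists f : E -> F, pic_iso_map f.

Definition unit_bimod (A : hstarAlg H) : ipBimod A A :=
  @IpBimod A A (regular_bimod A) (fun a b => a * star b) (fun a b => star a * b)
    (@ha_act _ _ A).

End Objects.

Section InternalTensor.
Variables (R : realDomainType) (H : hopfStarAlg R) (str : bool).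
Variables (B A : hstarAlg H) (P : ipMod B) (E : picObj str B A).
Local Notation C := (cplx R).

Local Notation T := (tensor P (bm_left E)).
Local Notation "p \ox x" := (@pure _ _ P (bm_left E) p x) (at level 40).
Let lP := bm_lactP E.
Let rP := bm_ractP E.

Lemma ipDl (p p' q : P) : ip (p + p') q = ip p q + ip p' q.
Proof. by rewrite (ripC (ipP P)) (ripDr (ipP P)) starD -!(ripC (ipP P)). Qed.
Lemma ipMl (p q : P) b : ip (ract p b) q = star b * ip p q.
Proof. by rewrite (ripC (ipP P)) (ripMr (ipP P)) starM -(ripC (ipP P)). Qed.
Lemma rip_Dl (x y z : E) : rip (x + y) z = rip x z + rip y z.
Proof.
have r := pic_rip (picP E).
by rewrite (ripC r) (ripDr r) starD -!(ripC r).
Qed.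
Lemma rip_Dr (x y z : E) : rip x (y + z) = rip x y + rip x z.
Proof. exact: (ripDr (pic_rip (picP E))). Qed.
Lemma rip_Mr (x y : E) a : rip x (bm_ract y a) = rip x y * a.
Proof. exact: (ripMr (pic_rip (picP E))). Qed.
Lemma rip_Zr c (x y : E) : rip x (c *: y) = c *: rip x y.
Proof. exact: (ripZr (pic_rip (picP E))). Qed.
Lemma rip_star (x y : E) : star (rip x y) = rip y x.
Proof. by rewrite -(ripC (pic_rip (picP E))). Qed.

(* <p (x) x, p' (x) x'> = <x, <p, p'> x'> *)
Definition tip_pure (p : P) (x : E) : T -> A :=
  @tlift _ _ P (bm_left E) A (fun p' x' => rip x (bm_lact (ip p p') x')).
Definition tip (t u : T) : A :=
  @tlift _ _ P (bm_left E) A (fun p x => tip_pure p x u) t.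

Lemma tip_inner_bal (p : P) (x : E) :
  @balanced _ _ P (bm_left E) A (fun p' x' => rip x (bm_lact (ip p p') x')).
Proof.
split=> [q q' y|q y y'|q b y].
- by rewrite (ripDr (ipP P)) (lactDl lP) rip_Dr.
- by rewrite (lactDr lP) rip_Dr.
- by rewrite (ripMr (ipP P)) (lactM lP).
Qed.

Lemma tip_pureE p x q y : tip_pure p x (q \ox y) = rip x (bm_lact (ip p q) y).
Proof. exact: (tlift_pure (tip_inner_bal p x)). Qed.

Lemma tip_pureD p x : {morph tip_pure p x : t u / t + u}.
Proof. exact: (tliftD (tip_inner_bal p x)). Qed.

Lemma tip_pure0 p x : tip_pure p x 0 = 0.
Proof. exact: (tlift0 (tip_inner_bal p x)). Qed.

Lemma tip_outer_bal u :
  @balanced _ _ P (bm_left E) A (fun p x => tip_pure p x u).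
Proof.
split=> [p p' x|p x x'|p b x]; elim/(@tensor_ind _ _ P (bm_left E)): u => [|q y u IH];
    rewrite ?tip_pure0 ?addr0 // !tip_pureD !tip_pureE IH.
- by rewrite ipDl (lactDl lP) rip_Dr addrACA.
- by rewrite rip_Dl addrACA.
- congr (_ + _); rewrite ipMl (lactM lP) (pic_ladj (picP E)) //.
Qed.

Lemma tipDl t t' u : tip (t + t') u = tip t u + tip t' u.
Proof. exact: (tliftD (tip_outer_bal u)). Qed.
Lemma tip0l u : tip 0 u = 0.
Proof. exact: (tlift0 (tip_outer_bal u)). Qed.
Lemma tip_pl p x u : tip (p \ox x) u = tip_pure p x u.
Proof. exact: (tlift_pure (tip_outer_bal u)). Qed.
Lemma tip_pp p x q y : tip (p \ox x) (q \ox y) = rip x (bm_lact (ip p q) y).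
Proof. by rewrite tip_pl tip_pureE. Qed.

Lemma tipDr t u u' : tip t (u + u') = tip t u + tip t u'.
Proof.
elim/(@tensor_ind _ _ P (bm_left E)): t => [|p x t IH]; rewrite ?tip0l ?addr0 //.
by rewrite !tipDl IH !tip_pl tip_pureD addrACA.
Qed.
Lemma tip0r t : tip t 0 = 0.
Proof. by apply: (addrI (tip t 0)); rewrite -tipDr !addr0. Qed.

Lemma tipC t u : tip t u = star (tip u t).
Proof.
elim/(@tensor_ind _ _ P (bm_left E)): t u => [|p x t IH] u.
  by rewrite tip0l tip0r star0.
rewrite tipDl tipDr starD IH; congr (_ + _); clear IH.
elim/(@tensor_ind _ _ P (bm_left E)): u => [|q y u IHu].
  by rewrite tip0l tip0r star0.
rewrite tipDl tipDr starD IHu; congr (_ + _).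
by rewrite !tip_pp rip_star (pic_ladj (picP E)) -(ripC (ipP P)).
Qed.

Lemma tipZr c t u : tip t (c *: u) = c *: tip t u.
Proof.
elim/(@tensor_ind _ _ P (bm_left E)): t => [|p x t IH].
  by rewrite !tip0l scaler0.
rewrite !tipDl IH scalerDr; congr (_ + _); clear IH.
elim/(@tensor_ind _ _ P (bm_left E)): u => [|q y u IHu].
  by rewrite scaler0 !tip0r scaler0.
rewrite scalerDr !tipDr IHu scale_pure scalerDr; congr (_ + _).
by rewrite !tip_pp (lactZr lP) rip_Zr.
Qed.

Definition tract (t : T) (a : A) : T :=
  @tlift _ _ P (bm_left E) T (fun p x => p \ox bm_ract x a) t.

Lemma tract_bal a :
  @balanced _ _ P (bm_left E) T (fun p x => p \ox bm_ract x a).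
Proof.
have bp := pure_balanced P (bm_left E).
split=> [p p' x|p x x'|p b x].
- exact: (balDl bp).
- by rewrite (ractDl rP); exact: (balDr bp).
- by rewrite (bal_act bp) bm_actA.
Qed.

Lemma tractD t u a : tract (t + u) a = tract t a + tract u a.
Proof. exact: (tliftD (tract_bal a)). Qed.
Lemma tract0 a : tract 0 a = 0.
Proof. exact: (tlift0 (tract_bal a)). Qed.
Lemma tract_pure p x a : tract (p \ox x) a = p \ox bm_ract x a.
Proof. exact: (tlift_pure (tract_bal a)). Qed.

Lemma tractP : @is_ract R A T tract.
Proof.
have bp := pure_balanced P (bm_left E).
split=> [t u a|t a b|c t a|c t a|t a b|t]; first exact: tractD;
  elim/(@tensor_ind _ _ P (bm_left E)): t => [|p x t IH];
  rewrite ?scaler0 ?tract0 ?scaler0 ?addr0 //.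
- rewrite !tractD IH addrACA !tract_pure (ractDr rP); congr (_ + _).
  exact: (balDr bp).
- rewrite scalerDr !tractD IH scalerDr; congr (_ + _).
  by rewrite scale_pure !tract_pure (ractZl rP) scale_pure.
- rewrite !tractD IH scalerDr; congr (_ + _).
  by rewrite !tract_pure (ractZr rP) scale_pure.
- by rewrite !tractD IH !tract_pure (ractM rP).
- by rewrite tractD IH tract_pure (ract1 rP).
Qed.

Lemma tipMr t u a : tip t (tract u a) = tip t u * a.
Proof.
elim/(@tensor_ind _ _ P (bm_left E)): t => [|p x t IH].
  by rewrite !tip0l mul0r.
rewrite !tipDl IH mulrDl; congr (_ + _); clear IH.
elim/(@tensor_ind _ _ P (bm_left E)): u => [|q y u IHu].
  by rewrite tract0 !tip0r mul0r.
rewrite tractD !tipDr IHu mulrDl tract_pure !tip_pp; congr (_ + _).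
by rewrite -bm_actA rip_Mr.
Qed.

Lemma tipMl t u a : tip (tract t a) u = star a * tip t u.
Proof. by rewrite tipC tipMr starM -tipC. Qed.
Lemma tipZl c t u : tip (c *: t) u = cconj c *: tip t u.
Proof. by rewrite tipC tipZr starZ -tipC. Qed.

(* g (p (x) x) = g_(1) p (x) g_(2) x.  The map lifted here is balanced, and
   preserves degen below, as soon as P and E are H-modules whose inner products
   are covariant and non-degenerate: these imply that H acts compatibly with
   the module structures. *)
Definition thact (g : H) : T -> T :=
  @tlift _ _ P (bm_left E) T
    (fun p x => sw (fun g1 g2 => hact g1 p \ox bhact g2 x) g).

(* The degeneracy space {t | <t, .> = 0} and the quotient by it. *)
Definition degen : {pred T} := fun t => `[< forall u, tip t u = 0 >].

Lemma degenP t : reflect (forall u, tip t u = 0) (t \in degen).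
Proof. exact: asboolP. Qed.

Fact degen_zmod : zmod_closed degen.
Proof.
split=> [|t t' /degenP t0 /degenP t'0]; apply/degenP => u; first exact: tip0l.
rewrite tipDl t0 add0r; apply: (addrI (tip t' u)).
by rewrite -tipDl subrr tip0l addr0 t'0.
Qed.
HB.instance Definition _ := GRing.isZmodClosed.Build T degen degen_zmod.

Definition itens := Quotient.quot degen.
HB.instance Definition _ := GRing.Zmodule.on itens.

Definition icls (t : T) : itens := \pi_itens t.

Lemma iclsP t t' : icls t = icls t' <-> forall u, tip t u = tip t' u.
Proof.
have tipN u v : tip (- u) v = - tip u v.
  by apply/eqP; rewrite -addr_eq0 -tipDl addNr tip0l.
split=> [|tt'].
  move/eqP; rewrite -Quotient.idealrBE => /degenP tt' u.
  by apply/eqP; rewrite -subr_eq0 -tipN -tipDl tt'.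
apply/eqP; rewrite -Quotient.idealrBE; apply/degenP => u.
by rewrite tipDl tipN tt' subrr.
Qed.

Lemma tip_repr_icls t u : tip (repr (icls t)) u = tip t u.
Proof. by apply: (iclsP _ _).1; rewrite /icls reprK. Qed.
Lemma tip_repr_iclsr t u : tip u (repr (icls t)) = tip u t.
Proof. by rewrite tipC tip_repr_icls -tipC. Qed.

Lemma itensW (K : itens -> Prop) : (forall t, K (icls t)) -> forall x, K x.
Proof. by move=> Kt x; rewrite -[x]reprK; exact: Kt. Qed.

Lemma iclsD t u : icls (t + u) = icls t + icls u.
Proof. exact: raddfD. Qed.

Definition iscale (c : C) (x : itens) : itens := icls (c *: repr x).
Definition iract (x : itens) (a : A) : itens := icls (tract (repr x) a).
Definition iip (x y : itens) : A := tip (repr x) (repr y).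
Definition ihact (g : H) (x : itens) : itens := icls (thact g (repr x)).

Lemma iscale_icls c t : iscale c (icls t) = icls (c *: t).
Proof. by apply/iclsP => u; rewrite !tipZl tip_repr_icls. Qed.
Lemma iract_icls t a : iract (icls t) a = icls (tract t a).
Proof. by apply/iclsP => u; rewrite !tipMl tip_repr_icls. Qed.
Lemma iip_icls t u : iip (icls t) (icls u) = tip t u.
Proof. by rewrite /iip tip_repr_icls tip_repr_iclsr. Qed.

Lemma iscaleA c d x : iscale c (iscale d x) = iscale (c * d) x.
Proof. by elim/itensW: x => t; rewrite !iscale_icls scalerA. Qed.
Lemma iscale1 : left_id 1 iscale.
Proof. by elim/itensW=> t; rewrite iscale_icls scale1r. Qed.
Lemma iscaleDr : right_distributive iscale +%R.
Proof.
move=> c; elim/itensW=> t; elim/itensW=> u.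
by rewrite -iclsD !iscale_icls scalerDr iclsD.
Qed.
Lemma iscaleDl x : {morph iscale^~ x : c d / c + d}.
Proof.
by move=> c d; elim/itensW: x => t; rewrite !iscale_icls scalerDl iclsD.
Qed.
HB.instance Definition _ :=
  GRing.Zmodule_isLmodule.Build C itens iscaleA iscale1 iscaleDr iscaleDl.

Lemma iclsZ c t : icls (c *: t) = c *: icls t.
Proof. by rewrite -iscale_icls. Qed.

Lemma iractP : @is_ract R A itens iract.
Proof.
split=> [x y a|x a b|c x a|c x a|x a b|x].
- elim/itensW: x => t; elim/itensW: y => u.
  by rewrite -iclsD !iract_icls (ractDl tractP) iclsD.
- by elim/itensW: x => t; rewrite !iract_icls (ractDr tractP) iclsD.
- by elim/itensW: x => t; rewrite -iclsZ !iract_icls (ractZl tractP) iclsZ.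
- by elim/itensW: x => t; rewrite !iract_icls (ractZr tractP) iclsZ.
- by elim/itensW: x => t; rewrite !iract_icls (ractM tractP).
- by elim/itensW: x => t; rewrite iract_icls (ract1 tractP).
Qed.

Definition itens_mod : rightMod A := RightMod iractP.

Lemma iipP : @is_rip R A itens_mod iip.
Proof.
split=> [x y z|c x y|x y a|x y]; elim/itensW: x => t; elim/itensW: y => u.
- by elim/itensW: z => v; rewrite -iclsD !iip_icls tipDr.
- by rewrite -iclsZ !iip_icls tipZr.
- by rewrite -[ract _ _]/(iract _ _) iract_icls !iip_icls tipMr.
- by rewrite !iip_icls tipC.
Qed.

(* P \hat{\otimes}_B E *)
Definition ptens : ipMod A := @IpMod R H A itens_mod iip iipP ihact.

End InternalTensor.

Section BimoduleTensor.
Variables (R : realDomainType) (H : hopfStarAlg R) (str : bool).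
Variables (D B A : hstarAlg H) (F : picObj str D B) (E : picObj str B A).
Local Notation C := (cplx R).

Definition pic_ipmod : ipMod B :=
  @IpMod R H B (bm_right F) (@rip _ _ _ _ F) (pic_rip (picP F)) (@bhact _ _ _ _ F).

Local Notation P := pic_ipmod.
Local Notation T := (tensor P (bm_left E)).
Local Notation pure := (@pure _ _ P (bm_left E)).
Local Notation Q := (itens P E).
Local Notation icls := (@icls _ _ _ _ _ P E).
Let lF := bm_lactP F.
Let lE := bm_lactP E.

Definition tlact (d : D) : T -> T :=
  @tlift _ _ P (bm_left E) T (fun y x => pure (bm_lact d y) x).

Lemma tlact_bal d :
  @balanced _ _ P (bm_left E) T (fun y x => pure (bm_lact d y) x).
Proof.
have bp := pure_balanced P (bm_left E).
split=> [p p' x|p x x'|p b x].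
- by rewrite (lactDr lF); exact: (balDl bp).
- exact: (balDr bp).
- by rewrite -(bal_act bp) /ract /= bm_actA.
Qed.

Lemma tlactD d t u : tlact d (t + u) = tlact d t + tlact d u.
Proof. exact: (tliftD (tlact_bal d)). Qed.
Lemma tlact0 d : tlact d 0 = 0.
Proof. exact: (tlift0 (tlact_bal d)). Qed.
Lemma tlact_pure d y x : tlact d (pure y x) = pure (bm_lact d y) x.
Proof. exact: (tlift_pure (tlact_bal d)). Qed.

Lemma pureZl c (y : F) (x : E) : pure (c *: y) x = c *: pure y x.
Proof.
have bp := pure_balanced P (bm_left E).
have -> : c *: y = bm_ract y (c *: (1 : B)).
  by rewrite (ractZr (bm_ractP F)) (ract1 (bm_ractP F)).
rewrite scale_pure (bal_act bp) /lact /=.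
by rewrite (lactZl lE) (lact1 lE).
Qed.

Lemma tlactP : @is_lact R D T tlact.
Proof.
have bp := pure_balanced P (bm_left E).
split=> [a b t|d t u|c d t|c d t|a b t|t]; try exact: tlactD;
  elim/(@tensor_ind _ _ P (bm_left E)): t => [|y x t IH];
  rewrite ?scaler0 ?tlact0 ?scaler0 ?addr0 //.
- rewrite !tlactD IH addrACA !tlact_pure (lactDl lF); congr (_ + _).
  exact: (balDl bp).
- rewrite !tlactD IH scalerDr; congr (_ + _).
  by rewrite !tlact_pure (lactZl lF) pureZl.
- rewrite scalerDr !tlactD IH scalerDr; congr (_ + _).
  by rewrite scale_pure !tlact_pure scale_pure.
- by rewrite !tlactD IH !tlact_pure (lactM lF).
- by rewrite tlactD IH tlact_pure (lact1 lF).
Qed.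

Lemma tlact_tract d t a : tract (tlact d t) a = tlact d (tract t a).
Proof.
elim/(@tensor_ind _ _ P (bm_left E)): t => [|y x t IH].
  by rewrite !(tlact0, tract0).
by rewrite !(tlactD, tractD) IH !(tlact_pure, tract_pure).
Qed.

Lemma tip_tlact d (t u : T) : tip (tlact d t) u = tip t (tlact (star d) u).
Proof.
elim/(@tensor_ind _ _ P (bm_left E)): t => [|y x t IH].
  by rewrite tlact0 !tip0l.
rewrite tlactD !tipDl IH; congr (_ + _); clear IH.
elim/(@tensor_ind _ _ P (bm_left E)): u => [|q z u IH].
  by rewrite tlact0 !tip0r.
rewrite tlactD !tipDr IH; congr (_ + _); rewrite !tlact_pure !tip_pp /ip /=.
by rewrite (pic_ladj (picP F)).
Qed.

Definition ilact (d : D) (x : Q) : Q := icls (tlact d (repr x)).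

Lemma ilact_icls d t : ilact d (icls t) = icls (tlact d t).
Proof. by apply/iclsP => u; rewrite !tip_tlact tip_repr_icls. Qed.

Lemma ilactP : @is_lact R D Q ilact.
Proof.
split=> [a b x|d x y|c d x|c d x|a b x|x].
- by elim/itensW: x => t; rewrite !ilact_icls (lactDl tlactP) iclsD.
- elim/itensW: x => t; elim/itensW: y => u.
  by rewrite -iclsD !ilact_icls (lactDr tlactP) iclsD.
- by elim/itensW: x => t; rewrite !ilact_icls (lactZl tlactP) iclsZ.
- by elim/itensW: x => t; rewrite -iclsZ !ilact_icls (lactZr tlactP) iclsZ.
- by elim/itensW: x => t; rewrite !ilact_icls (lactM tlactP).
- by elim/itensW: x => t; rewrite ilact_icls (lact1 tlactP).
Qed.

Lemma ilact_iract d (x : Q) a : iract (ilact d x) a = ilact d (iract x a).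
Proof.
by elim/itensW: x => t; rewrite !(ilact_icls, iract_icls) tlact_tract.
Qed.

Definition itens_bimod : bimod D A :=
  @Bimod R D A Q ilact (@iract _ _ _ _ _ P E) ilactP (iractP P E) ilact_iract.

(* <y (x) x, y' (x) x'> = <y <x, x'>, y'> *)
Definition tlip (t u : T) : D :=
  @tlift _ _ P (bm_left E) D (fun y x =>
    @tlift _ _ P (bm_left E) D (fun y' x' =>
      lip (bm_ract y (lip x x')) y') u) t.

(* F \tilde{\otimes}_B E.  The left inner product may be computed on
   representatives since, by fullness and the compatibility of the two inner
   products, both have the same degeneracy space on the tensor product. *)
Definition btens : ipBimod D A :=
  @IpBimod R H D A itens_bimod (fun x y => tlip (repr x) (repr y))
    (@iip _ _ _ _ _ P E) (@ihact _ _ _ _ _ P E).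

End BimoduleTensor.

(* Isomorphism classes live in a larger universe than the modules themselves,
   hence the records below rather than nmodType and zmodType. *)
Section Classes.
Variables (T : Type) (e : T -> T -> Prop).

Definition classes : Type := {c : T -> Prop | exists x, c = e x}.
Definition cls (x : T) : classes := exist _ (e x) (ex_intro _ x erefl).
Definition crepr (c : classes) : T := sval (cid (svalP c)).

Lemma creprK c : cls (crepr c) = c.
Proof.
case: c => c hc; rewrite /crepr /cls /=.
by case: cid => x /= ex; apply: eq_exist; rewrite ex.
Qed.

Hypotheses (e_refl : forall x, e x x) (e_sym : forall x y, e x y -> e y x)
  (e_trans : forall x y z, e x y -> e y z -> e x z).

Lemma clsP x y : cls x = cls y <-> e x y.
Proof.
split=> [/(congr1 sval) /= ->|xy]; first exact: e_refl.
apply: eq_exist; apply/predeqP => z; split; last exact: e_trans.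
by apply: e_trans; exact: e_sym.
Qed.

Lemma crepr_cls x : e (crepr (cls x)) x.
Proof. by apply/clsP; rewrite creprK. Qed.
End Classes.

Record cmonoid := CMonoid {
  cm_car :> Type;
  cm_add : cm_car -> cm_car -> cm_car;
  cm_zero : cm_car;
  cm_addA : associative cm_add;
  cm_addC : commutative cm_add;
  cm_add0 : left_id cm_zero cm_add
}.

Record abgroup := AbGroup {
  ag_mon :> cmonoid;
  ag_opp : ag_mon -> ag_mon;
  ag_addN : left_inverse (cm_zero ag_mon) ag_opp (@cm_add ag_mon)
}.

Definition additive_iso (M N : cmonoid) (f : M -> N) : Prop :=
  (forall x y, f (cm_add x y) = cm_add (f x) (f y)) /\ bijective f.

Section Grothendieck.
Variable M : cmonoid.
Local Notation "x +' y" := (@cm_add M x y) (at level 50, left associativity).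

Definition groth_eq (p q : M * M) : Prop :=
  exists k, p.1 +' q.2 +' k = q.1 +' p.2 +' k.

Let addA := @cm_addA M.
Let addC := @cm_addC M.
Let ACA (a b c d : M) : (a +' b) +' (c +' d) = (a +' c) +' (b +' d).
Proof. by rewrite !addA -(addA a b c) (addC b c) !addA. Qed.

Lemma groth_eq_refl p : groth_eq p p. Proof. by exists (cm_zero M). Qed.
Lemma groth_eq_sym p q : groth_eq p q -> groth_eq q p.
Proof. by case=> k kE; exists k. Qed.
Lemma groth_eq_trans p q r : groth_eq p q -> groth_eq q r -> groth_eq p r.
Proof.
case: p q r => [a b] [c d] [x y] [k /= E1] [l /= E2].
exists ((c +' d) +' (k +' l)) => /=.
have sh p q r s t u :
  (p +' q +' r) +' (s +' t +' u) = (p +' t) +' ((s +' q) +' (r +' u)).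
  by rewrite (ACA _ r) (addC s t) (ACA p) (addC q s) -!addA.
by rewrite -sh E1 E2 (addC c b) (addC x d) sh (addC b x) (addC d c).
Qed.

Definition groth_car := classes groth_eq.
Definition groth_mk (a b : M) : groth_car := cls groth_eq (a, b).
Definition groth_repr (x : groth_car) : M * M := crepr x.
Definition groth_add (x y : groth_car) : groth_car :=
  groth_mk ((groth_repr x).1 +' (groth_repr y).1)
           ((groth_repr x).2 +' (groth_repr y).2).
Definition groth_opp (x : groth_car) : groth_car :=
  groth_mk (groth_repr x).2 (groth_repr x).1.
Definition groth_zero : groth_car := groth_mk (cm_zero M) (cm_zero M).

Let gP := clsP groth_eq_refl groth_eq_sym groth_eq_trans.

Lemma groth_mkP a b c d :
  groth_mk a b = groth_mk c d <-> exists k, a +' d +' k = c +' b +' k.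
Proof. exact: gP. Qed.

Lemma groth_reprK x : groth_mk (groth_repr x).1 (groth_repr x).2 = x.
Proof. by rewrite /groth_mk -surjective_pairing creprK. Qed.

Lemma grothW (K : groth_car -> Prop) :
  (forall a b, K (groth_mk a b)) -> forall x, K x.
Proof. by move=> Kab x; rewrite -(groth_reprK x). Qed.

Lemma groth_add_mk a b c d :
  groth_add (groth_mk a b) (groth_mk c d) = groth_mk (a +' c) (b +' d).
Proof.
have [k E1] := (groth_mkP _ _ _ _).1 (groth_reprK (groth_mk a b)).
have [l E2] := (groth_mkP _ _ _ _).1 (groth_reprK (groth_mk c d)).
apply/groth_mkP; exists (k +' l).
by rewrite (ACA _ _ b d) (ACA a c) (ACA _ _ k l) (ACA _ _ k l) E1 E2.
Qed.

Lemma groth_opp_mk a b : groth_opp (groth_mk a b) = groth_mk b a.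
Proof.
have [k E1] := (groth_mkP _ _ _ _).1 (groth_reprK (groth_mk a b)).
by apply/groth_mkP; exists k; rewrite (addC _ a) (addC b) E1.
Qed.

Lemma groth_addA : associative groth_add.
Proof.
elim/grothW=> a b; elim/grothW=> c d; elim/grothW=> x y.
by rewrite !groth_add_mk !addA.
Qed.
Lemma groth_addC : commutative groth_add.
Proof.
elim/grothW=> a b; elim/grothW=> c d.
by rewrite !groth_add_mk (addC a) (addC b).
Qed.
Lemma groth_add0 : left_id groth_zero groth_add.
Proof. by elim/grothW=> a b; rewrite groth_add_mk !(@cm_add0 M). Qed.
Lemma groth_addN : left_inverse groth_zero groth_opp groth_add.
Proof.
elim/grothW=> a b; rewrite groth_opp_mk groth_add_mk.
by apply/groth_mkP; exists (cm_zero M); rewrite (addC b a) (addC (a +' b)).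
Qed.

Definition groth_monoid : cmonoid :=
  CMonoid groth_addA groth_addC groth_add0.
Definition groth : abgroup := @AbGroup groth_monoid groth_opp groth_addN.
Definition groth_in (a : M) : groth := groth_mk a (cm_zero M).
End Grothendieck.

Section DirectSum.
Variables (R : realDomainType) (H : hopfStarAlg R) (A : hstarAlg H).
Local Notation C := (cplx R).

Section Sum.
Variables P Q : ipMod A.

Definition dsum_car : lmodType C := (P * Q)%type.
Definition dsum_ract (x : dsum_car) (a : A) : dsum_car :=
  (ract x.1 a, ract x.2 a).
Lemma dsum_ractP : @is_ract R A dsum_car dsum_ract.
Proof.
have rP := ractP P; have rQ := ractP Q.
by split=> *; rewrite /dsum_ract /= ?(ractDl rP, ractDl rQ, ractDr rP, ractDr rQ,
  ractZl rP, ractZl rQ, ractZr rP, ractZr rQ, ractM rP, ractM rQ,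
  ract1 rP, ract1 rQ) // -?surjective_pairing.
Qed.
Definition dsum_mod : rightMod A := RightMod dsum_ractP.

Definition dsum_ip (x y : dsum_car) : A := ip x.1 y.1 + ip x.2 y.2.
Lemma dsum_ipP : @is_rip R A dsum_mod dsum_ip.
Proof.
have rP := ipP P; have rQ := ipP Q.
split=> [x y z|c x y|x y a|x y]; rewrite /dsum_ip /=.
- by rewrite (ripDr rP) (ripDr rQ) addrACA.
- by rewrite (ripZr rP) (ripZr rQ) scalerDr.
- by rewrite (ripMr rP) (ripMr rQ) mulrDl.
- by rewrite starD -(ripC rP) -(ripC rQ).
Qed.

Definition dsum : ipMod A :=
  @IpMod R H A dsum_mod dsum_ip dsum_ipP
    (fun g x => (hact g x.1, hact g x.2)).
End Sum.

Lemma sw_add (V : zmodType) (f1 f2 : H -> H -> V) g :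
  sw (fun g1 g2 => f1 g1 g2 + f2 g1 g2) g = sw f1 g + sw f2 g.
Proof. exact: big_split. Qed.

Lemma cnneg_add (z w : C) : cnneg z -> cnneg w -> cnneg (z + w).
Proof.
case: z w => [a b] [c d] /andP[/= /eqP-> a0] /andP[/= /eqP-> c0].
by apply/andP; split; rewrite /= ?addr0 // addr_ge0.
Qed.

Lemma dsum_is_proj str (P Q : ipMod A) :
  is_proj str P -> is_proj str Q -> is_proj str (dsum P Q).
Proof.
move=> [hP cP fP pP nP cpP] [hQ cQ fQ pQ nQ cpQ]; split.
- split=> *; rewrite /hact /= ?(hactDl hP, hactDl hQ, hactDr hP, hactDr hQ,
    hactZl hP, hactZl hQ, hactZr hP, hactZr hQ, hactM hP, hactM hQ,
    hact1 hP, hact1 hQ) // -?surjective_pairing //.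
- move=> g x y; rewrite /ip /= /dsum_ip (hactDr (ha_actP A)) cP cQ.
  by rewrite -sw_add.
- have [n [e eP]] := fP; have [m [f fE]] := fQ.
  exists (n + m)%N, (fun i => match split i with
    | inl j => (e j, 0) | inr k => (0, f k) end) => -[x y].
  have [a ->] := eP x; have [b ->] := fE y.
  exists (fun i => match split i with inl j => a j | inr k => b k end).
  rewrite big_split_ord /=.
  have r0 (M : rightMod A) c : ract (0 : M) c = 0.
    by apply: (addrI (ract 0 c)); rewrite -(ractDl (ractP M)) !addr0.
  have sl i : split (lshift m i) = inl i :> 'I_n + 'I_m := unsplitK (inl i).
  have sr i : split (rshift n i) = inr i :> 'I_n + 'I_m := unsplitK (inr i).
  rewrite [X in _ = X + _](eq_bigr (fun i => (ract (e i) (a i), ract 0 (a i))));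
    last by move=> i _; rewrite !sl.
  rewrite [X in _ = _ + X](eq_bigr (fun i => (ract 0 (b i), ract (f i) (b i))));
    last by move=> i _; rewrite !sr.
  have -> : \sum_(i < n) ((ract (e i) (a i), ract 0 (a i)) : dsum_car P Q) =
      (\sum_i ract (e i) (a i), 0).
    apply: (big_ind2 (fun (u : dsum_car P Q) v => u = (v, 0))) => //.
      by move=> _ v _ w -> ->; congr (_, _); rewrite addr0.
    by move=> i _; rewrite r0.
  have -> : \sum_(i < m) ((ract 0 (b i), ract (f i) (b i)) : dsum_car P Q) =
      (0, \sum_i ract (f i) (b i)).
    apply: (big_ind2 (fun (u : dsum_car P Q) v => u = (0, v))) => //.
      by move=> _ v _ w -> ->; congr (_, _); rewrite addr0.
    by move=> i _; rewrite r0.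
  by congr (_, _); rewrite ?addr0 ?add0r.
- move=> M N f g lf sf [gD gM].
  have i1D x y : ((x + y, 0) : dsum P Q) = (x, 0) + (y, 0).
    by congr (_, _); rewrite addr0.
  have i2D x y : ((0, x + y) : dsum P Q) = (0, x) + (0, y).
    by congr (_, _); rewrite addr0.
  have r0 (K : rightMod A) c : ract (0 : K) c = 0.
    by apply: (addrI (ract 0 c)); rewrite -(ractDl (ractP K)) !addr0.
  have i1M x a : ((ract x a, 0) : dsum P Q) = ract ((x, 0) : dsum P Q) a.
    by rewrite /ract /= /dsum_ract /= r0.
  have i2M x a : ((0, ract x a) : dsum P Q) = ract ((0, x) : dsum P Q) a.
    by rewrite /ract /= /dsum_ract /= r0.
  have [|h1 [h1D h1M] h1f] := pP M N f (fun x => g (x, 0)) lf sf.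
    by split=> [x y|x a]; rewrite ?i1D ?i1M ?gD ?gM.
  have [|h2 [h2D h2M] h2f] := pQ M N f (fun x => g (0, x)) lf sf.
    by split=> [x y|x a]; rewrite ?i2D ?i2M ?gD ?gM.
  exists (fun x => h1 x.1 + h2 x.2).
    split=> [x y|x a] /=; first by rewrite h1D h2D addrACA.
    by rewrite (ractDl (ractP M)) h1M h2M.
  case: lf => fD _ [x y]; rewrite fD h1f h2f -gD; congr g.
  by congr (_, _); rewrite /= ?addr0 ?add0r.
- move=> phi [phD phM].
  have i1D x y : ((x + y, 0) : dsum P Q) = (x, 0) + (y, 0).
    by congr (_, _); rewrite addr0.
  have i2D x y : ((0, x + y) : dsum P Q) = (0, x) + (0, y).
    by congr (_, _); rewrite addr0.
  have r0 (K : rightMod A) c : ract (0 : K) c = 0.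
    by apply: (addrI (ract 0 c)); rewrite -(ractDl (ractP K)) !addr0.
  have i1M x a : ((ract x a, 0) : dsum P Q) = ract ((x, 0) : dsum P Q) a.
    by rewrite /ract /= /dsum_ract /= r0.
  have i2M x a : ((0, ract x a) : dsum P Q) = ract ((0, x) : dsum P Q) a.
    by rewrite /ract /= /dsum_ract /= r0.
  have ip0r (K : ipMod A) (z : K) : ip z 0 = 0.
    by apply: (addrI (ip z 0)); rewrite -(ripDr (ipP K)) !addr0.
  have [|x [xE xU]] := nP (fun x => phi (x, 0)).
    by split=> [y z|y a]; rewrite ?i1D ?i1M ?phD ?phM.
  have [|y [yE yU]] := nQ (fun x => phi (0, x)).
    by split=> [u z|u a]; rewrite ?i2D ?i2M ?phD ?phM.
  exists (x, y); split=> [[u v]|[x' y'] E].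
    have -> : ((u, v) : dsum P Q) = (u, 0) + (0, v).
      by congr (_, _); rewrite /= ?addr0 ?add0r.
    by rewrite phD xE yE /ip /= /dsum_ip /= addr0 add0r.
  rewrite (xU x') ?(yU y') // => u; rewrite E /ip /= /dsum_ip /=.
    by rewrite ip0r add0r.
  by rewrite ip0r addr0.
- move=> st n x w [wD wZ w0].
  have -> : \matrix_(i, j) ip (x i) (x j) =
      \matrix_(i, j) ip (x i).1 (x j).1 + \matrix_(i, j) ip (x i).2 (x j).2.
    by apply/matrixP => i j; rewrite !mxE.
  rewrite wD; apply: cnneg_add.
    by apply: (cpP st n (fun i => (x i).1)); split.
  by apply: (cpQ st n (fun i => (x i).2)); split.
Qed.

Definition zero_car : lmodType C := 'rV[C]_0.

Lemma zero_ractP : @is_ract R A zero_car (fun _ _ => 0).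
Proof. by split=> *; rewrite ?addr0 ?scaler0 //; exact/esym/thinmx0. Qed.
Definition zero_mod : rightMod A := RightMod zero_ractP.

Lemma zero_ipP : @is_rip R A zero_mod (fun _ _ => 0).
Proof. by split=> *; rewrite ?addr0 ?scaler0 ?mul0r ?star0. Qed.

Definition pzero : ipMod A :=
  @IpMod R H A zero_mod (fun _ _ => 0) zero_ipP (fun _ _ => 0).

Lemma zero_is_proj str : is_proj str pzero.
Proof.
have z0 (x : pzero) : x = 0 by exact: thinmx0.
split.
- by split=> *; rewrite ?addr0 ?scaler0 //; exact/esym/thinmx0.
- move=> g x y; rewrite /ip /= /sw /sweedler /tlift big1 //.
  by apply: (addrI (ha_act g 0)); rewrite -(hactDr (ha_actP A)) !addr0.
- by exists 0%N, (fun=> 0) => x; exists (fun=> 0); rewrite big_ord0.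
- move=> M N f g [fD fM] sf [gD gM]; exists (fun=> 0).
    split=> [x y|x a]; first by rewrite addr0.
    by apply: (addrI (ract 0 a)); rewrite -(ractDl (ractP M)) !addr0.
  move=> x; rewrite (z0 x).
  have -> : f 0 = 0 by apply: (addrI (f 0)); rewrite -fD !addr0.
  by apply: (addrI (g 0)); rewrite -gD !addr0.
- move=> phi [phD phM]; exists 0; split=> [y|x _]; last by rewrite (z0 x).
  rewrite (z0 y) /ip /=.
  by apply: (addrI (phi 0)); rewrite -phD !addr0.
- move=> _ n x w [wD wZ w0].
  have -> : \matrix_(i, j) ip (x i) (x j) = 0 :> 'M[A]_n.
    by apply/matrixP => i j; rewrite !mxE.
  have -> : w 0 = 0 by apply: (addrI (w 0)); rewrite -wD !addr0.
  by apply/andP; split; [exact: eqxx | exact: lexx].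
Qed.

Lemma right_linear_inv (P Q : rightMod A) (f : P -> Q) (h : Q -> P) :
  cancel f h -> cancel h f -> right_linear f -> right_linear h.
Proof.
move=> fK hK [fD fM]; split=> [x y|x a]; apply: (can_inj fK).
  by rewrite fD !hK.
by rewrite fM !hK.
Qed.

Lemma proj_iso_refl (P : ipMod A) : proj_iso P P.
Proof. by exists id; split=> //; exists id. Qed.

Lemma proj_iso_sym (P Q : ipMod A) : proj_iso P Q -> proj_iso Q P.
Proof.
move=> [f [[h fK hK] lf fh fi]]; exists h; split.
- by exists f.
- exact: right_linear_inv lf.
- by move=> g x; apply: (can_inj fK); rewrite fh !hK.
- by move=> x y; rewrite -fi !hK.
Qed.

Lemma proj_iso_trans (P Q S : ipMod A) :
  proj_iso P Q -> proj_iso Q S -> proj_iso P S.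
Proof.
move=> [f [bf [fD fM] fh fi]] [h [bh [hD hM] hh hi]].
exists (h \o f); split=> /=.
- exact: bij_comp.
- by split=> [x y|x a] /=; rewrite ?fD ?hD ?fM ?hM.
- by move=> g x; rewrite fh hh.
- by move=> x y; rewrite hi fi.
Qed.

Lemma dsum_iso (P P' Q Q' : ipMod A) :
  proj_iso P P' -> proj_iso Q Q' -> proj_iso (dsum P Q) (dsum P' Q').
Proof.
move=> [f [[f' fK f'K] [fD fM] fh fi]] [h [[h' hK h'K] [hD hM] hh hi]].
exists (fun x => (f x.1, h x.2)); split.
- exists (fun x => (f' x.1, h' x.2)) => -[x y] /=; first by rewrite fK hK.
  by rewrite f'K h'K.
- split=> [x y|x a]; first by rewrite /= fD hD.
  by rewrite /ract /= /dsum_ract /= fM hM.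
- by move=> g x; rewrite /hact /= fh hh.
- by move=> x y; rewrite /ip /= /dsum_ip /= fi hi.
Qed.

Lemma dsumA (P Q S : ipMod A) :
  proj_iso (dsum P (dsum Q S)) (dsum (dsum P Q) S).
Proof.
exists (fun x => ((x.1, x.2.1), x.2.2)); split=> //.
- by exists (fun x => (x.1.1, (x.1.2, x.2))); [case=> x [] | case=> [[]]].
- by move=> x y; rewrite /ip /= /dsum_ip /= addrA.
Qed.

Lemma dsumC (P Q : ipMod A) : proj_iso (dsum P Q) (dsum Q P).
Proof.
exists (fun x => (x.2, x.1)); split=> //.
- by exists (fun x => (x.2, x.1)); case.
- by move=> x y; rewrite /ip /= /dsum_ip /= addrC.
Qed.

Lemma dsum0 (P : ipMod A) : proj_iso (dsum pzero P) P.
Proof.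
exists (fun x => x.2); split=> //.
- by exists (fun x => (0, x)) => // -[z x] /=; rewrite (thinmx0 z).
- by move=> x y; rewrite /ip /= /dsum_ip /= add0r.
Qed.

End DirectSum.

Section Classification.
Variables (R : realDomainType) (H : hopfStarAlg R) (str : bool).

Definition projobj_iso (A : hstarAlg H) (P Q : projObj str A) : Prop :=
  proj_iso P Q.

Definition picobj_iso (B A : hstarAlg H) (E F : picObj str B A) : Prop :=
  pic_iso E F.

Definition Pic (B A : hstarAlg H) : Type := classes (@picobj_iso B A).
Definition pic_cls (B A : hstarAlg H) (E : picObj str B A) : Pic B A :=
  cls (@picobj_iso B A) E.

Section ProjMonoid.
Variable A : hstarAlg H.

Definition proj_car : Type := classes (@projobj_iso A).
Definition pcls (P : projObj str A) : proj_car := cls (@projobj_iso A) P.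
Definition dsum_obj (P Q : projObj str A) : projObj str A :=
  ProjObj (dsum_is_proj (projP P) (projP Q)).
Definition proj_add (x y : proj_car) : proj_car :=
  pcls (dsum_obj (crepr x) (crepr y)).
Definition proj_zero : proj_car := pcls (ProjObj (zero_is_proj A str)).

Lemma pclsP P Q : pcls P = pcls Q <-> proj_iso P Q.
Proof.
apply: clsP => [x|x y|x y z]; first exact: proj_iso_refl.
  exact: proj_iso_sym.
exact: proj_iso_trans.
Qed.

Lemma pclsW (K : proj_car -> Prop) : (forall P, K (pcls P)) -> forall x, K x.
Proof. by move=> KP x; rewrite -(creprK x); exact: KP. Qed.

Lemma proj_add_cls P Q : proj_add (pcls P) (pcls Q) = pcls (dsum_obj P Q).
Proof. by apply/pclsP/dsum_iso; apply/pclsP; exact: creprK. Qed.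

Lemma proj_addA : associative proj_add.
Proof.
elim/pclsW=> P; elim/pclsW=> Q; elim/pclsW=> S.
by rewrite !proj_add_cls; apply/pclsP; exact: dsumA.
Qed.
Lemma proj_addC : commutative proj_add.
Proof.
elim/pclsW=> P; elim/pclsW=> Q.
by rewrite !proj_add_cls; apply/pclsP; exact: dsumC.
Qed.
Lemma proj_add0 : left_id proj_zero proj_add.
Proof.
by elim/pclsW=> P; rewrite proj_add_cls; apply/pclsP; exact: dsum0.
Qed.

(* Proj_H(A) under orthogonal direct sum, and its Grothendieck group *)
Definition Proj : cmonoid := CMonoid proj_addA proj_addC proj_add0.
Definition proj_cls (P : projObj str A) : Proj := pcls P.
Definition K0 : abgroup := groth Proj.
Definition K0_in (x : Proj) : K0 := groth_in x.
End ProjMonoid.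

Lemma proj_clsP (A : hstarAlg H) (P Q : projObj str A) :
  proj_cls P = proj_cls Q <-> proj_iso P Q.
Proof. exact: pclsP. Qed.

(* A right action of the Picard groupoid on a family X of sets indexed by its
   objects.  That the tensor product of two bimodules, resp. the unit bimodule,
   is again in the groupoid is part of the claim. *)
Definition right_pic_action (X : hstarAlg H -> Type)
    (S : forall B A : hstarAlg H, X B -> Pic B A -> X A) : Prop :=
  (forall (D B A : hstarAlg H) (x : X D) (F : picObj str D B) (E : picObj str B A),
     exists FE : is_pic str (btens F E),
       S B A (S D B x (pic_cls F)) (pic_cls E) = S D A x (pic_cls (PicObj FE))) /\
  (forall (A : hstarAlg H) (x : X A),
     exists uA : is_pic str (unit_bimod A),
       S A A x (pic_cls (PicObj uA)) = x).

End Classification.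

(* Main.v *)
Require Import Defs.
From HB Require Import structures.
From mathcomp Require Import all_boot all_order all_algebra.
From mathcomp Require Import boolp.

(* A finitely generated projective module with a strongly non-degenerate inner
   product is the same thing as one with a finite frame, x = sum_i e_i <f_i, x>.
   An equivalence bimodule has such a frame because its left inner product
   attains the unit, and frames multiply under tensor products; hence the
   degeneracy spaces vanish and P (x) E is again projective.  Covariance is
   handled in the form <x, g y> = g_(2) <g_(1)^* x, y>, and complete positivity
   by pulling positive functionals back to matrices indexed by generators.
   Isometric isomorphisms are obtained by comparing the Gram matrices of two
   generating families.  The action of E is inverted by that of the conjugate
   bimodule, on which g acts by S(g)^*. *)

Set Implicit Arguments.
Unset Strict Implicit.
Unset Printing Implicit Defensive.

Import Order.TTheory GRing.Theory Num.Theory.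
Local Open Scope ring_scope.

(** * Sweedler calculus *)

(** The obstacle is that H acts on P (x) E by a formula evaluated on a chosen representative, which
    says nothing until the formula is known to be balanced and the choice to be harmless.
    Balancedness rests on the rule g (x a) = (g_1 x)(g_2 a), which is not an axiom of the objects
    but is forced by covariance together with non-degeneracy. The choice is harmless because a frame
    recovers a tensor from its inner products, so that the quotient map is injective on the
    unreduced tensor product. For two bimodules, left covariance is not computed: it is deduced from
    right covariance and the rule for the left action, because the left algebra acts faithfully.
    Complete positivity is the only clause that depends on [str], so both versions are proved at
    once. *)

Section Sweedler.
Variables (R : realDomainType) (H : hopfStarAlg R).
Local Notation C := (cplx R).
Let hH := hopfP H.

(** With [linear], each side condition is a single identity about [k *: a + a'], which the lists
    [rules] further on settle by rewriting. *)
Record bilin (V : lmodType C) (f : H -> H -> V) : Prop := Bilin {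
  bilin_l : forall b, linear (f^~ b);
  bilin_r : forall a, linear (f a)
}.

Record trilin (V : lmodType C) (f : H -> H -> H -> V) : Prop := Trilin {
  trilin1 : forall b c, linear (fun a => f a b c);
  trilin2 : forall a c, linear (fun b => f a b c);
  trilin3 : forall a b, linear (f a b)
}.

Lemma linD (U V : lmodType C) (f : U -> V) :
  linear f -> {morph f : x y / x + y}.
Proof. by move=> lf x y; have := lf 1 x y; rewrite !scale1r. Qed.

Lemma linZ (U V : lmodType C) (f : U -> V) : linear f -> scalable f.
Proof.
move=> lf k a; have := lf k a 0; rewrite addr0 => ->.
rewrite (_ : f 0 = 0) ?addr0 //.
by apply: (addrI (f 0)); rewrite -(linD lf) !addr0.
Qed.

Lemma eq_sw (V : zmodType) (f f' : H -> H -> V) g :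
  (forall a b, f a b = f' a b) -> sw f g = sw f' g.
Proof. by move=> ff'; apply: eq_bigr. Qed.

Lemma sw_morph (V W : zmodType) (phi : V -> W) (f : H -> H -> V) g :
  {morph phi : x y / x + y} -> phi (sw f g) = sw (fun a b => phi (f a b)) g.
Proof.
move=> phD; apply: big_morph => //.
by apply: (addrI (phi 0)); rewrite -phD !addr0.
Qed.

Lemma sw_scale (V : lmodType C) (f : H -> H -> V) k g :
  k *: sw f g = sw (fun a b => k *: f a b) g.
Proof. by apply: sw_morph => x y; rewrite scalerDr. Qed.

(** Holds for arbitrary f, since [sw] is a finite sum over one fixed representative of the
    coproduct. *)
Lemma sw_exchange (V : zmodType) (f : H -> H -> H -> H -> V) g h :
  sw (fun a b => sw (fun c d => f a b c d) h) g =
  sw (fun c d => sw (fun a b => f a b c d) g) h.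
Proof. exact: exchange_big. Qed.

Lemma bilin_balanced (V : lmodType C) (f : H -> H -> V) : bilin f ->
  @balanced _ _ (scalar_right H) (scalar_left H) V f.
Proof.
move=> bf; split=> [p p' x|p x x'|p b x]; first exact: linD (bilin_l bf _) _ _.
  exact: linD (bilin_r bf _) _ _.
by rewrite /ract /lact /= (linZ (bilin_l bf _)) (linZ (bilin_r bf _)).
Qed.

Lemma swD (V : lmodType C) (f : H -> H -> V) g h : bilin f ->
  sw f (g + h) = sw f g + sw f h.
Proof.
move=> bf; rewrite /sw /sweedler (coprodD hH) tliftD //.
exact: bilin_balanced.
Qed.

Lemma tlift_scale (V : lmodType C) (f : H -> H -> V) k (t : tensC H H) :
  bilin f ->
  @tlift _ _ (scalar_right H) (scalar_left H) V f (k *: t) =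
  k *: @tlift _ _ (scalar_right H) (scalar_left H) V f t.
Proof.
move=> bf; have bb := bilin_balanced bf.
elim/(@tensor_ind _ _ (scalar_right H) (scalar_left H)): t => [|a b t IH].
  by rewrite scaler0 (tlift0 bb) scaler0.
rewrite scalerDr !(tliftD bb) IH scalerDr scale_pure !(tlift_pure bb).
by rewrite (linZ (bilin_r bf _)).
Qed.

Lemma swZ (V : lmodType C) (f : H -> H -> V) k g : bilin f ->
  sw f (k *: g) = k *: sw f g.
Proof. by move=> bf; rewrite /sw /sweedler (coprodZ hH) tlift_scale. Qed.

Lemma sw_one (V : lmodType C) (f : H -> H -> V) : bilin f -> sw f 1 = f 1 1.
Proof.
move=> bf; rewrite /sw /sweedler (coprod1 hH) tlift_pure //.
exact: bilin_balanced.
Qed.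

Lemma sw_star (V : lmodType C) (f : H -> H -> V) g : bilin f ->
  sw f (star g) = sw (fun a b => f (star a) (star b)) g.
Proof.
move=> /bilin_balanced bf; rewrite /sw /sweedler (coprod_star hH).
rewrite [LHS](sw_morph _ _ (tliftD bf)); apply: eq_sw => a b.
exact: (tlift_pure bf).
Qed.

Lemma sw_mul (V : lmodType C) (f : H -> H -> V) g h : bilin f ->
  sw f (g * h) = sw (fun a b => sw (fun c d => f (a * c) (b * d)) h) g.
Proof.
move=> /bilin_balanced bf; rewrite /sw /sweedler (coprodM hH).
rewrite [LHS](sw_morph _ _ (tliftD bf)); apply: eq_sw => a b.
rewrite [LHS](sw_morph _ _ (tliftD bf)); apply: eq_sw => c d.
exact: (tlift_pure bf).
Qed.

Lemma trilin_bilin (V : lmodType C) (f : H -> H -> H -> V) : trilin f ->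
  forall a, bilin (f a).
Proof. by move=> tf a; split=> b; [exact: trilin2 | exact: trilin3]. Qed.

Lemma sw_coassoc (V : lmodType C) (f : H -> H -> H -> V) g : trilin f ->
  sw (fun a b => sw (fun c d => f c d b) a) g =
  sw (fun a b => sw (fun c d => f a c d) b) g.
Proof.
move=> tf; have bf a := bilin_balanced (trilin_bilin tf a).
(* The axiom [coassoc] lives in H (x) (H (x) H), so f is lifted twice: [phi a] lifts [f a] to H (x)
   H, and the lift of [phi] is then applied to both sides of the axiom. *)
pose phi a (t : tensC H H) :=
  @tlift _ _ (scalar_right H) (scalar_left H) V (f a) t.
have bphi : @balanced _ _ (scalar_right H) (scalar_left (tensC H H)) V phi.
  split=> [a a' t|a t t'|a k t].
  - rewrite /phi /tlift -big_split; apply: eq_bigr => q _.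
    exact: linD (trilin1 tf _ _) _ _.
  - exact: (tliftD (bf a)).
  - rewrite /ract /lact /= /phi tlift_scale; last exact: trilin_bilin.
    rewrite /tlift scaler_sumr; apply: eq_bigr => q _.
    exact: linZ (trilin1 tf _ _) _ _.
have := congr1 (@tlift _ _ (scalar_right H) (scalar_left (tensC H H)) V phi)
  (coassoc hH g).
rewrite !(sw_morph _ _ (tliftD bphi)) => E.
transitivity (sw (fun a b => @tlift _ _ (scalar_right H)
  (scalar_left (tensC H H)) V phi (sweedler (@coprod R H)
  (fun a0 b0 : H => pureC a0 (pureC b0 b)) a)) g).
  apply: eq_sw => a b; rewrite (sw_morph _ _ (tliftD bphi)); apply: eq_sw => c d.
  by rewrite (tlift_pure bphi) /phi (tlift_pure (bf c)).
rewrite [LHS]E; apply: eq_sw => a b.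
by rewrite (tlift_pure bphi).
Qed.

Lemma sw_counit_l (V : lmodType C) (f : H -> V) g : linear f ->
  sw (fun a b => counit a *: f b) g = f g.
Proof.
move=> lf; rewrite -{2}(counit_l hH g) [RHS](sw_morph _ _ (linD lf)).
by apply: eq_sw => a b; rewrite (linZ lf).
Qed.

Lemma sw_counit_r (V : lmodType C) (f : H -> V) g : linear f ->
  sw (fun a b => counit b *: f a) g = f g.
Proof.
move=> lf; rewrite -{2}(counit_r hH g) [RHS](sw_morph _ _ (linD lf)).
by apply: eq_sw => a b; rewrite (linZ lf).
Qed.

Lemma sw_antipode_l (V : lmodType C) (f : H -> V) g : linear f ->
  sw (fun a b => f (antipode a * b)) g = counit g *: f 1.
Proof.
move=> lf; rewrite -(linZ lf) -(antipode_l hH).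
by rewrite [RHS](sw_morph _ _ (linD lf)).
Qed.

Lemma sw_antipode_r (V : lmodType C) (f : H -> V) g : linear f ->
  sw (fun a b => f (a * antipode b)) g = counit g *: f 1.
Proof.
move=> lf; rewrite -(linZ lf) -(antipode_r hH).
by rewrite [RHS](sw_morph _ _ (linD lf)).
Qed.

End Sweedler.

(** * The antipode reverses products *)

Section Antipode.
Variables (R : realDomainType) (H : hopfStarAlg R).
Local Notation C := (cplx R).
Let hH := hopfP H.

Lemma scaler_mul_l (A : starAlg R) k (a b : A) : k *: (a * b) = (k *: a) * b.
Proof. exact: sa_scaleAl. Qed.
Lemma scaler_mul_r (A : starAlg R) k (a b : A) : k *: (a * b) = a * (k *: b).
Proof. exact: sa_scaleAr. Qed.
Lemma mul_linl (A : starAlg R) k (a a' b : A) :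
  (k *: a + a') * b = k *: (a * b) + a' * b.
Proof. by rewrite mulrDl scaler_mul_l. Qed.
Lemma mul_linr (A : starAlg R) k (a b b' : A) :
  a * (k *: b + b') = k *: (a * b) + a * b'.
Proof. by rewrite mulrDr scaler_mul_r. Qed.
Lemma star_semilin (A : starAlg R) k (a a' : A) :
  star (k *: a + a') = cconj k *: star a + star a'.
Proof. by rewrite starD starZ. Qed.
Lemma antipode_lin k (a a' : H) :
  antipode (k *: a + a') = k *: antipode a + antipode a'.
Proof. by rewrite (antipodeD hH) (antipodeZ hH). Qed.
Lemma antipode1 : antipode (1 : H) = 1.
Proof.
have := antipode_l hH 1.
rewrite -/(sw _ _) sw_one ?mulr1 ?(counit1 hH) ?scale1r //.
by split=> ? ? ? ? /=; rewrite ?antipode_lin ?(mul_linl, mul_linr).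
Qed.

(** Both sides are convolution inverses of the multiplication. Concretely, S(gh) is expanded to
    S(g_1 h_1) g_2 h_2 S(h_3) S(g_3), and the factors are then contracted in the other grouping. It
    makes [star (antipode g)] multiplicative in g, so that the conjugate bimodule is an H-module. *)
Lemma antipodeM (g h : H) : antipode (g * h) = antipode h * antipode g.
Proof.
have lL (b : H) : linear (fun a : H => antipode (a * b)).
  by move=> ? ? ?; rewrite mul_linl antipode_lin.
have lR (b : H) : linear (fun a : H => antipode (b * a)).
  by move=> ? ? ?; rewrite mul_linr antipode_lin.
rewrite -(sw_counit_r g (lL h)).
under eq_sw => g1 g2 do rewrite -(sw_counit_r h (lR g1)) sw_scale.
(* The two counits are replaced by the nested product a c S(d) S(b), the h-part being inserted
   between a and S(b). *)
have E (g1 g2 h1 h2 : H) : counit g2 *: (counit h2 *: antipode (g1 * h1)) =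
    sw (fun a b => sw (fun c d =>
      antipode (g1 * h1) * ((a * c) * (antipode d * antipode b))) h2) g2.
  transitivity (sw (fun a b =>
      counit h2 *: (antipode (g1 * h1) * (a * antipode b))) g2).
    have l : linear (fun x : H => antipode (g1 * h1) * x).
      by move=> ? ? ?; rewrite mul_linr.
    rewrite -sw_scale (sw_antipode_r g2 l) mulr1.
    by rewrite !scalerA mulrC.
  apply: eq_sw => a b.
  have l : linear (fun x : H => antipode (g1 * h1) * (a * x * antipode b)).
    by move=> ? ? ?; rewrite !(mul_linr, mul_linl).
  rewrite -[a in LHS]mulr1 -(sw_antipode_r h2 l); apply: eq_sw => c d.
  by rewrite !mulrA.
under eq_sw => g1 g2 do under eq_sw => h1 h2 do rewrite E.
under eq_sw => g1 g2 do rewrite (sw_exchange _ h g2).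
have t1 (g1 a b : H) : trilin (fun h1 c d : H =>
      antipode (g1 * h1) * (a * c * (antipode d * antipode b))).
    split=> ? ? ? ? ?; by rewrite ?(mul_linr, antipode_lin, mul_linl).
under eq_sw => g1 g2 do under eq_sw => a b do
  rewrite -(sw_coassoc h (t1 _ _ _)).
pose G (g1 a b : H) := sw (fun x d => sw (fun h1 c =>
    antipode (g1 * h1) * (a * c * (antipode d * antipode b))) x) h.
rewrite -[LHS]/(sw (fun g1 g2 => sw (fun a b => G g1 a b) g2) g).
rewrite -sw_coassoc; last first.
  split=> ? ? ? ? ?; rewrite /G sw_scale -sw_add; apply: eq_sw => ? ?;
  rewrite sw_scale -sw_add; apply: eq_sw => ? ?;
  by rewrite ?(mul_linr, antipode_lin, mul_linl).
have lS (b d : H) : linear (fun x : H => x * (antipode d * antipode b)).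
  by move=> ? ? ?; rewrite mul_linl.
have bS : bilin (fun a b : H => antipode a * b).
  by split=> ? ? ? ?; rewrite ?(antipode_lin, mul_linl, mul_linr).
(* After regrouping in h and in g, the factors S(g_1 h_1) g_2 h_2 have the form S(y_1) y_2 with y =
   a c, and they collapse to the counit of y. *)
transitivity (sw (fun a b => sw (fun c d =>
    counit c *: (counit a *: (antipode d * antipode b))) h) g).
  apply: eq_sw => a b; rewrite /G sw_exchange; apply: eq_sw => c d.
  rewrite scalerA [counit c * _]mulrC -(counitM hH).
  rewrite -[X in _ = _ *: X]mul1r -(linZ (lS b d)) -(antipode_l hH) -/(sw _ _).
  rewrite (sw_mul _ _ bS) [RHS](sw_morph _ _ (linD (lS b d))).
  apply: eq_sw => e f; rewrite (sw_morph _ _ (linD (lS b d))).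
  apply: eq_sw => e' f'.
  by rewrite !mulrA.
under eq_sw => a b.
  rewrite (sw_counit_l h (f := fun d => counit a *: (antipode d * antipode b))).
  over.
  by move=> ? ? ?; rewrite antipode_lin mul_linl scalerDr !scalerA mulrC.
rewrite (sw_counit_l g (f := fun b => antipode h * antipode b)) //.
by move=> ? ? ?; rewrite antipode_lin mul_linr.
Qed.
End Antipode.

Lemma hact_linl (R : realDomainType) (H : hopfStarAlg R) (V : lmodType (cplx R))
    (act : H -> V -> V) : is_hact act ->
  forall k a b x, act (k *: a + b) x = k *: act a x + act b x.
Proof. by move=> hP k a b x; rewrite (hactDl hP) (hactZl hP). Qed.

Lemma hact_linr (R : realDomainType) (H : hopfStarAlg R) (V : lmodType (cplx R))
    (act : H -> V -> V) : is_hact act ->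
  forall k a x y, act a (k *: x + y) = k *: act a x + act a y.
Proof. by move=> hP k a x y; rewrite (hactDr hP) (hactZr hP). Qed.

Lemma star1 (R : realDomainType) (A : starAlg R) : star (1 : A) = 1.
Proof.
by rewrite -[RHS]star_involutive -[star 1 in RHS]mul1r starM star_involutive mul1r.
Qed.

(** * Covariant inner products and frames *)

Section RightModules.
Variables (R : realDomainType) (A : starAlg R) (M : rightMod A).
Let rM := ractP M.

Lemma ract0r (x : M) : ract x 0 = 0.
Proof. by apply: (addrI (ract x 0)); rewrite -(ractDr rM) !addr0. Qed.
Lemma ract0l a : ract (0 : M) a = 0.
Proof. by apply: (addrI (ract 0 a)); rewrite -(ractDl rM) !addr0. Qed.
Lemma ract_sumr I (s : seq I) (F : I -> A) (x : M) :
  ract x (\sum_(i <- s) F i) = \sum_(i <- s) ract x (F i).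
Proof. by apply: (big_morph (ract x)); [exact: (ractDr rM) | exact: ract0r]. Qed.
Lemma ract_suml I (s : seq I) (F : I -> M) a :
  ract (\sum_(i <- s) F i) a = \sum_(i <- s) ract (F i) a.
Proof.
apply: (big_morph (fun x : M => ract x a)) => [x y|]; last exact: ract0l.
exact: (ractDl rM).
Qed.

Lemma right_linear_sum (N : rightMod A) (f : M -> N) : right_linear f ->
  forall I (s : seq I) (F : I -> M),
    f (\sum_(i <- s) F i) = \sum_(i <- s) f (F i).
Proof.
move=> [fD _] I s F; apply: big_morph => //.
by apply: (addrI (f 0)); rewrite -fD !addr0.
Qed.
End RightModules.

Section Covariance.
Variables (R : realDomainType) (H : hopfStarAlg R) (A : hstarAlg H).
Variable P : ipMod A.
Local Notation C := (cplx R).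
Let hA := ha_actP A.
Let rP := ipP P.

Lemma ip_linl k (x x' y : P) : ip (k *: x + x') y = cconj k *: ip x y + ip x' y.
Proof. by rewrite ipDl (ripC rP (k *: x)) (ripZr rP) starZ -(ripC rP). Qed.
Lemma ip_linr k (x y y' : P) : ip x (k *: y + y') = k *: ip x y + ip x y'.
Proof. by rewrite (ripDr rP) (ripZr rP). Qed.
Lemma ip0l (y : P) : ip 0 y = 0.
Proof. by apply: (addrI (ip 0 y)); rewrite -ipDl !addr0. Qed.
Lemma ip0r (y : P) : ip y 0 = 0.
Proof. by apply: (addrI (ip y 0)); rewrite -(ripDr rP) !addr0. Qed.
Lemma ip_suml I (s : seq I) (F : I -> P) y :
  ip (\sum_(i <- s) F i) y = \sum_(i <- s) ip (F i) y.
Proof.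
by apply: (big_morph (fun x => ip x y)) => [x x'|]; [exact: ipDl | exact: ip0l].
Qed.
Lemma ip_sumr I (s : seq I) (F : I -> P) y :
  ip y (\sum_(i <- s) F i) = \sum_(i <- s) ip y (F i).
Proof.
by apply: (big_morph (ip y)) => [x x'|]; [exact: (ripDr rP) | exact: ip0r].
Qed.
Lemma ip_inj : Defs.nondegenerate (@ip _ _ _ P) ->
  forall x y : P, (forall z, ip z x = ip z y) -> x = y.
Proof.
move=> nP x y xy; apply/eqP; rewrite -subr_eq0; apply/eqP/nP => z.
rewrite (ripC rP) addrC -scaleN1r ip_linr xy -ip_linr scaleN1r addrC subrr.
by rewrite ip0r star0.
Qed.

Hypothesis hP : is_hact (@hact _ _ _ P).

Let rules := (mul_linl, mul_linr, star_semilin, antipode_lin, hact_linl hP,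
  hact_linr hP, hact_linl hA, hact_linr hA, ip_linl, ip_linr, cconjK).

(* Unlike the defining form of covariance, the form below does not involve the
   antipode, so it passes to tensor products without any rule for the
   coproduct of [antipode g]. *)
Definition covariant_adj := forall g (x y : P), ip x (hact g y) =
  sw (fun a b => ha_act b (ip (hact (star a) x) y)) g.

(** In each direction a counit is inserted and written as [c * antipode d] or [antipode c * d]; the
    star reverses this product, which puts the two operations on x in the order that coassociativity
    produces on the other side. *)
Lemma covariant_adjP : right_covariant (@hact _ _ _ P) (@ip _ _ _ P) <->
  covariant_adj.
Proof.
split=> cov g x y.
  have t1 : trilin (fun a b c : H =>
      ip (hact (star (antipode b)) (hact (star a) x)) (hact c y)).
    by split=> ? ? ? ? ?; rewrite !rules.
  under [RHS]eq_sw => a b do rewrite cov.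
  rewrite -(sw_coassoc _ t1).
  rewrite -[LHS](sw_counit_l g (f := fun c => ip x (hact c y))); last first.
    by move=> ? ? ?; rewrite !rules.
  apply: eq_sw => a b.
  have l1 : linear (fun c : H => ip (hact (star c) x) (hact b y)).
    by move=> ? ? ?; rewrite !rules.
  transitivity (sw (fun c d => ip (hact (star (c * antipode d)) x) (hact b y)) a).
    by rewrite (sw_antipode_r a l1) star1 (hact1 hP).
  by apply: eq_sw => c d; rewrite starM (hactM hP).
under eq_sw => a b do rewrite cov.
have t1 : trilin (fun a b c : H =>
    ha_act c (ip (hact (star b) (hact (star (antipode a)) x)) y)).
  by split=> ? ? ? ? ?; rewrite !rules.
rewrite -(sw_coassoc _ t1).
rewrite -[LHS](sw_counit_l g (f := fun c => ha_act c (ip x y))); last first.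
  by move=> ? ? ?; rewrite !rules.
apply: eq_sw => a b.
have l1 : linear (fun c : H => ha_act b (ip (hact (star c) x) y)).
  by move=> ? ? ?; rewrite !rules.
transitivity (sw (fun c d => ha_act b (ip (hact (star (antipode c * d)) x) y)) a).
  by rewrite (sw_antipode_l a l1) star1 (hact1 hP).
by apply: eq_sw => c d; rewrite starM (hactM hP).
Qed.

Hypotheses (nP : Defs.nondegenerate (@ip _ _ _ P))
  (cP : right_covariant (@hact _ _ _ P) (@ip _ _ _ P)).

Lemma ip_sw (f : H -> H -> P) g z :
  ip z (sw f g) = sw (fun a b => ip z (f a b)) g.
Proof. by apply: sw_morph => x y; exact: (ripDr rP). Qed.

(** Tested against an arbitrary z, the adjoint form of covariance moves g onto the algebra, where it
    acts on the product <z, x> a by the module algebra rule; non-degeneracy removes z. *)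
Lemma hact_ract g (x : P) a :
  hact g (ract x a) = sw (fun b c => ract (hact b x) (ha_act c a)) g.
Proof.
have cP' := covariant_adjP.1 cP.
apply: ip_inj => // z; rewrite cP' ip_sw.
have t1 : trilin (fun b c d : H => ha_act c (ip (hact (star b) z) x) * ha_act d a).
  by split=> ? ? ? ? ?; rewrite !rules.
transitivity (sw (fun b c => sw (fun d e =>
    ha_act d (ip (hact (star b) z) x) * ha_act e a) c) g).
  by apply: eq_sw => b c; rewrite (ripMr rP) ha_act_mul.
rewrite -(sw_coassoc _ t1); apply: eq_sw => b c.
rewrite (ripMr rP) cP'; symmetry.
by apply: (sw_morph (phi := fun u : A => u * ha_act c a)) => ? ?; exact: mulrDl.
Qed.
End Covariance.

(** * Frames, projectivity and strong non-degeneracy *)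

Section Frame.
Variables (R : realDomainType) (H : hopfStarAlg R) (A : hstarAlg H).
Variable P : ipMod A.
Local Notation C := (cplx R).
Let rP := ipP P.

Definition frame (s : seq (P * P)) : Prop :=
  forall x : P, x = \sum_(q <- s) ract q.1 (ip q.2 x).

Lemma frame_nondeg s : frame s -> Defs.nondegenerate (@ip _ _ _ P).
Proof.
move=> fs x x0; rewrite [x]fs big1 // => q _.
by rewrite (ripC rP) x0 star0 ract0r.
Qed.

Lemma frame_fg s : frame s -> fin_generated P.
Proof.
move=> fs; exists (size s), (fun i => (nth (0, 0) s i).1) => x.
exists (fun i => ip (nth (0, 0) s i).2 x).
by rewrite {1}[x]fs (big_nth (0, 0)) big_mkord.
Qed.

Lemma frame_proj s : frame s -> projective P.
Proof.
move=> fs M N f g lf sf lg.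
pose m (q : P * P) := sval (cid (sf (g q.1))).
have fm q : f (m q) = g q.1 by rewrite /m; case: cid.
have rM := ractP M.
exists (fun x => \sum_(q <- s) ract (m q) (ip q.2 x)).
  split=> [x y|x a].
    by rewrite -big_split; apply: eq_bigr => q _; rewrite (ripDr rP) (ractDr rM).
  by rewrite ract_suml; apply: eq_bigr => q _; rewrite (ripMr rP) (ractM rM).
move=> x; rewrite (right_linear_sum lf) [in RHS](fs x) (right_linear_sum lg).
apply: eq_bigr => q _.
by rewrite (lf.2) (lg.2) fm.
Qed.

Lemma frame_sndeg s : frame s -> strongly_nondegenerate (@ip _ _ _ P).
Proof.
move=> fs phi lphi.
(* The frame gives phi y as the sum of phi(e) <f, y>; the coefficient phi(e) enters the antilinear
   slot through its star. *)
exists (\sum_(q <- s) ract q.2 (star (phi q.1))); split=> [y|x' x'E].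
  rewrite ip_suml {1}[y]fs (right_linear_sum lphi); apply: eq_bigr => q _.
  by rewrite lphi.2 ipMl star_involutive.
apply: (ip_inj (frame_nondeg fs)) => z.
rewrite [LHS](ripC rP) [RHS](ripC rP) -x'E; congr star.
rewrite ip_suml {2}[z]fs (right_linear_sum lphi); apply: eq_bigr => q _.
by rewrite lphi.2 ipMl star_involutive.
Qed.

(** Projectivity lifts the identity of P along the surjection from the free module [V]. The
    coordinates of the lift are right linear functionals on P, and strong non-degeneracy represents
    each of them by a vector [f i]. *)
Lemma frame_exists : fin_generated P -> projective P ->
  strongly_nondegenerate (@ip _ _ _ P) -> exists s, frame s.
Proof.
move=> [n [e eP]] pP nP.
pose V : lmodType C := {ffun 'I_n -> A}.
pose act (x : V) (a : A) : V := [ffun i => x i * a].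
have actP : @is_ract R A V act.
  split=> *; apply/ffunP => i; rewrite !ffunE ?mulrDl ?mulrDr ?mulr1 ?mulrA //.
  - by rewrite -scaler_mul_l.
  - by rewrite -scaler_mul_r.
have [h [hD hM] hE] : exists2 h : P -> RightMod actP, right_linear h &
   forall x, \sum_i ract (e i) (h x i) = x.
  apply: (pP (RightMod actP) P (fun a => \sum_i ract (e i) (a i)) id) => //.
  - split=> [x y|x a].
      by rewrite -big_split; apply: eq_bigr => i _; rewrite ffunE (ractDr (ractP P)).
    by rewrite ract_suml; apply: eq_bigr => i _; rewrite ffunE (ractM (ractP P)).
  - move=> x; have [a ->] := eP x; exists [ffun i => a i].
    by apply: eq_bigr => i _; rewrite ffunE.
have fx i : exists f : P, forall x, h x i = ip f x.
  have [|f [fE _]] := nP (fun x => h x i); last by exists f.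
  by split=> [x y|x a]; rewrite ?hD ?hM ffunE.
pose f i := sval (cid (fx i)).
exists [seq (e i, f i) | i <- enum 'I_n] => x.
rewrite big_map big_enum -[LHS]hE; apply: eq_bigr => i _.
by rewrite /f; case: cid => /= ? ->.
Qed.
End Frame.

Lemma proj_nondegenerate (R : realDomainType) (H : hopfStarAlg R) str
    (A : hstarAlg H) (P : ipMod A) :
  is_proj str P -> Defs.nondegenerate (@ip _ _ _ P).
Proof.
case=> _ _ fg pr sn _; have [s fs] := frame_exists fg pr sn.
exact: frame_nondeg fs.
Qed.

(** * Equivalence bimodules *)

Section Bimodule.
Variables (R : realDomainType) (H : hopfStarAlg R) (B A : hstarAlg H).
Variable E : ipBimod B A.
Local Notation C := (cplx R).

Let lE := bm_lactP E.
Let rE := bm_ractP E.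

(** This is the form in which fullness is used: compatibility turns such a list into a frame of the
    right module, and multiplying it by b from the left gives fullness back. The scalars allowed in
    [full] are absorbed into a vector. *)
Definition lip_unital (s : seq (E * E)) := 1 = \sum_(q <- s) lip q.1 q.2.
Definition rip_unital (s : seq (E * E)) := 1 = \sum_(q <- s) rip q.1 q.2.

Lemma lact_linl k b b' (x : E) :
  bm_lact (k *: b + b') x = k *: bm_lact b x + bm_lact b' x.
Proof. by rewrite (lactDl lE) (lactZl lE). Qed.
Lemma lact_linr k b (x x' : E) :
  bm_lact b (k *: x + x') = k *: bm_lact b x + bm_lact b x'.
Proof. by rewrite (lactDr lE) (lactZr lE). Qed.
Lemma ract_linl k (x x' : E) a :
  bm_ract (k *: x + x') a = k *: bm_ract x a + bm_ract x' a.
Proof. by rewrite (ractDl rE) (ractZl rE). Qed.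
Lemma ract_linr k (x : E) a a' :
  bm_ract x (k *: a + a') = k *: bm_ract x a + bm_ract x a'.
Proof. by rewrite (ractDr rE) (ractZr rE). Qed.

Lemma lact_suml I (s : seq I) (F : I -> B) (x : E) :
  bm_lact (\sum_(i <- s) F i) x = \sum_(i <- s) bm_lact (F i) x.
Proof.
apply: (big_morph (fun b => bm_lact b x)) => [b b'|]; first exact: (lactDl lE).
by apply: (addrI (bm_lact 0 x)); rewrite -(lactDl lE) !addr0.
Qed.

Hypotheses (lipE : @is_lip _ B (bm_left E) (@lip _ _ _ _ E))
  (ripE : @is_rip _ A (bm_right E) (@rip _ _ _ _ E)).

Lemma lip_linl k (x x' y : E) : lip (k *: x + x') y = k *: lip x y + lip x' y.
Proof. by rewrite (lipDl lipE) (lipZl lipE). Qed.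
Lemma lip_linr k (x y y' : E) : lip x (k *: y + y') = cconj k *: lip x y + lip x y'.
Proof. by rewrite (lipC lipE) lip_linl star_semilin -!(lipC lipE). Qed.
Lemma rip_linl k (x x' y : E) : rip (k *: x + x') y = cconj k *: rip x y + rip x' y.
Proof.
by rewrite (ripC ripE) (ripDr ripE) (ripZr ripE) star_semilin -!(ripC ripE).
Qed.
Lemma rip_linr k (x y y' : E) : rip x (k *: y + y') = k *: rip x y + rip x y'.
Proof. by rewrite (ripDr ripE) (ripZr ripE). Qed.

Lemma lip_unital_full s : lip_unital s -> full (@lip _ _ _ _ E).
Proof.
move=> s1 b; exists [seq (1, (bm_lact b q.1, q.2)) | q <- s].
rewrite big_map -[LHS]mulr1 s1 mulr_sumr; apply: eq_bigr => q _ /=.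
by rewrite scale1r (lipMl lipE).
Qed.

Lemma rip_unital_full s : rip_unital s -> full (@rip _ _ _ _ E).
Proof.
move=> s1 a; exists [seq (1, (q.1, bm_ract q.2 a)) | q <- s].
rewrite big_map -[LHS]mul1r s1 mulr_suml; apply: eq_bigr => q _ /=.
by rewrite scale1r (ripMr ripE).
Qed.

Lemma lip_full_sum : full (@lip _ _ _ _ E) ->
  forall b, exists s : seq (E * E), b = \sum_(q <- s) lip q.1 q.2.
Proof.
move=> fE b; have [s ->] := fE b; exists [seq (q.1 *: q.2.1, q.2.2) | q <- s].
by rewrite big_map; apply: eq_bigr => q _; rewrite (lipZl lipE).
Qed.

Lemma rip_full_sum : full (@rip _ _ _ _ E) ->
  forall a, exists s : seq (E * E), a = \sum_(q <- s) rip q.1 q.2.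
Proof.
move=> fE b; have [s ->] := fE b; exists [seq (q.2.1, q.1 *: q.2.2) | q <- s].
by rewrite big_map; apply: eq_bigr => q _; rewrite (ripZr ripE).
Qed.

Hypothesis compat : forall x y z : E, bm_lact (lip x y) z = bm_ract x (rip y z).

Lemma right_frame s : lip_unital s ->
  forall z : E, z = \sum_(q <- s) bm_ract q.1 (rip q.2 z).
Proof.
move=> s1 z; rewrite -[LHS](lact1 lE) s1 lact_suml.
by apply: eq_bigr => q _; rewrite compat.
Qed.

Lemma left_frame s : rip_unital s ->
  forall z : E, z = \sum_(q <- s) bm_lact (lip z q.1) q.2.
Proof.
move=> s1 z; rewrite -[LHS](ract1 rE) s1 [LHS](ract_sumr (M := bm_right E)).
by apply: eq_bigr => q _; rewrite compat.
Qed.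

(** The action determines b, as b is the sum of the inner products of b q.1 with q.2. *)
Lemma lact_faithful s : lip_unital s ->
  forall b b', (forall x : E, bm_lact b x = bm_lact b' x) -> b = b'.
Proof.
move=> s1 b b' bb'; rewrite -[b]mulr1 -[b']mulr1 s1 !mulr_sumr.
by apply: eq_bigr => q _; rewrite -!(lipMl lipE) /lact /= bb'.
Qed.

Lemma lip_nondegenerate s : rip_unital s -> Defs.nondegenerate (@lip _ _ _ _ E).
Proof.
move=> s1 x x0; rewrite [x](left_frame s1) big1 // => q _.
by rewrite x0; apply: (addrI (bm_lact 0 q.2)); rewrite -(lactDl lE) !addr0.
Qed.

Lemma rip_nondegenerate s : lip_unital s -> Defs.nondegenerate (@rip _ _ _ _ E).
Proof.
move=> s1 x x0; rewrite [x](right_frame s1) big1 // => q _.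
by rewrite (ripC ripE) x0 star0; exact: (ract0r (M := bm_right E)).
Qed.

Hypotheses (hE : is_hact (@bhact _ _ _ _ E))
  (rcov : right_covariant (@bhact _ _ _ _ E) (@rip _ _ _ _ E)).

Let rules := (lact_linl, lact_linr, ract_linl, ract_linr, lip_linl, lip_linr,
  rip_linl, rip_linr, mul_linl, mul_linr, star_semilin, antipode_lin,
  hact_linl hE, hact_linr hE,
  hact_linl (ha_actP A), hact_linr (ha_actP A), hact_linl (ha_actP B),
  hact_linr (ha_actP B), cconjK).

Lemma lact_sw_l (f : H -> H -> B) g (x : E) :
  bm_lact (sw f g) x = sw (fun a b => bm_lact (f a b) x) g.
Proof.
by apply: (sw_morph (phi := fun b => bm_lact b x)) => a b; exact: (lactDl lE).
Qed.

Lemma ract_sw_r (f : H -> H -> A) g (x : E) :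
  bm_ract x (sw f g) = sw (fun a b => bm_ract x (f a b)) g.
Proof. by apply: sw_morph => a b; exact: (ractDr rE). Qed.

Hypothesis hract : forall g (x : E) a,
  bhact g (bm_ract x a) = sw (fun b c => bm_ract (bhact b x) (ha_act c a)) g.

(* Apply [g] to [lip x y . z = x . rip y z].  Left covariance of [lip] and
   compatibility of [g] with the left action follow from each other through this
   expansion. *)
Lemma bhact_lact_lip g (x y z : E) : bhact g (bm_lact (lip x y) z) =
  sw (fun a b => bm_lact
    (sw (fun c d => lip (bhact c x) (bhact (star (antipode d)) y)) a)
    (bhact b z)) g.
Proof.
rewrite compat hract.
under [RHS]eq_sw => a b do rewrite lact_sw_l.
have t1 : trilin (fun c d b : H =>
    bm_lact (lip (bhact c x) (bhact (star (antipode d)) y)) (bhact b z)).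
  by split=> ? ? ? ? ?; rewrite !rules.
rewrite (sw_coassoc _ t1); apply: eq_sw => a b.
by rewrite rcov ract_sw_r; apply: eq_sw => c d; rewrite compat.
Qed.

Lemma bhact_lact_full : full (@lip _ _ _ _ E) ->
  left_covariant (@bhact _ _ _ _ E) (@lip _ _ _ _ E) ->
  forall g b (x : E),
  bhact g (bm_lact b x) = sw (fun c d => bm_lact (ha_act c b) (bhact d x)) g.
Proof.
move=> fE lcov g b x; have [s ->] := lip_full_sum fE b.
elim: s => [|q s IH].
  have l0 (y : E) : bm_lact 0 y = 0.
    by apply: (addrI (bm_lact 0 y)); rewrite -(lactDl lE) !addr0.
  have h0 : bhact g (0 : E) = 0.
    by apply: (addrI (bhact g 0)); rewrite -(hactDr hE) !addr0.
  rewrite big_nil l0 h0 [RHS]big1 // => r _.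
  rewrite (_ : ha_act _ 0 = 0) ?l0 //.
  by apply: (addrI (ha_act r.1 0)); rewrite -(hactDr (ha_actP B)) !addr0.
rewrite big_cons (lactDl lE) (hactDr hE) IH bhact_lact_lip -sw_add.
by apply: eq_sw => c d; rewrite (hactDr (ha_actP B)) (lactDl lE) lcov.
Qed.

Hypothesis hlact : forall g b (x : E),
  bhact g (bm_lact b x) = sw (fun c d => bm_lact (ha_act c b) (bhact d x)) g.

(** Writing F(g) u as F(g_1) g_2 S(g_3) u produces terms F(c)(d v) with v = S(b) u, the shape to
    which [hlact] and [bhact_lact_lip] apply. *)
Lemma lact_expand (F : H -> B) g (u : E) : linear F ->
  bm_lact (F g) u =
  sw (fun a b => sw (fun c d =>
    bm_lact (F c) (bhact d (bhact (antipode b) u))) a) g.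
Proof.
move=> lF; have t1 : trilin (fun c d b : H =>
    bm_lact (F c) (bhact d (bhact (antipode b) u))).
  by split=> ? ? ? ? ?; rewrite ?lF !rules.
rewrite (sw_coassoc _ t1).
rewrite -[LHS](sw_counit_r g (f := fun c => bm_lact (F c) u)); last first.
  by move=> ? ? ?; rewrite lF !rules.
apply: eq_sw => a b.
have l1 : linear (fun c : H => bm_lact (F a) (bhact c u)).
  by move=> ? ? ?; rewrite !rules.
transitivity (sw (fun c d => bm_lact (F a) (bhact (c * antipode d) u)) b).
  by rewrite (sw_antipode_r _ l1) (hact1 hE).
by apply: eq_sw => c d; rewrite (hactM hE).
Qed.

(** By faithfulness both sides may act on a vector u. After [lact_expand] each becomes an expansion
    of the same a (lip x y . v), one through the left module rule, the other through compatibility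
    and right covariance. *)
Lemma left_covariant_of_right s : lip_unital s ->
  left_covariant (@bhact _ _ _ _ E) (@lip _ _ _ _ E).
Proof.
move=> s1 g x y; apply: (lact_faithful s1) => u.
have b1 : bilin (fun g1 g2 : H => lip (bhact g1 x) (bhact (star (antipode g2)) y)).
  by split=> ? ? ? ?; rewrite !rules.
rewrite [LHS](lact_expand (F := fun g => ha_act g (lip x y))); last first.
  by move=> ? ? ?; rewrite !rules.
rewrite [RHS](lact_expand (F := sw _)); last first.
  by move=> k a a'; rewrite swD // swZ.
by apply: eq_sw => a b; rewrite -bhact_lact_lip -hlact.
Qed.
End Bimodule.

Section PicObj.
Variables (R : realDomainType) (H : hopfStarAlg R) (str : bool).
Variables (B A : hstarAlg H) (E : picObj str B A).
Let pE := picP E.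

Lemma pic_lip_unital : exists s : seq (E * E), lip_unital s.
Proof. exact: (lip_full_sum (pic_lip pE) (pic_lfull pE)). Qed.
Lemma pic_rip_unital : exists s : seq (E * E), rip_unital s.
Proof. exact: (rip_full_sum (pic_rip pE) (pic_rfull pE)). Qed.

Lemma bhact_ract g (x : E) a :
  bhact g (bm_ract x a) = sw (fun b c => bm_ract (bhact b x) (ha_act c a)) g.
Proof.
exact: (hact_ract (P := pic_ipmod E) (pic_hact pE) (pic_rnondeg pE) (pic_rcov pE)).
Qed.

Lemma bhact_lact g b (x : E) :
  bhact g (bm_lact b x) = sw (fun c d => bm_lact (ha_act c b) (bhact d x)) g.
Proof.
exact: (bhact_lact_full (pic_lip pE) (pic_compat pE) (pic_hact pE)
  (pic_rcov pE) bhact_ract (pic_lfull pE) (pic_lcov pE)).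
Qed.

Lemma rip_covariant_adj g (x y : E) : rip x (bhact g y) =
  sw (fun a b => ha_act b (rip (bhact (star a) x) y)) g.
Proof.
exact: ((covariant_adjP (P := pic_ipmod E) (pic_hact pE)).1 (pic_rcov pE)).
Qed.

Lemma pic_frame s : lip_unital s -> @frame _ _ _ (pic_ipmod E) s.
Proof. by move=> s1 x; exact: (right_frame (pic_compat pE) s1). Qed.

(** With its left structure forgotten, a bimodule is an object of Proj, so what is proved about P
    (x) E serves for F (x) E as well. *)
Lemma pic_is_proj : is_proj str (pic_ipmod E).
Proof.
have [s /pic_frame fs] := pic_lip_unital.
split.
- exact: pic_hact pE.
- exact: pic_rcov pE.
- exact: frame_fg fs.
- exact: frame_proj fs.
- exact: frame_sndeg fs.
- exact: pic_rcp pE.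
Qed.
End PicObj.

(** * Interior tensor products *)

Section TensorModule.
Variables (R : realDomainType) (H : hopfStarAlg R) (str : bool).
Variables (B A : hstarAlg H) (P : ipMod B) (E : picObj str B A).
Local Notation C := (cplx R).
Let pE := picP E.

Local Notation T := (tensor P (bm_left E)).
Local Notation "p \ox x" := (@pure _ _ P (bm_left E) p x) (at level 40).
Local Notation icls := (@icls _ _ _ _ _ P E).

Definition ipure (p : P) (x : E) : ptens P E := icls (p \ox x).

Lemma ipureDl p p' x : ipure (p + p') x = ipure p x + ipure p' x.
Proof. by rewrite /ipure (balDl (pure_balanced P (bm_left E))) iclsD. Qed.
Lemma ipureDr p x x' : ipure p (x + x') = ipure p x + ipure p x'.
Proof. by rewrite /ipure (balDr (pure_balanced P (bm_left E))) iclsD. Qed.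
Lemma ipure_bal p b x : ipure (ract p b) x = ipure p (bm_lact b x).
Proof. by rewrite /ipure (bal_act (pure_balanced P (bm_left E))). Qed.
Lemma ipureZr k p x : ipure p (k *: x) = k *: ipure p x.
Proof. by rewrite /ipure -scale_pure iclsZ. Qed.
Lemma ipureZl k p x : ipure (k *: p) x = k *: ipure p x.
Proof.
rewrite -[p in LHS](ract1 (ractP P)) -(ractZr (ractP P)) ipure_bal.
by rewrite (lactZl (bm_lactP E)) (lact1 (bm_lactP E)) ipureZr.
Qed.
Lemma ipure_linl k p p' x : ipure (k *: p + p') x = k *: ipure p x + ipure p' x.
Proof. by rewrite ipureDl ipureZl. Qed.
Lemma ipure_linr k p x x' : ipure p (k *: x + x') = k *: ipure p x + ipure p x'.
Proof. by rewrite ipureDr ipureZr. Qed.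
Lemma ipure_suml I (s : seq I) (F : I -> P) x :
  ipure (\sum_(i <- s) F i) x = \sum_(i <- s) ipure (F i) x.
Proof.
apply: (big_morph (fun p => ipure p x)) => [p p'|]; first exact: ipureDl.
by apply: (addrI (ipure 0 x)); rewrite -ipureDl !addr0.
Qed.
Lemma ipure_sumr I (s : seq I) p (F : I -> E) :
  ipure p (\sum_(i <- s) F i) = \sum_(i <- s) ipure p (F i).
Proof.
apply: (big_morph (ipure p)) => [x x'|]; first exact: ipureDr.
by apply: (addrI (ipure p 0)); rewrite -ipureDr !addr0.
Qed.

Lemma ip_ipure p x q y :
  ip (ipure p x) (ipure q y) = rip x (bm_lact (ip p q) y).
Proof. by rewrite /ip /= iip_icls tip_pp. Qed.
Lemma ract_ipure p x a : ract (ipure p x) a = ipure p (bm_ract x a).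
Proof. by rewrite /ract /= iract_icls tract_pure. Qed.

Lemma ptens_ind (K : ptens P E -> Prop) :
  K 0 -> (forall p x t, K t -> K (ipure p x + t)) -> forall t, K t.
Proof.
move=> K0 KD; elim/itensW; elim/(@tensor_ind _ _ P (bm_left E)) => [|p x t IH].
  by rewrite (_ : icls 0 = 0) //; exact: raddf0.
by rewrite iclsD; exact: KD.
Qed.

Lemma ptens_span (t : ptens P E) :
  exists s : seq (P * E), t = \sum_(q <- s) ipure q.1 q.2.
Proof.
elim/ptens_ind: t => [|p x t [s ->]]; first by exists [::]; rewrite big_nil.
by exists ((p, x) :: s); rewrite big_cons.
Qed.

(** Placed in the tensor product before the division, since it is what shows that the degeneracy
    space is zero. Expand p in P, carry the coefficient <f, p> across to x, and expand the result in
    E; the coefficients obtained are the inner products with f (x) f'. *)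
Lemma tensor_frame (sP : seq (P * P)) (sE : seq (E * E)) :
  frame sP -> lip_unital sE -> forall t : T,
  t = \sum_(q <- sP) \sum_(r <- sE) tract (q.1 \ox r.1) (tip (q.2 \ox r.2) t).
Proof.
move=> fP uE t; have bp := pure_balanced P (bm_left E).
elim/(@tensor_ind _ _ P (bm_left E)): t => [|p x t IH].
  rewrite big1 // => q _; rewrite big1 // => r _; rewrite tip0r.
  by apply: (addrI (tract (q.1 \ox r.1) 0)); rewrite -(ractDr (tractP P E)) !addr0.
rewrite {1}IH.
under [RHS]eq_bigr => q _ do under eq_bigr => r _ do
  rewrite tipDr (ractDr (tractP P E)).
under [RHS]eq_bigr => q _ do rewrite big_split.
rewrite big_split; congr (_ + _); rewrite {1}[p]fP.
rewrite (big_morph (fun p => p \ox x) (id1 := 0) (op1 := +%R)); first last.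
- by apply: (addrI (0 \ox x)); rewrite -(balDl bp) !addr0.
- by move=> u v; rewrite (balDl bp).
apply: eq_bigr => q _; rewrite (bal_act bp).
rewrite {1}(right_frame (pic_compat pE) uE (lact (ip q.2 p) (x : bm_left E))).
rewrite (big_morph (fun x => q.1 \ox x) (id1 := 0) (op1 := +%R)); first last.
- by apply: (addrI (q.1 \ox 0)); rewrite -(balDr bp) !addr0.
- by move=> u v; rewrite (balDr bp).
by apply: eq_bigr => r _; rewrite tract_pure tip_pp.
Qed.

Hypothesis hP : is_proj str P.
Let hactP := proj_hact hP.

(** A representative and t have the same inner products, hence the same frame expansion. From here
    on, operations defined through [repr] may be evaluated on any tensor. *)
Lemma repr_icls (t : T) : repr (icls t) = t.
Proof.
have [sP fP] := frame_exists (proj_fg hP) (proj_proj hP) (proj_nondeg hP).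
have [sE uE] := pic_lip_unital E.
rewrite [LHS](tensor_frame fP uE) [RHS](tensor_frame fP uE).
by apply: eq_bigr => q _; apply: eq_bigr => r _; rewrite tip_repr_iclsr.
Qed.

Lemma ptens_frame : exists s, @frame _ _ _ (ptens P E) s.
Proof.
have [sP fP] := frame_exists (proj_fg hP) (proj_proj hP) (proj_nondeg hP).
have [sE uE] := pic_lip_unital E.
exists [seq (ipure q.1 r.1, ipure q.2 r.2) | q <- sP, r <- sE] => t.
rewrite big_allpairs_dep -{1}[t]reprK {1}(tensor_frame fP uE (repr t)).
rewrite -/(icls _) [LHS](raddf_sum (icls)).
apply: eq_bigr => q _; rewrite [LHS](raddf_sum (icls)).
apply: eq_bigr => r _; rewrite /ract /ip /= iract_icls /iip.
by rewrite tip_repr_icls.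
Qed.

Let rules := (mul_linl, mul_linr, star_semilin, antipode_lin, hact_linl hactP,
  hact_linr hactP, hact_linl (ha_actP A), hact_linr (ha_actP A), hact_linl (ha_actP B),
  hact_linr (ha_actP B), cconjK, hact_linl (pic_hact pE), hact_linr (pic_hact pE),
  ip_linl, ip_linr, rip_linl (pic_rip pE), rip_linr (pic_rip pE), lact_linl, lact_linr,
  ract_linl, ract_linr, ipure_linl, ipure_linr).

(** Balancing over b: both p b (x) x and p (x) b x lead to g_1 p (x) (g_2 b)(g_3 x), reached by the
    two groupings of the iterated coproduct. *)
Lemma thact_balanced g : @balanced _ _ P (bm_left E) T
  (fun p x => sw (fun a b => hact a p \ox bhact b x) g).
Proof.
have bp := pure_balanced P (bm_left E).
split=> [p p' x|p x x'|p b x].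
- by rewrite -sw_add; apply: eq_sw => c d; rewrite (hactDr hactP) (balDl bp).
- by rewrite -sw_add; apply: eq_sw => c d; rewrite (hactDr (pic_hact pE)) (balDr bp).
have pPl k (p1 p2 : P) (y : E) : (k *: p1 + p2) \ox y = k *: (p1 \ox y) + p2 \ox y.
  rewrite (balDl bp) -[p1 in LHS](ract1 (ractP P)) -(ractZr (ractP P)) (bal_act bp).
  by rewrite (lactZl (lactP (bm_left E))) (lact1 (lactP (bm_left E))) scale_pure.
have pPr k (q : P) (y1 y2 : E) : q \ox (k *: y1 + y2) = k *: (q \ox y1) + q \ox y2.
  by rewrite (balDr bp) scale_pure.
have t1 : trilin (fun c d e : H =>
    hact c p \ox bm_lact (ha_act d b) (bhact e x)).
  by split=> ? ? ? ? ?; rewrite !rules ?pPl ?pPr.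
transitivity (sw (fun c d => sw (fun e f =>
    hact e p \ox bm_lact (ha_act f b) (bhact d x)) c) g).
  apply: eq_sw => c d; rewrite (hact_ract hactP (proj_nondegenerate hP) (proj_cov hP)).
  rewrite (sw_morph (phi := fun q => q \ox bhact d x)); last first.
    by move=> ? ?; rewrite (balDl bp).
  by apply: eq_sw => e f; rewrite (bal_act bp).
rewrite (sw_coassoc _ t1); apply: eq_sw => c d.
rewrite [bhact d _](bhact_lact d b (x : E)).
rewrite (sw_morph (phi := fun y => hact c p \ox y)) //.
by move=> ? ?; rewrite (balDr bp).
Qed.

Lemma ptens_hactDr g (t u : ptens P E) : hact g (t + u) = hact g t + hact g u.
Proof.
elim/itensW: t => t; elim/itensW: u => u.
rewrite /hact /= -iclsD /ihact !repr_icls -iclsD; congr icls.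
exact: (tliftD (thact_balanced g)).
Qed.

Lemma hact_ipure g p x :
  hact g (ipure p x) = sw (fun a b => ipure (hact a p) (bhact b x)) g.
Proof.
rewrite /hact /= /ihact repr_icls /thact (tlift_pure (thact_balanced g)).
exact: (sw_morph (phi := icls) _ _ (@iclsD _ _ _ _ _ _ _)).
Qed.

Lemma ptens_hact0 g : hact g (0 : ptens P E) = 0.
Proof. by apply: (addrI (hact g 0)); rewrite -ptens_hactDr !addr0. Qed.

Lemma ipure_bilin p x : bilin (fun a b : H => ipure (hact a p) (bhact b x)).
Proof. by split=> ? ? ? ?; rewrite !rules. Qed.

Lemma ptens_hactP : is_hact (@hact _ _ _ (ptens P E)).
Proof.
have b1 := ipure_bilin.
split; last 5 first.
- exact: ptens_hactDr.
- move=> c g t; elim/ptens_ind: t => [|p x t IH].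
    by rewrite !ptens_hact0 scaler0.
  by rewrite !ptens_hactDr scalerDr IH !hact_ipure swZ.
- move=> c g t; elim/ptens_ind: t => [|p x t IH].
    by rewrite scaler0 !ptens_hact0 scaler0.
  rewrite scalerDr !ptens_hactDr scalerDr IH -ipureZr !hact_ipure sw_scale.
  by congr (_ + _); apply: eq_sw => a b; rewrite (hactZr (pic_hact pE)) ipureZr.
- move=> g h t; elim/ptens_ind: t => [|p x t IH]; first by rewrite !ptens_hact0.
  rewrite !ptens_hactDr IH !hact_ipure sw_mul //; congr (_ + _).
  rewrite sw_exchange [RHS](sw_morph _ _ (ptens_hactDr _)).
  apply: eq_sw => a b; rewrite hact_ipure; apply: eq_sw => c d.
  by rewrite (hactM hactP) (hactM (pic_hact pE)).
- move=> t; elim/ptens_ind: t => [|p x t IH]; first by rewrite !ptens_hact0.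
  by rewrite !ptens_hactDr IH hact_ipure sw_one // (hact1 hactP) (hact1 (pic_hact pE)).
- move=> g h t; elim/ptens_ind: t => [|p x t IH].
    by rewrite !ptens_hact0 addr0.
  by rewrite !ptens_hactDr IH !hact_ipure swD // addrACA.
Qed.

Lemma ptens_cov : right_covariant (@hact _ _ _ (ptens P E)) (@ip _ _ _ (ptens P E)).
Proof.
have adjP := (covariant_adjP hactP).1 (proj_cov hP).
apply/(covariant_adjP ptens_hactP) => g t u.
have h0 h : ha_act h (0 : A) = 0.
  by apply: (addrI (ha_act h 0)); rewrite -(hactDr (ha_actP A)) !addr0.
elim/ptens_ind: t => [|p x t IH].
  by rewrite ip0l [RHS]big1 // => q _; rewrite ptens_hact0 ip0l h0.
rewrite ipDl IH.
under [X in _ = X]eq_sw => a b do rewrite ptens_hactDr ipDl (hactDr (ha_actP A)).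
rewrite sw_add; congr (_ + _) => {IH t}.
elim/ptens_ind: u => [|q y u IH].
  by rewrite ptens_hact0 ip0r [RHS]big1 // => r _; rewrite ip0r h0.
rewrite ptens_hactDr (ripDr (ipP (ptens P E))) IH.
under [X in _ = X]eq_sw => a b do
  rewrite (ripDr (ipP (ptens P E))) (hactDr (ha_actP A)).
rewrite sw_add; congr (_ + _) => {IH u}.
have t1 : trilin (fun c d b : H =>
    rip x (bm_lact (ha_act d (ip (hact (star c) p) q)) (bhact b y))).
  by split=> ? ? ? ? ?; rewrite !rules.
have t2 : trilin (fun c d b : H =>
    ha_act b (rip (bhact (star d) x) (bm_lact (ip (hact (star c) p) q) y))).
  by split=> ? ? ? ? ?; rewrite !rules.
rewrite hact_ipure ip_sw.
(* The adjoint form for P moves the first leg of g off q, leaving an operation on the B-valued inner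
   product. *)
transitivity (sw (fun a b => sw (fun c d =>
    rip x (bm_lact (ha_act d (ip (hact (star c) p) q)) (bhact b y))) a) g).
  apply: eq_sw => a b; rewrite ip_ipure adjP lact_sw_l.
  by apply: sw_morph => ? ?; exact: rip_Dr.
rewrite (sw_coassoc _ t1).
(* Regrouped, the last two legs act together on b y with b = <c^* p, q>; the adjoint form for E then
   moves them off that vector. *)
transitivity (sw (fun a b => sw (fun c d =>
    ha_act b (rip (bhact (star d) x) (bm_lact (ip (hact (star c) p) q) y))) a) g).
  rewrite (sw_coassoc _ t2); apply: eq_sw => a b.
  rewrite -rip_covariant_adj bhact_lact; symmetry.
  by apply: sw_morph => ? ?; exact: rip_Dr.
(* The stars c^* on p and d^* on x reassemble into a^* acting on p (x) x, because the coproduct is a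
   star-homomorphism. *)
apply: eq_sw => a b; rewrite hact_ipure (sw_star _ (ipure_bilin _ _)).
rewrite (sw_morph (phi := fun t => ha_act b (ip t (ipure q y)))); last first.
  by move=> ? ?; rewrite ipDl (hactDr (ha_actP A)).
by apply: eq_sw => c d; rewrite ip_ipure.
Qed.

End TensorModule.

(** * Positive matrices and complete positivity of tensor products *)

Section Positivity.
Variables (R : realDomainType).

Lemma mx_positive_sum (A : starAlg R) n I (s : seq I) (F : I -> 'M[A]_n) :
  (forall i, mx_positive (F i)) -> mx_positive (\sum_(i <- s) F i).
Proof.
move=> F_ge0 w pw; have [wD _ _] := pw.
have w0 : w 0 = 0 by apply: (addrI (w 0)); rewrite -wD !addr0.
rewrite (big_morph w wD w0); apply: (big_ind (@cnneg R)) => [|z v|i _].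
- by rewrite /cnneg /= eqxx lexx.
- exact: cnneg_add.
- exact: F_ge0.
Qed.

Lemma mx_positive_sq (A : starAlg R) n (N : 'M[A]_n) :
  mx_positive ((map_mx (@star R A) N)^T *m N).
Proof. by move=> w; case. Qed.

(** Positive matrices need not be sums of squares, so Phi M is not examined directly: [w \o Phi] is
    a positive functional once Phi sends squares to positive matrices, and M is tested on it. *)
Lemma mx_positive_map (B A : starAlg R) m n (Phi : 'M[B]_m -> 'M[A]_n) :
  (forall M N, Phi (M + N) = Phi M + Phi N) ->
  (forall (c : cplx R) M,
     Phi (map_mx (fun b : B => c *: b) M) = map_mx (fun a : A => c *: a) (Phi M)) ->
  (forall N : 'M[B]_m, mx_positive (Phi ((map_mx (@star R B) N)^T *m N))) ->
  forall M, mx_positive M -> mx_positive (Phi M).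
Proof.
move=> PhiD PhiZ Phi_sq M M_ge0 w pw; have [wD wZ _] := pw.
apply: (M_ge0 (w \o Phi)); split=> [N N'|c N|N] /=.
- by rewrite PhiD wD.
- by rewrite PhiZ wZ.
- exact: Phi_sq.
Qed.
End Positivity.

Section TensorPositive.
Variables (R : realDomainType) (H : hopfStarAlg R) (str : bool).
Variables (B A : hstarAlg H) (P : ipMod B) (E : picObj str B A).
Let pE := picP E.
Let lE := bm_lactP E.

Lemma rip_suml I (s : seq I) (F : I -> E) y :
  rip (\sum_(i <- s) F i) y = \sum_(i <- s) rip (F i) y.
Proof. exact: (ip_suml (P := pic_ipmod E)). Qed.
Lemma rip_sumr I (s : seq I) (F : I -> E) y :
  rip y (\sum_(i <- s) F i) = \sum_(i <- s) rip y (F i).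
Proof. exact: (ip_sumr (P := pic_ipmod E)). Qed.

(* Over a finite generating family [e] of P every element of the tensor product
   is a combination of the [e k] with coefficients [y k] in E, which avoids
   flattening sums of different lengths. *)
Lemma ptens_coord n (e : 'I_n -> P) :
  (forall x, exists b : 'I_n -> B, x = \sum_i ract (e i) (b i)) ->
  forall t : ptens P E, exists y : 'I_n -> E, t = \sum_k ipure (e k) (y k).
Proof.
move=> eP; elim/ptens_ind => [|p x t [y ->]].
  exists (fun=> 0); rewrite big1 // => k _.
  by apply: (addrI (ipure (e k) (0 : E))); rewrite -ipureDr !addr0.
have [b ->] := eP p; exists (fun k => bm_lact (b k) x + y k).
rewrite ipure_suml -big_split; apply: eq_bigr => k _.
by rewrite ipure_bal ipureDr.
Qed.

Lemma ptens_cp : fin_generated P -> completely_positive (@ip _ _ _ P) ->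
  completely_positive (@rip _ _ _ _ E) ->
  completely_positive (@ip _ _ _ (ptens P E)).
Proof.
move=> [m [e eP]] cpP cpE n t.
pose y i := sval (cid (ptens_coord eP (t i))).
have tE i : t i = \sum_k ipure (e k) (y i k) by rewrite /y; case: cid.
(* Chosen so that the Gram matrix of the t i is the image of the Gram matrix of the generators of
   P. *)
pose Phi (M : 'M[B]_m) : 'M[A]_n :=
  \matrix_(i, j) \sum_k \sum_l rip (y i k) (bm_lact (M k l) (y j l)).
have -> : \matrix_(i, j) ip (t i) (t j) = Phi (\matrix_(k, l) ip (e k) (e l)).
  apply/matrixP => i j; rewrite !mxE !tE ip_suml; apply: eq_bigr => k _.
  by rewrite ip_sumr; apply: eq_bigr => l _; rewrite ip_ipure mxE.
apply: mx_positive_map (cpP m e) => [M N|c M|N].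
- apply/matrixP => i j; rewrite !mxE -big_split; apply: eq_bigr => k _.
  rewrite -big_split; apply: eq_bigr => l _.
  by rewrite mxE (lactDl lE) rip_Dr.
- apply/matrixP => i j; rewrite !mxE scaler_sumr; apply: eq_bigr => k _.
  rewrite scaler_sumr; apply: eq_bigr => l _.
  by rewrite mxE (lactZl lE) rip_Zr.
(* On a square, each row r of N contributes the Gram matrix of the vectors [z r i], which is
   positive by complete positivity of E. *)
pose z r i : E := \sum_k bm_lact (N r k) (y i k).
rewrite (_ : Phi _ = \sum_r \matrix_(i, j) rip (z r i) (z r j)).
  by apply: mx_positive_sum => r; exact: cpE.
apply/matrixP => i j; rewrite summxE mxE.
under [RHS]eq_bigr => r _ do rewrite mxE rip_suml.
rewrite [RHS]exchange_big; apply: eq_bigr => k _.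
under [RHS]eq_bigr => r _ do rewrite rip_sumr.
rewrite [RHS]exchange_big; apply: eq_bigr => l _.
rewrite mxE lact_suml rip_sumr; apply: eq_bigr => r _.
by rewrite !mxE (lactM lE) (pic_ladj pE).
Qed.

Lemma ptens_is_proj : is_proj str P -> is_proj str (ptens P E).
Proof.
move=> hP; have [s fs] := ptens_frame E hP.
split.
- exact: ptens_hactP.
- exact: ptens_cov.
- exact: frame_fg fs.
- exact: frame_proj fs.
- exact: frame_sndeg fs.
- move=> st; apply: ptens_cp; [exact: proj_fg hP| exact: proj_cp hP st|].
  exact: pic_rcp pE st.
Qed.
End TensorPositive.

Local Arguments ip : simpl never.
Local Arguments hact : simpl never.
Local Arguments rip : simpl never.
Local Arguments lip : simpl never.
Local Arguments bhact : simpl never.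
Local Arguments bm_lact : simpl never.
Local Arguments bm_ract : simpl never.
Local Arguments ract : simpl never.

(** * The tensor product of two equivalence bimodules *)

Section BimoduleTensor.
Variables (R : realDomainType) (H : hopfStarAlg R) (str : bool).
Variables (D B A : hstarAlg H) (F : picObj str D B) (E : picObj str B A).
Local Notation C := (cplx R).
Let pF := picP F.
Let pE := picP E.
Let hF := pic_is_proj F.

Definition bpure (y : F) (x : E) : btens F E := @ipure _ _ _ _ _ (pic_ipmod F) E y x.

Lemma bpureDl y y' x : bpure (y + y') x = bpure y x + bpure y' x.
Proof. exact: ipureDl. Qed.
Lemma bpure_bal y b x : bpure (bm_ract y b) x = bpure y (bm_lact b x).
Proof. exact: (@ipure_bal _ _ _ _ _ (pic_ipmod F)). Qed.
Lemma bpure_linl k y y' x : bpure (k *: y + y') x = k *: bpure y x + bpure y' x.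
Proof. exact: ipure_linl. Qed.
Lemma bpure_linr k y x x' : bpure y (k *: x + x') = k *: bpure y x + bpure y x'.
Proof. exact: ipure_linr. Qed.
Lemma bpure_sumr I (s : seq I) y (G : I -> E) :
  bpure y (\sum_(i <- s) G i) = \sum_(i <- s) bpure y (G i).
Proof. exact: ipure_sumr. Qed.

Lemma btens_ind (K : btens F E -> Prop) :
  K 0 -> (forall y x t, K t -> K (bpure y x + t)) -> forall t, K t.
Proof. exact: (@ptens_ind _ _ _ _ _ (pic_ipmod F) E K). Qed.

Lemma bm_lact_bpure d y x : bm_lact d (bpure y x) = bpure (bm_lact d y) x.
Proof.
rewrite -[LHS]/(ilact d (icls (pure _ _))) ilact_icls.
by congr icls; exact: tlact_pure.
Qed.
Lemma bm_ract_bpure y x a : bm_ract (bpure y x) a = bpure y (bm_ract x a).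
Proof. exact: (@ract_ipure _ _ _ _ _ (pic_ipmod F)). Qed.
Lemma rip_bpure y x y' x' :
  rip (bpure y x) (bpure y' x') = rip x (bm_lact (rip y y') x').
Proof. exact: (@ip_ipure _ _ _ _ _ (pic_ipmod F)). Qed.
Lemma bhact_bpure g y x :
  bhact g (bpure y x) = sw (fun a b => bpure (bhact a y) (bhact b x)) g.
Proof. exact: hact_ipure. Qed.

Local Notation T := (tensor (pic_ipmod F) (bm_left E)).

Lemma lip_lact_r (x y : E) b : lip x (bm_lact b y) = lip x y * star b.
Proof.
have lE := pic_lip pE.
by rewrite (lipC lE) [lip (bm_lact _ _) _](lipMl lE) starM -(lipC lE).
Qed.
Lemma lipDr (x y z : E) : lip x (y + z) = lip x y + lip x z.
Proof.
have lE := pic_lip pE.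
by rewrite (lipC lE) (lipDl lE) starD -!(lipC lE).
Qed.

(** A lift asks only for additivity and balancing, so it applies although the left inner product is
    antilinear in its second argument. *)
Lemma tlip_inner_balanced (y : F) (x : E) :
  @balanced _ _ (pic_ipmod F) (bm_left E) D
    (fun y' x' => lip (bm_ract y (lip x x')) y').
Proof.
have lF := pic_lip pF; have rF := bm_ractP F.
split=> [p p' z|p z z'|p b z].
- by rewrite (lipC lF) (lipDl lF) starD -!(lipC lF).
- by rewrite lipDr (ractDr rF) (lipDl lF).
- rewrite [lip x (lact b z)](lip_lact_r x z b) (ractM rF).
  by rewrite [RHS](pic_radj pF) star_involutive.
Qed.

Lemma tlip_outer_balanced (u : T) :
  @balanced _ _ (pic_ipmod F) (bm_left E) D
    (fun y x => @tlift _ _ (pic_ipmod F) (bm_left E) D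
      (fun y' x' => lip (bm_ract y (lip x x')) y') u).
Proof.
have lF := pic_lip pF; have rF := bm_ractP F.
split=> [p p' z|p z z'|p b z].
- rewrite /tlift -big_split; apply: eq_bigr => q _.
  by rewrite (ractDl rF) (lipDl lF).
- rewrite /tlift -big_split; apply: eq_bigr => q _.
  by rewrite (lipDl (pic_lip pE)) (ractDr rF) (lipDl lF).
- apply: eq_bigr => q _; rewrite (lipMl (pic_lip pE)).
  by rewrite (ractM rF).
Qed.

Lemma lip_icls (t u : T) :
  lip (icls t : btens F E) (icls u : btens F E) = tlip t u.
Proof. by rewrite -[t in RHS](repr_icls hF) -[u in RHS](repr_icls hF). Qed.

Lemma lip_bpure y x y' x' :
  lip (bpure y x) (bpure y' x') = lip (bm_ract y (lip x x')) y'.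
Proof.
rewrite [LHS]lip_icls /tlip (tlift_pure (tlip_outer_balanced _)).
exact: (tlift_pure (tlip_inner_balanced y x)).
Qed.

Lemma btens_lipDl (t t' u : btens F E) : lip (t + t') u = lip t u + lip t' u.
Proof.
elim/itensW: t => t; elim/itensW: t' => t'; elim/itensW: u => u.
rewrite -[_ + _ in LHS]/((icls t : itens (pic_ipmod F) E) + icls t') -iclsD.
rewrite [LHS]lip_icls [X in _ = X + _]lip_icls [X in _ = _ + X]lip_icls.
exact: (tliftD (tlip_outer_balanced _)).
Qed.

Lemma btens_lip0l u : lip (0 : btens F E) u = 0.
Proof. by apply: (addrI (lip 0 u)); rewrite -btens_lipDl !addr0. Qed.

Lemma btens_lipDr (t u u' : btens F E) : lip t (u + u') = lip t u + lip t u'.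
Proof.
elim/btens_ind: t => [|y x t IH]; first by rewrite !btens_lip0l addr0.
rewrite !btens_lipDl IH addrACA; congr (_ + _) => {IH t}.
elim/itensW: u => u; elim/itensW: u' => u'.
rewrite -[_ + _ in LHS]/((icls u : itens (pic_ipmod F) E) + icls u').
rewrite -iclsD [LHS]lip_icls.
rewrite [X in _ = X + _]lip_icls [X in _ = _ + X]lip_icls /tlip.
rewrite !(tlift_pure (tlip_outer_balanced _)).
exact: (tliftD (tlip_inner_balanced y x)).
Qed.

Lemma btens_lip0r u : lip u (0 : btens F E) = 0.
Proof. by apply: (addrI (lip u 0)); rewrite -btens_lipDr !addr0. Qed.

Let Q := btens F E.
Let lQ := bm_lactP Q.
Let rQ := bm_ractP Q.

Lemma btens_lipP : @is_lip _ D (bm_left Q) (@lip _ _ _ _ Q).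
Proof.
have lF := pic_lip pF.
have lipMQ d (t u : Q) : lip (bm_lact d t) u = d * lip t u.
  elim/btens_ind: t => [|y x t IH].
    rewrite (_ : bm_lact d 0 = 0) ?btens_lip0l ?mulr0 //.
    by apply: (addrI (bm_lact d 0)); rewrite -(lactDr lQ) !addr0.
  rewrite (lactDr lQ) !btens_lipDl IH mulrDr; congr (_ + _) => {IH t}.
  elim/btens_ind: u => [|y' x' u IH]; first by rewrite !btens_lip0r mulr0.
  rewrite !btens_lipDr IH mulrDr bm_lact_bpure !lip_bpure; congr (_ + _).
  by rewrite bm_actA -(lipMl lF).
split=> [t u w|c t u|d t u|t u].
- exact: btens_lipDl.
- rewrite -[t in LHS](lact1 lQ) -(lactZl lQ) lipMQ -scaler_mul_l mul1r //.
- exact: lipMQ.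
elim/btens_ind: t => [|y x t IH]; first by rewrite btens_lip0l btens_lip0r star0.
rewrite !btens_lipDl btens_lipDr starD IH; congr (_ + _) => {IH t}.
elim/btens_ind: u => [|y' x' u IH]; first by rewrite btens_lip0l btens_lip0r star0.
rewrite !btens_lipDr btens_lipDl starD IH; congr (_ + _) => {IH u}.
by rewrite !lip_bpure (pic_radj pF) -(lipC lF) -(lipC (pic_lip pE)).
Qed.

Lemma btens_compat (t u w : Q) : bm_lact (lip t u) w = bm_ract t (rip u w).
Proof.
have l0 d : bm_lact d (0 : Q) = 0.
  by apply: (addrI (bm_lact d 0)); rewrite -(lactDr lQ) !addr0.
have l0' (q : Q) : bm_lact 0 q = 0.
  by apply: (addrI (bm_lact 0 q)); rewrite -(lactDl lQ) !addr0.
have r0 (q : Q) : bm_ract q 0 = 0 := ract0r (M := bm_right Q) q.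
have r0' a : bm_ract (0 : Q) a = 0 := ract0l (bm_right Q) a.
have rl (q : Q) : rip 0 q = 0 := ip0l (P := ptens (pic_ipmod F) E) q.
have rr (q : Q) : rip q 0 = 0 := ip0r (P := ptens (pic_ipmod F) E) q.
have rDl (q q' z : Q) : rip (q + q') z = rip q z + rip q' z :=
  ipDl (P := ptens (pic_ipmod F) E) q q' z.
have rDr (z q q' : Q) : rip z (q + q') = rip z q + rip z q' :=
  ripDr (ipP (ptens (pic_ipmod F) E)) z q q'.
elim/btens_ind: t => [|y x t IH]; first by rewrite btens_lip0l l0' r0'.
rewrite btens_lipDl (lactDl lQ) (ractDl rQ) IH; congr (_ + _) => {IH t}.
elim/btens_ind: u => [|y' x' u IH]; first by rewrite btens_lip0r rl r0 l0'.
rewrite btens_lipDr rDl (lactDl lQ) (ractDr rQ) IH; congr (_ + _) => {IH u}.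
elim/btens_ind: w => [|z v w IH]; first by rewrite l0 rr r0.
rewrite rDr (lactDr lQ) (ractDr rQ) IH; congr (_ + _) => {IH w}.
rewrite lip_bpure rip_bpure bm_lact_bpure bm_ract_bpure.
rewrite (pic_compat pF) -(pic_compat pE) -(ractM (bm_ractP F)) bpure_bal.
by rewrite (lactM (bm_lactP E)).
Qed.

Lemma btens_radj a (t u : Q) : lip (bm_ract t a) u = lip t (bm_ract u (star a)).
Proof.
have r0 b : bm_ract (0 : Q) b = 0 := ract0l (bm_right Q) b.
elim/btens_ind: t => [|y x t IH]; first by rewrite r0 !btens_lip0l.
rewrite (ractDl rQ) !btens_lipDl IH; congr (_ + _) => {IH t}.
elim/btens_ind: u => [|y' x' u IH]; first by rewrite r0 !btens_lip0r.
rewrite (ractDl rQ) !btens_lipDr IH; congr (_ + _) => {IH u}.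
by rewrite !bm_ract_bpure !lip_bpure (pic_radj pE).
Qed.

Lemma btens_ladj d (t u : Q) : rip (bm_lact d t) u = rip t (bm_lact (star d) u).
Proof.
elim/itensW: t => t; elim/itensW: u => u.
rewrite /rip /bm_lact /= !ilact_icls !iip_icls.
exact: tip_tlact.
Qed.

Lemma btens_lip_unital : exists s : seq (Q * Q), lip_unital s.
Proof.
have [sF uF] := pic_lip_unital F; have [sE uE] := pic_lip_unital E.
exists [seq (bpure q.1 r.1, bpure q.2 r.2) | q <- sF, r <- sE].
rewrite /lip_unital big_allpairs_dep [LHS]uF; apply: eq_bigr => q _.
rewrite -{1}[q.1](ract1 (bm_ractP F)) uE [bm_ract _ _](ract_sumr (M := bm_right F)).
rewrite (big_morph (fun y : F => lip y q.2) (id1 := 0) (op1 := +%R)); first last.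
- by apply: (addrI (lip 0 q.2)); rewrite -(lipDl (pic_lip pF)) !addr0.
- by move=> y y'; rewrite (lipDl (pic_lip pF)).
by apply: eq_bigr => r _; rewrite lip_bpure.
Qed.

Lemma btens_rip_unital : exists s : seq (Q * Q), rip_unital s.
Proof.
have [sF uF] := pic_rip_unital F; have [sE uE] := pic_rip_unital E.
exists [seq (bpure q.1 r.1, bpure q.2 r.2) | r <- sE, q <- sF].
rewrite /rip_unital big_allpairs_dep [LHS]uE; apply: eq_bigr => r _.
rewrite -{1}[r.2](lact1 (bm_lactP E)) uF lact_suml rip_sumr.
by apply: eq_bigr => q _; rewrite rip_bpure.
Qed.

Lemma btens_bhact_lact g d (t : Q) :
  bhact g (bm_lact d t) = sw (fun a b => bm_lact (ha_act a d) (bhact b t)) g.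
Proof.
have hQ : is_hact (@bhact _ _ _ _ Q) := ptens_hactP E hF.
have h0 h : bhact h (0 : Q) = 0.
  by apply: (addrI (bhact h 0)); rewrite -(hactDr hQ) !addr0.
have l0 c : bm_lact c (0 : Q) = 0.
  by apply: (addrI (bm_lact c 0)); rewrite -(lactDr lQ) !addr0.
elim/btens_ind: t => [|y x t IH].
  by rewrite l0 h0 [RHS]big1 // => r _; rewrite h0 l0.
rewrite (lactDr lQ) (hactDr hQ) IH.
under [X in _ = X]eq_sw => a b do rewrite (hactDr hQ) (lactDr lQ).
rewrite sw_add; congr (_ + _) => {IH t}.
rewrite bm_lact_bpure bhact_bpure.
have t1 : trilin (fun a b c : H =>
    bpure (bm_lact (ha_act a d) (bhact b y)) (bhact c x)).
  by split=> ? ? ? ? ?; rewrite ?(hact_linl (ha_actP D), hact_linl (pic_hact pF),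
    hact_linl (pic_hact pE), lact_linl, lact_linr, bpure_linl, bpure_linr).
transitivity (sw (fun a b => sw (fun c e =>
    bpure (bm_lact (ha_act c d) (bhact e y)) (bhact b x)) a) g).
  apply: eq_sw => a b; rewrite bhact_lact.
  rewrite (sw_morph (phi := fun y => bpure y (bhact b x))) // => ? ?.
  exact: bpureDl.
rewrite (sw_coassoc _ t1); apply: eq_sw => a b.
rewrite bhact_bpure (sw_morph (phi := bm_lact (ha_act a d))) => [|? ?]; last first.
  exact: (lactDr lQ).
by apply: eq_sw => c e; rewrite bm_lact_bpure.
Qed.

(** Mirror image of [ptens_coord]: for the left inner product the generators are those of E as a
    left module, and the coefficients lie in F. *)
Lemma btens_coord n (e : 'I_n -> E) :
  (forall x, exists b : 'I_n -> B, x = \sum_i bm_lact (b i) (e i)) ->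
  forall t : Q, exists y : 'I_n -> F, t = \sum_k bpure (y k) (e k).
Proof.
move=> eE; elim/btens_ind => [|p x t [y ->]].
  exists (fun=> 0); rewrite big1 // => k _.
  by apply: (addrI (bpure 0 (e k))); rewrite -bpureDl !addr0.
have [b ->] := eE x; exists (fun k => bm_ract p (b k) + y k).
rewrite bpure_sumr -big_split; apply: eq_bigr => k _.
by rewrite -bpure_bal bpureDl.
Qed.

Lemma lip_suml (X Y : hstarAlg H) (G : ipBimod X Y)
    (lG : @is_lip _ X (bm_left G) (@lip _ _ _ _ G)) I (s : seq I) (f : I -> G) y :
  lip (\sum_(i <- s) f i) y = \sum_(i <- s) lip (f i) y.
Proof.
apply: (big_morph (fun x : G => lip x y)) => [x x'|]; first exact: (lipDl lG).
by apply: (addrI (lip 0 y)); rewrite -(lipDl lG) !addr0.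
Qed.
Lemma lip_sumr (X Y : hstarAlg H) (G : ipBimod X Y)
    (lG : @is_lip _ X (bm_left G) (@lip _ _ _ _ G)) I (s : seq I) (f : I -> G) y :
  lip y (\sum_(i <- s) f i) = \sum_(i <- s) lip y (f i).
Proof.
rewrite (lipC lG) lip_suml //.
rewrite (big_morph _ (@starD _ _) (@star0 _ _)); apply: eq_bigr => i _.
by rewrite -(lipC lG).
Qed.

Lemma btens_lcp : completely_positive (@lip _ _ _ _ F) ->
  completely_positive (@lip _ _ _ _ E) -> completely_positive (@lip _ _ _ _ Q).
Proof.
move=> cpF cpE n t; have lF := pic_lip pF; have lQ' := btens_lipP.
have rF := bm_ractP F.
have [s us] := pic_rip_unital E.
pose m := size s; pose e (i : 'I_m) : E := (nth (0, 0) s i).2.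
have eE (x : E) : exists b : 'I_m -> B, x = \sum_i bm_lact (b i) (e i).
  exists (fun i => lip x (nth (0, 0) s i).1).
  by rewrite {1}[x](left_frame (pic_compat pE) us) (big_nth (0, 0)) big_mkord.
pose y i := sval (cid (btens_coord eE (t i))).
have tE i : t i = \sum_k bpure (y i k) (e k) by rewrite /y; case: cid.
pose Phi (M : 'M[B]_m) : 'M[D]_n :=
  \matrix_(i, j) \sum_k \sum_l lip (bm_ract (y i k) (M k l)) (y j l).
have -> : \matrix_(i, j) lip (t i) (t j) = Phi (\matrix_(k, l) lip (e k) (e l)).
  apply/matrixP => i j; rewrite !mxE !tE lip_suml //; apply: eq_bigr => k _.
  by rewrite lip_sumr //; apply: eq_bigr => l _; rewrite lip_bpure mxE.
apply: mx_positive_map (cpE m e) => [M N|c M|N].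
- apply/matrixP => i j; rewrite !mxE -big_split; apply: eq_bigr => k _.
  rewrite -big_split; apply: eq_bigr => l _.
  by rewrite mxE (ractDr rF) (lipDl lF).
- apply/matrixP => i j; rewrite !mxE scaler_sumr; apply: eq_bigr => k _.
  rewrite scaler_sumr; apply: eq_bigr => l _.
  by rewrite mxE (ractZr rF) (lipZl lF).
(* The star appears because an entry of the square is the sum of [star (N r k) * N r l], and moving
   [N r l] to the second argument of [lip] stars it too. *)
pose z r i : F := \sum_k bm_ract (y i k) (star (N r k)).
rewrite (_ : Phi _ = \sum_r \matrix_(i, j) lip (z r i) (z r j)).
  by apply: mx_positive_sum => r; exact: cpF.
apply/matrixP => i j; rewrite summxE mxE.
under [RHS]eq_bigr => r _ do rewrite mxE lip_suml //.
rewrite [RHS]exchange_big; apply: eq_bigr => k _.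
under [RHS]eq_bigr => r _ do rewrite lip_sumr //.
rewrite [RHS]exchange_big; apply: eq_bigr => l _.
rewrite mxE [bm_ract _ (\sum_(_ <- _) _)](ract_sumr (M := bm_right F)) lip_suml //.
apply: eq_bigr => r _.
by rewrite !mxE [ract _ _](ractM rF) (pic_radj pF).
Qed.

Lemma btens_is_pic : is_pic str (btens F E).
Proof.
have hQ := ptens_is_proj E hF.
have rQ' : @is_rip _ A (bm_right Q) (@rip _ _ _ _ Q) := ipP (ptens (pic_ipmod F) E).
have [s1 u1] := btens_lip_unital; have [s2 u2] := btens_rip_unital.
have rn := rip_nondegenerate rQ' btens_compat u1.
split.
- exact: btens_lipP.
- exact: rQ'.
- exact: lip_unital_full btens_lipP _ u1.
- exact: rip_unital_full rQ' _ u2.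
- exact: lip_nondegenerate btens_compat _ u2.
- exact: rn.
- exact: btens_ladj.
- exact: btens_radj.
- exact: btens_compat.
- exact: proj_hact hQ.
- exact: proj_cov hQ.
(* Both module rules are at hand: the left one is [btens_bhact_lact], the right one follows from the
   covariance already obtained from [ptens]. *)
- apply: (left_covariant_of_right btens_lipP btens_compat (proj_hact hQ)
    (proj_cov hQ) _ btens_bhact_lact u1).
  exact: (hact_ract (proj_hact hQ) rn (proj_cov hQ)).
- by move=> st; apply: btens_lcp; [exact: pic_lcp pF st|exact: pic_lcp pE st].
- exact: proj_cp hQ.
Qed.
End BimoduleTensor.

(** * Isometries from Gram matrices *)

Section Matched.
Variables (X Y : zmodType) (I : Type) (u : I -> X) (v : I -> Y).

(** The graph of the additive extension of u i -> v i, available before that extension is known to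
    be a map. Sums without coefficients suffice because the families used generate additively. *)
Definition matched x y := exists s : seq I,
  x = \sum_(i <- s) u i /\ y = \sum_(i <- s) v i.

Lemma matched_gen i : matched (u i) (v i).
Proof. by exists [:: i]; rewrite !big_seq1. Qed.

Lemma matched0 : matched 0 0.
Proof. by exists [::]; rewrite !big_nil. Qed.

Lemma matchedD x y x' y' : matched x y -> matched x' y' -> matched (x + x') (y + y').
Proof. by move=> [s [-> ->]] [t [-> ->]]; exists (s ++ t); rewrite !big_cat. Qed.

Lemma matched_sw (R : realDomainType) (H : hopfStarAlg R) (g : H) f f' :
  (forall a b, matched (f a b) (f' a b)) -> matched (sw f g) (sw f' g).
Proof.
by move=> ff'; apply: (big_ind2 matched); [exact: matched0| exact: matchedD|].
Qed.

Lemma matched_fun f : {morph f : x y / x + y} -> (forall i, f (u i) = v i) ->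
  forall x y, matched x y -> f x = y.
Proof.
move=> fD fu x y [s [-> ->]].
have f0 : f 0 = 0 by apply: (addrI (f 0)); rewrite -fD !addr0.
by rewrite (big_morph f fD f0); apply: eq_bigr.
Qed.

End Matched.

Section GramIso.
Variables (R : realDomainType) (H : hopfStarAlg R) (A : hstarAlg H).
Variables (P Q : ipMod A) (I : Type) (u : I -> P) (v : I -> Q).
Hypotheses (nP : Defs.nondegenerate (@ip _ _ _ P))
  (nQ : Defs.nondegenerate (@ip _ _ _ Q)).
Hypotheses (uP : forall x, exists s, x = \sum_(i <- s) u i)
  (vQ : forall y, exists s, y = \sum_(i <- s) v i).
Hypothesis gram : forall i j, ip (u i) (u j) = ip (v i) (v j).

Let f (x : P) : Q := \sum_(i <- sval (cid (uP x))) v i.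
Let h (y : Q) : P := \sum_(i <- sval (cid (vQ y))) u i.

Lemma gram_sum s t :
  ip (\sum_(i <- s) u i) (\sum_(i <- t) u i) = ip (\sum_(i <- s) v i) (\sum_(i <- t) v i).
Proof.
rewrite !ip_suml; apply: eq_bigr => i _; rewrite !ip_sumr.
by apply: eq_bigr => j _.
Qed.

(** Independence of the chosen decomposition: two decompositions of one vector yield v-sums with
    equal inner products against every y, by [gram_sum], and non-degeneracy of Q identifies them. *)
Let f_sum s : f (\sum_(i <- s) u i) = \sum_(i <- s) v i.
Proof.
rewrite /f; case: cid => t /= E; apply: (ip_inj nQ) => y.
by have [r ->] := vQ y; rewrite -!gram_sum E.
Qed.

Let h_sum s : h (\sum_(i <- s) v i) = \sum_(i <- s) u i.
Proof.
rewrite /h; case: cid => t /= E; apply: (ip_inj nP) => y.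
by have [r ->] := uP y; rewrite !gram_sum E.
Qed.

Let fK : cancel f h. Proof. by move=> x; have [s ->] := uP x; rewrite f_sum h_sum. Qed.
Let hK : cancel h f. Proof. by move=> x; have [s ->] := vQ x; rewrite h_sum f_sum. Qed.

Let f_ip x y : ip (f x) (f y) = ip x y.
Proof. by have [s ->] := uP x; have [t ->] := uP y; rewrite !f_sum gram_sum. Qed.

Let fD : {morph f : x y / x + y}.
Proof.
by move=> x y; have [s ->] := uP x; have [t ->] := uP y; rewrite -big_cat !f_sum big_cat.
Qed.

(** Forced by isometry: with y = f (h y), both sides have inner product <h y, x> a with y. *)
Let f_ract x a : f (ract x a) = ract (f x) a.
Proof.
apply: (ip_inj nQ) => y; rewrite -(hK y) f_ip.
by rewrite (ripMr (ipP P)) (ripMr (ipP Q)) f_ip.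
Qed.

Hypotheses (hP : is_hact (@hact _ _ _ P)) (hQ : is_hact (@hact _ _ _ Q)).
Hypothesis uv_hact : forall g i, matched u v (hact g (u i)) (hact g (v i)).

Lemma gram_iso : exists f : P -> Q,
  [/\ bijective f, right_linear f, forall g x, f (hact g x) = hact g (f x),
      forall x y, ip (f x) (f y) = ip x y & forall i, f (u i) = v i].
Proof.
exists f; split.
- by exists h.
- by split.
- move=> g x; have [s ->] := uP x; rewrite f_sum.
  have hs (M : ipMod A) (hM : is_hact (@hact _ _ _ M)) (F : I -> M) :
      hact g (\sum_(i <- s) F i) = \sum_(i <- s) hact g (F i).
    apply: big_morph => [y z|]; first exact: (hactDr hM).
    by apply: (addrI (hact g 0)); rewrite -(hactDr hM) !addr0.
  rewrite (hs _ hP) (hs _ hQ).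
  have f0 : f 0 = 0 by apply: (addrI (f 0)); rewrite -fD !addr0.
  rewrite (big_morph f fD f0); apply: eq_bigr => i _.
  by have [t [-> ->]] := uv_hact g i; rewrite f_sum.
- exact: f_ip.
- by move=> i; have := f_sum [:: i]; rewrite !big_seq1.
Qed.

Lemma gram_proj_iso : proj_iso P Q.
Proof. by have [k [bk lk hk ik _]] := gram_iso; exists k. Qed.
End GramIso.

(** * Invariance, additivity and associativity of the interior tensor product *)

Section PtensIso.
Variables (R : realDomainType) (H : hopfStarAlg R) (str : bool).

Lemma ptens_congr (B A : hstarAlg H) (P P' : ipMod B) (E E' : picObj str B A) :
  is_proj str P -> is_proj str P' -> proj_iso P P' -> pic_iso E E' ->
  proj_iso (ptens P E) (ptens P' E').
Proof.
move=> hP hP' [f [[f' fK f'K] [fD fM] fh fi]] [k [[k' kK k'K] kD kl kr kh kli kri]].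
have pPE := ptens_is_proj E hP; have pPE' := ptens_is_proj E' hP'.
apply: (gram_proj_iso (u := fun q : P * E => ipure q.1 q.2)
  (v := fun q : P * E => ipure (f q.1) (k q.2) : ptens P' E')
  (proj_nondegenerate pPE) (proj_nondegenerate pPE')).
- exact: ptens_span.
- move=> t; have [s ->] := ptens_span t; exists [seq (f' q.1, k' q.2) | q <- s].
  by rewrite big_map; apply: eq_bigr => q _; rewrite f'K k'K.
- by move=> [p x] [q y] /=; rewrite !ip_ipure fi -kl kri.
- exact: proj_hact pPE.
- exact: proj_hact pPE'.
- move=> g [p x] /=; rewrite !hact_ipure //; apply: matched_sw => a b.
  by rewrite -fh -kh; exact: (matched_gen _ _ (hact a p, bhact b x)).
Qed.

Lemma ptens_dsum (B A : hstarAlg H) (P Q : ipMod B) (E : picObj str B A) :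
  is_proj str P -> is_proj str Q ->
  proj_iso (ptens (dsum P Q) E) (dsum (ptens P E) (ptens Q E)).
Proof.
move=> hP hQ; have hPQ := dsum_is_proj hP hQ.
have h1 := ptens_is_proj E hPQ.
have h2 := dsum_is_proj (ptens_is_proj E hP) (ptens_is_proj E hQ).
apply: (gram_proj_iso (u := fun q : dsum P Q * E => ipure q.1 q.2)
  (v := fun q : dsum P Q * E => (ipure q.1.1 q.2, ipure q.1.2 q.2) :
     dsum (ptens P E) (ptens Q E))
  (proj_nondegenerate h1) (proj_nondegenerate h2)).
- exact: ptens_span.
- move=> [t w]; have [s1 ->] := ptens_span t; have [s2 ->] := ptens_span w.
  exists ([seq ((q.1, 0) : dsum P Q, q.2) | q <- s1] ++
          [seq ((0, q.1) : dsum P Q, q.2) | q <- s2]).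
  have i0 (M : ipMod B) (x : E) : ipure (0 : M) x = 0 :> ptens M E.
    by apply: (addrI (ipure 0 x)); rewrite -ipureDl !addr0.
  rewrite big_cat !big_map /=.
  under [X in _ = X + _]eq_bigr do rewrite i0.
  under [X in _ = _ + X]eq_bigr do rewrite i0.
  have pair_sum I (s : seq I) (F : I -> ptens P E) (G : I -> ptens Q E) :
     \sum_(i <- s) ((F i, G i) : dsum (ptens P E) (ptens Q E)) =
     (\sum_(i <- s) F i, \sum_(i <- s) G i).
    by elim: s => [|i s IH]; rewrite ?big_nil // !big_cons IH.
  by rewrite !pair_sum !big1_eq; congr (_, _); rewrite /= ?addr0 ?add0r.
- move=> [[p q] x] [[p' q'] x'] /=; rewrite ip_ipure /= [RHS]/ip /= /dsum_ip /=.
  by rewrite !ip_ipure [ip _ _]/ip /= /dsum_ip (lactDl (bm_lactP E)) rip_Dr.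
- exact: proj_hact h1.
- exact: proj_hact h2.
- move=> g [[p q] x] /=; rewrite hact_ipure // [X in matched _ _ _ X]/hact /=.
  rewrite !hact_ipure //.
  (* A pair of Sweedler sums is one Sweedler sum of pairs, as both run over the same representative
     of the coproduct. *)
  rewrite (_ : (_, _) = sw (fun a b =>
      (ipure (hact a p) (bhact b x), ipure (hact a q) (bhact b x)) :
        dsum (ptens P E) (ptens Q E)) g); last first.
    rewrite /sw /sweedler /tlift; elim: (repr _) => [|i s IH].
      by rewrite !big_nil.
    by rewrite !big_cons -IH.
  apply: matched_sw => a b.
  exact: (matched_gen _ _ ((hact a p, hact a q) : dsum P Q, bhact b x)).
Qed.

(** Both sides are generated by triples (p, y, x), and both Gram entries equal <x, <y, <p, p'> y'>
    x'>. *)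
Lemma ptens_assoc (D B A : hstarAlg H) (P : ipMod D) (F : picObj str D B)
    (E : picObj str B A) (FE : is_pic str (btens F E)) : is_proj str P ->
  proj_iso (ptens (ptens P F) E) (ptens P (PicObj FE)).
Proof.
move=> hP; have h1 := ptens_is_proj E (ptens_is_proj F hP).
have h2 := ptens_is_proj (PicObj FE) hP.
pose J := (P * F * E)%type.
pose v (q : J) : ptens P (PicObj FE) :=
  ipure q.1.1 (bpure q.1.2 q.2 : PicObj FE).
apply: (gram_proj_iso (u := fun q : J => ipure (ipure q.1.1 q.1.2) q.2)
  (v := v) (proj_nondegenerate h1) (proj_nondegenerate h2)).
- elim/ptens_ind => [|p x t [s ->]]; first by exists [::]; rewrite big_nil.
  have [r ->] := ptens_span p; exists ([seq (q, x) | q <- r] ++ s).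
  by rewrite big_cat big_map /= ipure_suml.
- elim/ptens_ind => [|p x t [s ->]]; first by exists [::]; rewrite big_nil.
  have [r ->] := ptens_span (x : ptens (pic_ipmod F) E).
  exists ([seq (p, q.1, q.2) | q <- r] ++ s).
  by rewrite big_cat big_map /= ipure_sumr.
- move=> [[p y] x] [[p' y'] x'] /=; rewrite !ip_ipure /=.
  rewrite [bm_lact _ (bpure _ _)](@bm_lact_bpure _ _ _ _ _ _ F E).
  by rewrite [RHS](@rip_bpure _ _ _ _ _ _ F E).
- exact: proj_hact h1.
- exact: proj_hact h2.
- move=> g [[p y] x]; rewrite /v /= !hact_ipure //; last exact: ptens_is_proj.
  have w1 : trilin (fun a b c : H => ipure (hact a p)
      (bpure (bhact b y) (bhact c x) : PicObj FE)).
    split=> ? ? ? ? ?; rewrite ?(hact_linl (proj_hact hP), hact_linl (pic_hact (picP F)),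
      hact_linl (pic_hact (picP E)), ipure_linl).
    + by [].
    + by rewrite bpure_linl; exact: ipure_linr.
    + by rewrite bpure_linr; exact: ipure_linr.
  (* On the right, g acts as g_1 on p and (g_2, g_3) on the pair; coassociativity regroups this to
     match the left side term by term. *)
  rewrite [X in matched _ _ _ X](_ : _ =
      sw (fun a b => sw (fun c d => ipure (hact c p)
        (bpure (bhact d y) (bhact b x) : PicObj FE)) a) g); last first.
    rewrite (sw_coassoc _ w1); apply: eq_sw => a b.
    rewrite [bhact b _](@bhact_bpure _ _ _ _ _ _ F E).
    by apply: (sw_morph (phi := ipure (hact a p))) => ? ?; exact: ipureDr.
  apply: matched_sw => a b; rewrite hact_ipure //.
  rewrite (sw_morph (phi := fun t => ipure t (bhact b x))); last first.
    by move=> ? ?; exact: ipureDl.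
  apply: matched_sw => c d.
  exact: (matched_gen _ _ ((hact c p, bhact d y), bhact b x)).
Qed.
End PtensIso.

(** * Unit and conjugate bimodules *)

Section Unit.
Variables (R : realDomainType) (H : hopfStarAlg R) (str : bool) (A : hstarAlg H).
Local Notation C := (cplx R).
Let hH := hopfP H.

Lemma star_cov (g : H) (a : A) :
  star (ha_act (star (antipode g)) a) = ha_act g (star a).
Proof. by rewrite ha_act_star (antipode_star hH). Qed.

Lemma mx_positive_row n (a : 'I_n -> A) :
  mx_positive (\matrix_(i, j) (star (a i) * a j)).
Proof.
case: n a => [|n] a.
  rewrite (_ : \matrix_(i, j) _ = (map_mx (@star R A) (0 : 'M[A]_0))^T *m 0).
    exact: mx_positive_sq.
  by apply/matrixP => -[].
(* The rank-one matrix is a square of a square matrix whose first row is a and whose other rows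
   vanish; size 0 has no first row and was treated apart. *)
pose N : 'M[A]_n.+1 := \matrix_(i, j) if i == ord0 then a j else 0.
rewrite (_ : \matrix_(_, _) _ = (map_mx (@star R A) N)^T *m N).
  exact: mx_positive_sq.
apply/matrixP => i j; rewrite !mxE (bigD1 ord0) //= big1 ?addr0 => [|r /negPf r0].
  by rewrite !mxE eqxx.
by rewrite !mxE r0 mulr0.
Qed.

Lemma unit_is_pic : is_pic str (unit_bimod A).
Proof.
pose E := unit_bimod A.
have lE : @is_lip _ A (bm_left E) (@lip _ _ _ _ E).
  split=> [x y z|c x y|a x y|x y].
  - exact: mulrDl.
  - by rewrite /lip /= scaler_mul_l.
  - by rewrite /lip /= mulrA.
  - by rewrite /lip /= starM star_involutive.
have rE : @is_rip _ A (bm_right E) (@rip _ _ _ _ E).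
  split=> [x y z|c x y|x y a|x y].
  - exact: mulrDr.
  - by rewrite /rip /= scaler_mul_r.
  - by rewrite /rip /= -mulrA.
  - by rewrite /rip /= starM star_involutive.
have cE (x y z : E) : bm_lact (lip x y) z = bm_ract x (rip y z).
  by rewrite /bm_lact /lip /bm_ract /rip /= mulrA.
have ul : lip_unital [:: (1, 1) : E * E].
  by rewrite /lip_unital big_seq1 /lip /= star1 mulr1.
have ur : rip_unital [:: (1, 1) : E * E].
  by rewrite /rip_unital big_seq1 /rip /= star1 mulr1.
split.
- exact: lE.
- exact: rE.
- exact: lip_unital_full lE _ ul.
- exact: rip_unital_full rE _ ur.
- exact: lip_nondegenerate cE _ ur.
- exact: rip_nondegenerate rE cE _ ul.
- by move=> b x y; rewrite /rip /bm_lact /= starM mulrA.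
- by move=> a x y; rewrite /lip /bm_ract /= starM star_involutive mulrA.
- exact: cE.
- exact: ha_actP.
- move=> g x y; rewrite /rip /bhact /= ha_act_mul; apply: eq_sw => a b.
  by rewrite star_cov.
- move=> g x y; rewrite /lip /bhact /= ha_act_mul; apply: eq_sw => a b.
  by rewrite star_cov.
(* The entries x_i x_j^* have the form of [mx_positive_row] for the starred family. *)
- move=> _ n x; rewrite (_ : \matrix_(_, _) _ =
    \matrix_(i, j) (star (star (x i : A)) * star (x j))); first exact: mx_positive_row.
  by apply/matrixP => i j; rewrite !mxE star_involutive.
- by move=> _ n x; exact: mx_positive_row.
Qed.

Lemma ptens_unit (P : ipMod A) (uA : is_pic str (unit_bimod A)) :
  is_proj str P -> proj_iso (ptens P (PicObj uA)) P.
Proof.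
move=> hP; have h1 := ptens_is_proj (PicObj uA) hP.
apply: (gram_proj_iso (u := fun q : P * PicObj uA => ipure q.1 q.2)
  (v := fun q : P * PicObj uA => ract q.1 q.2)
  (proj_nondegenerate h1) (proj_nondegenerate hP)).
- exact: ptens_span.
- by move=> x; exists [:: (x, 1 : A)]; rewrite big_seq1 (ract1 (ractP P)).
- move=> [p a] [q b]; rewrite ip_ipure ipMl (ripMr (ipP P)) /=.
  by rewrite /rip /bm_lact /= mulrA.
- exact: proj_hact h1.
- exact: proj_hact hP.
- move=> g [p a]; rewrite /= hact_ipure //.
  rewrite (hact_ract (proj_hact hP) (proj_nondegenerate hP) (proj_cov hP)).
  apply: matched_sw => b c.
  exact: (matched_gen _ _ (hact b p, ha_act c a : PicObj uA)).
Qed.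
End Unit.

(** A new name for the carrier, so that it keeps its addition but can receive the conjugated
    scalars. *)
Definition conj_car (R : realDomainType) (V : lmodType (cplx R)) : Type := V.
HB.instance Definition _ R V := GRing.Zmodule.on (@conj_car R V).

Section ConjModule.
Variables (R : realDomainType) (V : lmodType (cplx R)).
Local Notation C := (cplx R).
Definition conj_scale (c : C) (x : conj_car V) : conj_car V := cconj c *: (x : V).
Lemma conj_scaleA c d x : conj_scale c (conj_scale d x) = conj_scale (c * d) x.
Proof. by rewrite /conj_scale scalerA cconjM. Qed.
Lemma conj_scale1 : left_id 1 conj_scale.
Proof.
move=> x; rewrite /conj_scale (_ : cconj 1 = 1) ?scale1r //.
by congr Cplx; rewrite /= oppr0.
Qed.
Lemma conj_scaleDr : right_distributive conj_scale +%R.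
Proof. by move=> c x y; exact: scalerDr. Qed.
Lemma conj_scaleDl x : {morph conj_scale^~ x : c d / c + d}.
Proof. by move=> c d; rewrite /conj_scale cconjD scalerDl. Qed.
HB.instance Definition _ := GRing.Zmodule_isLmodule.Build C (conj_car V)
  conj_scaleA conj_scale1 conj_scaleDr conj_scaleDl.
End ConjModule.

Section Conjugate.
Variables (R : realDomainType) (H : hopfStarAlg R) (str : bool).
Variables (B A : hstarAlg H) (E : picObj str B A).
Local Notation C := (cplx R).
Let pE := picP E.
Let hH := hopfP H.
Let lE := bm_lactP E.
Let rE := bm_ractP E.
Let lipE := pic_lip pE.
Let ripE := pic_rip pE.
Let V : lmodType C := conj_car E.

Definition conj_lact (a : A) (x : V) : V := bm_ract (x : E) (star a).
Definition conj_ract (x : V) (b : B) : V := bm_lact (star b) (x : E).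

Lemma conj_lactP : @is_lact R A V conj_lact.
Proof.
split=> *; rewrite /conj_lact ?starD ?starZ ?starM ?star1.
- exact: (ractDr rE).
- exact: (ractDl rE).
- exact: (ractZr rE).
- exact: (ractZl rE).
- exact: (ractM rE).
- exact: (ract1 rE).
Qed.

Lemma conj_ractP : @is_ract R B V conj_ract.
Proof.
split=> *; rewrite /conj_ract ?starD ?starZ ?starM ?star1.
- exact: (lactDr lE).
- exact: (lactDl lE).
- exact: (lactZr lE).
- exact: (lactZl lE).
- exact: (lactM lE).
- exact: (lact1 lE).
Qed.

Lemma conj_actA a (x : V) b : conj_ract (conj_lact a x) b = conj_lact a (conj_ract x b).
Proof. by rewrite /conj_lact /conj_ract bm_actA. Qed.

Definition conj_bimod : bimod A B := Bimod conj_lactP conj_ractP conj_actA.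

(** The inner products trade places unchanged: [rip] is antilinear in its first argument, hence
    linear there for the conjugated scalars, as a left inner product must be. *)
Definition conj_ipbimod : ipBimod A B :=
  @IpBimod R H A B conj_bimod (fun x y => rip (x : E) y) (fun x y => lip (x : E) y)
    (fun g x => bhact (star (antipode g)) (x : E)).

Lemma conj_is_pic : is_pic str conj_ipbimod.
Proof.
have hE := pic_hact pE.
have [s us] := pic_rip_unital E; have [s' us'] := pic_lip_unital E.
have lF : @is_lip _ A (bm_left conj_ipbimod) (@lip _ _ _ _ conj_ipbimod).
  split=> [x y z|c x y|a x y|x y]; rewrite /lip /=.
  - exact: rip_Dl.
  - by rewrite (ripC ripE) (ripZr ripE) starZ cconjK -(ripC ripE).
  - rewrite -[LHS]/(rip (bm_ract (x : E) (star a)) (y : E)) (ripC ripE).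
    by rewrite (ripMr ripE) starM star_involutive -(ripC ripE).
  - exact: (ripC ripE).
have rF : @is_rip _ B (bm_right conj_ipbimod) (@rip _ _ _ _ conj_ipbimod).
  split=> [x y z|c x y|x y a|x y]; rewrite /rip /=.
  - exact: lipDr.
  - by rewrite (lipC lipE) (lipZl lipE) starZ cconjK -(lipC lipE).
  - rewrite -[LHS]/(lip (x : E) (bm_lact (star a) (y : E))) (lipC lipE).
    by rewrite (lipMl lipE) starM star_involutive -(lipC lipE).
  - exact: (lipC lipE).
have cF (x y z : conj_ipbimod) : bm_lact (lip x y) z = bm_ract x (rip y z).
  rewrite /bm_lact /bm_ract /= /conj_lact /conj_ract /lip /rip /=.
  by rewrite -(ripC ripE) -(lipC lipE) (pic_compat pE).
split.
- exact: lF.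
- exact: rF.
- exact: (pic_rfull pE).
- exact: (pic_lfull pE).
- exact: (pic_rnondeg pE).
- exact: (pic_lnondeg pE).
- move=> b x y; rewrite /rip /bm_lact /= /conj_lact star_involutive.
  by rewrite (pic_radj pE) star_involutive.
- move=> b x y; rewrite /lip /bm_ract /= /conj_ract star_involutive.
  by rewrite (pic_ladj pE) star_involutive.
- exact: cF.
- split=> *; rewrite /bhact /=.
  + by rewrite (antipodeD hH) starD (hactDl hE).
  + exact: (hactDr hE).
  + by rewrite (antipodeZ hH) starZ (hactZl hE).
  + exact: (hactZr hE).
  (* Antipode and star both reverse products, so their composite preserves them. *)
  + by rewrite antipodeM starM (hactM hE).
  + by rewrite antipode1 star1 (hact1 hE).
(* The conjugate action of [star (antipode a)] applies antipode and star twice, which gives back a;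
   the covariance of one side of E thus becomes that of the other side. *)
- move=> g x y; rewrite /rip /bhact /= (pic_lcov pE); apply: eq_sw => a b.
  by rewrite (antipode_star hH).
- move=> g x y; rewrite /lip /bhact /= (pic_rcov pE); apply: eq_sw => a b.
  by rewrite (antipode_star hH).
- exact: (pic_rcp pE).
- exact: (pic_lcp pE).
Qed.

Definition conj_pic : picObj str A B := PicObj conj_is_pic.
End Conjugate.

(** * The conjugate bimodule as an inverse *)

Section PicIso.
Variables (R : realDomainType) (H : hopfStarAlg R) (str : bool).

(** The left inner product is not compared: lip (f x) (f y) . f z = f x . rip y z = f (lip x y . z)
    = lip x y . f z, and the left action is faithful. *)
Lemma pic_gram_iso (B A : hstarAlg H) (E F : picObj str B A) (I : Type)
    (u : I -> E) (v : I -> F) :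
  (forall x, exists s, x = \sum_(i <- s) u i) ->
  (forall y, exists s, y = \sum_(i <- s) v i) ->
  (forall i j, rip (u i) (u j) = rip (v i) (v j)) ->
  (forall g i, matched u v (bhact g (u i)) (bhact g (v i))) ->
  (forall b i, matched u v (bm_lact b (u i)) (bm_lact b (v i))) ->
  pic_iso E F.
Proof.
move=> uE vF gram uv_hact uv_lact.
have [f [bf [fD fM] fh fip fu]] := gram_iso (P := pic_ipmod E) (Q := pic_ipmod F)
  (pic_rnondeg (picP E)) (pic_rnondeg (picP F)) uE vF gram
  (pic_hact (picP E)) (pic_hact (picP F)) uv_hact.
have lE := bm_lactP E; have lF := bm_lactP F.
have f0 : f 0 = 0 by apply: (addrI (f 0)); rewrite -fD !addr0.
have fl b x : f (bm_lact b x) = bm_lact b (f x).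
  have [s ->] := uE x; elim: s => [|i s IH].
    have l0 (G : picObj str B A) : bm_lact b (0 : G) = 0.
      by apply: (addrI (bm_lact b 0)); rewrite -(lactDr (bm_lactP G)) !addr0.
    by rewrite big_nil l0 f0 l0.
  rewrite big_cons (lactDr lE) !fD (lactDr lF) IH fu; congr (_ + _).
  exact: (matched_fun (Y := F) fD fu).
have [s us] := pic_lip_unital F.
have fr x y : rip (f x) (f y) = rip x y := fip x y.
have fa x a : f (bm_ract x a) = bm_ract (f x) a := fM x a.
exists f; split=> //.
move=> x y; apply: (lact_faithful (pic_lip (picP F)) us) => z.
have [h fK hK] := bf; rewrite -(hK z) (pic_compat (picP F)) fr.
by rewrite -fl (pic_compat (picP E)) fa.
Qed.

Lemma btens_span (D B A : hstarAlg H) (F : picObj str D B) (E : picObj str B A)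
    (t : btens F E) : exists s : seq (F * E), t = \sum_(q <- s) bpure q.1 q.2.
Proof.
elim/btens_ind: t => [|y x t [s ->]]; first by exists [::]; rewrite big_nil.
by exists ((y, x) :: s); rewrite big_cons.
Qed.

(** The isomorphism sends x (x) y to [lip x y], and fullness makes it onto. Both Gram entries reduce
    to the left inner product of y with y' acted on by the star of [rip x x']. *)
Lemma btens_conj_r (B A : hstarAlg H) (E : picObj str B A)
    (FE : is_pic str (btens E (conj_pic E))) (uB : is_pic str (unit_bimod B)) :
  pic_iso (PicObj FE) (PicObj uB).
Proof.
have pE := picP E.
apply: (pic_gram_iso (u := fun q : E * E => bpure q.1 (q.2 : conj_pic E) : PicObj FE)
  (v := fun q : E * E => lip q.1 q.2 : PicObj uB)).
- exact: btens_span.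
- exact: (lip_full_sum (pic_lip pE) (pic_lfull pE)).
- move=> [x y] [x' y'] /=; rewrite [LHS]rip_bpure.
  rewrite /rip /bm_lact /= /conj_lact -/(rip _ _).
  rewrite -(lipC (pic_lip pE)) -(lipMl (pic_lip pE)) [lact _ _](pic_compat pE).
  by rewrite (pic_radj pE).
- move=> g [x y] /=; rewrite [bhact g (bpure _ _)]bhact_bpure.
  rewrite [X in matched _ _ _ X](pic_lcov pE g x y).
  apply: matched_sw => a b.
  exact: (matched_gen _ _ (bhact a x, bhact (star (antipode b)) y)).
- move=> b [x y] /=; rewrite [bm_lact _ (bpure _ _)]bm_lact_bpure.
  rewrite [X in matched _ _ _ X](_ : _ = lip (bm_lact b x) y).
    exact: (matched_gen _ _ (bm_lact b x, y)).
  by rewrite [RHS](lipMl (pic_lip pE)).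
Qed.

Lemma btens_conj_l (B A : hstarAlg H) (E : picObj str B A)
    (FE : is_pic str (btens (conj_pic E) E)) (uA : is_pic str (unit_bimod A)) :
  pic_iso (PicObj FE) (PicObj uA).
Proof.
have pE := picP E.
apply: (pic_gram_iso (u := fun q : E * E => bpure (q.1 : conj_pic E) q.2 : PicObj FE)
  (v := fun q : E * E => rip q.1 q.2 : PicObj uA)).
- exact: btens_span.
- exact: (rip_full_sum (pic_rip pE) (pic_rfull pE)).
- move=> [x y] [x' y'] /=; rewrite [LHS]rip_bpure.
  rewrite [RHS]/rip /= -(ripC (pic_rip pE)) -(ripMr (pic_rip pE)).
  by rewrite [ract _ _](esym (pic_compat pE _ _ _)).
- move=> g [x y] /=; rewrite [bhact g (bpure _ _)]bhact_bpure.
  rewrite [X in matched _ _ _ X](pic_rcov pE g x y).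
  apply: matched_sw => a b.
  exact: (matched_gen _ _ (bhact (star (antipode a)) x, bhact b y)).
- move=> a [x y] /=; rewrite [bm_lact _ (bpure _ _)]bm_lact_bpure.
  rewrite [X in matched _ _ _ X](_ : _ = rip (bm_ract x (star a)) y).
    exact: (matched_gen _ _ (bm_ract x (star a), y)).
  rewrite [RHS](ripC (pic_rip pE)) [rip y _](ripMr (pic_rip pE)).
  by rewrite starM star_involutive -(ripC (pic_rip pE)).
Qed.

Lemma pic_iso_refl (B A : hstarAlg H) (E : ipBimod B A) : pic_iso E E.
Proof. by exists id; split=> //; exists id. Qed.
End PicIso.

(** * The action *)

Section GrothMap.
Variables (M N : cmonoid) (f : M -> N).
Hypothesis fD : forall x y, f (cm_add x y) = cm_add (f x) (f y).

Definition groth_map (x : groth M) : groth N :=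
  groth_mk (f (groth_repr x).1) (f (groth_repr x).2).

Lemma groth_map_mk a b : groth_map (groth_mk a b) = groth_mk (f a) (f b).
Proof.
have [k E] := (groth_mkP _ _ _ _).1 (groth_reprK (groth_mk a b)).
by apply/groth_mkP; exists (f k); rewrite -!fD E.
Qed.

Lemma groth_mapD x y : groth_map (cm_add x y) = cm_add (groth_map x) (groth_map y).
Proof.
elim/grothW: x => a b; elim/grothW: y => c d.
rewrite -[LHS]/(groth_map (groth_add (groth_mk a b) (groth_mk c d))).
rewrite -[RHS]/(groth_add (groth_map (groth_mk a b)) (groth_map (groth_mk c d))).
by rewrite groth_add_mk !groth_map_mk groth_add_mk !fD.
Qed.

Lemma groth_map_in x : groth_map (groth_in x) = groth_in (f x).
Proof.
(* Additivity alone makes f 0 idempotent, so adding it once more equates the classes of (f x, f 0)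
   and (f x, 0). *)
rewrite groth_map_mk; apply/groth_mkP; exists (f (cm_zero M)).
by rewrite -!cm_addA cm_add0 -(fD (cm_zero M)) cm_add0.
Qed.
End GrothMap.

Section Action.
Variables (R : realDomainType) (H : hopfStarAlg R) (str : bool).

Definition pic_act (B A : hstarAlg H) (x : Proj str B) (e : Pic str B A) :
    Proj str A :=
  proj_cls (ProjObj (ptens_is_proj (crepr e) (projP (crepr x)))).

Lemma pic_act_cls (B A : hstarAlg H) (P : projObj str B) (E : picObj str B A) :
  pic_act (proj_cls P) (pic_cls E) = proj_cls (ProjObj (ptens_is_proj E (projP P))).
Proof.
apply/proj_clsP; apply: ptens_congr; [exact: projP | exact: projP | |].
  by apply/proj_clsP; exact: creprK.
(* Equal classes are equal predicates, so replacing the predicate of the representative by that of E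
   leaves only reflexivity of [pic_iso]. *)
have /(congr1 sval) /= eE := creprK (pic_cls E).
rewrite -[pic_iso _ _]/(picobj_iso (crepr (pic_cls E)) E) eE.
exact: pic_iso_refl.
Qed.

Lemma proj_clsW (A : hstarAlg H) (K : Proj str A -> Prop) :
  (forall P, K (proj_cls P)) -> forall x, K x.
Proof. exact: pclsW. Qed.

Lemma pic_clsW (B A : hstarAlg H) (K : Pic str B A -> Prop) :
  (forall E, K (pic_cls E)) -> forall e, K e.
Proof. by move=> KE e; rewrite -(creprK e); exact: KE. Qed.

Lemma pic_act_iso (B A : hstarAlg H) (x : Proj str B) (E F : picObj str B A) :
  pic_iso E F -> pic_act x (pic_cls E) = pic_act x (pic_cls F).
Proof.
elim/proj_clsW: x => P EF; rewrite !pic_act_cls; apply/proj_clsP.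
by apply: ptens_congr => //; [exact: projP | exact: projP | exact: proj_iso_refl].
Qed.

Lemma pic_actD (B A : hstarAlg H) (x y : Proj str B) (e : Pic str B A) :
  pic_act (cm_add x y) e = cm_add (pic_act x e) (pic_act y e).
Proof.
elim/proj_clsW: x => P; elim/proj_clsW: y => Q; elim/pic_clsW: e => E.
have addE (X : hstarAlg H) (U V : projObj str X) :
    cm_add (proj_cls U) (proj_cls V) = proj_cls (dsum_obj U V).
  exact: proj_add_cls.
rewrite addE !pic_act_cls addE.
by apply/proj_clsP; apply: ptens_dsum; exact: projP.
Qed.

Lemma pic_act_assoc (D B A : hstarAlg H) (x : Proj str D) (F : picObj str D B)
    (E : picObj str B A) :
  pic_act (pic_act x (pic_cls F)) (pic_cls E) =
  pic_act x (pic_cls (PicObj (btens_is_pic F E))).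
Proof.
elim/proj_clsW: x => P; rewrite !pic_act_cls; apply/proj_clsP.
by apply: ptens_assoc; exact: projP.
Qed.

Lemma pic_act_unit (A : hstarAlg H) (x : Proj str A) :
  pic_act x (pic_cls (PicObj (unit_is_pic str A))) = x.
Proof.
elim/proj_clsW: x => P; rewrite pic_act_cls; apply/proj_clsP.
by apply: ptens_unit; exact: projP.
Qed.

Lemma pic_act_conj_r (B A : hstarAlg H) (x : Proj str B) (E : picObj str B A) :
  pic_act (pic_act x (pic_cls E)) (pic_cls (conj_pic E)) = x.
Proof.
rewrite pic_act_assoc -[RHS]pic_act_unit; apply: pic_act_iso.
exact: btens_conj_r.
Qed.

Lemma pic_act_conj_l (B A : hstarAlg H) (x : Proj str A) (E : picObj str B A) :
  pic_act (pic_act x (pic_cls (conj_pic E))) (pic_cls E) = x.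
Proof.
rewrite pic_act_assoc -[RHS]pic_act_unit; apply: pic_act_iso.
exact: btens_conj_l.
Qed.

Definition pic_act_K0 (B A : hstarAlg H) (x : K0 str B) (e : Pic str B A) :
    K0 str A :=
  groth_map (fun y => pic_act y e) x.

Lemma pic_act_K0_mk (B A : hstarAlg H) a b (e : Pic str B A) :
  pic_act_K0 (groth_mk a b) e = groth_mk (pic_act a e) (pic_act b e).
Proof. by apply: groth_map_mk => x y; exact: pic_actD. Qed.
End Action.

Theorem proposition5p6 (R : realDomainType) (H : hopfStarAlg R) (str : bool) :
  exists (S : forall B A : hstarAlg H, Proj str B -> Pic str B A -> Proj str A)
         (SK : forall B A : hstarAlg H, K0 str B -> Pic str B A -> K0 str A),
    [/\ (* S([P], [E]) = [P (x)_B E], which lies in Proj_H(A) *)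
        forall (B A : hstarAlg H) (P : projObj str B) (E : picObj str B A),
          exists PE : is_proj str (ptens P E),
            S B A (proj_cls P) (pic_cls E) = proj_cls (ProjObj PE),
        (* S is a right action by semigroup isomorphisms *)
        right_pic_action S /\
          (forall (B A : hstarAlg H) (e : Pic str B A),
             additive_iso (fun x : Proj str B => S B A x e)),
        (* S induces SK on K_0 *)
        forall (B A : hstarAlg H) (x : Proj str B) (e : Pic str B A),
          SK B A (K0_in x) e = K0_in (S B A x e)
      & (* SK is a right action by group isomorphisms *)
        right_pic_action SK /\
          (forall (B A : hstarAlg H) (e : Pic str B A),
             additive_iso (fun x : K0 str B => SK B A x e))].
Proof.
exists (@pic_act R H str), (@pic_act_K0 R H str); split.
- by move=> B A P E; exists (ptens_is_proj E (projP P)); exact: pic_act_cls.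
- split; first split.
  + by move=> D B A x F E; exists (btens_is_pic F E); exact: pic_act_assoc.
  + by move=> A x; exists (unit_is_pic str A); exact: pic_act_unit.
  move=> B A e; split=> [x y|]; first exact: pic_actD.
  elim/pic_clsW: e => E; exists (fun x => pic_act x (pic_cls (conj_pic E))) => x.
    exact: pic_act_conj_r.
  exact: pic_act_conj_l.
- move=> B A x e; apply: groth_map_in => y z; exact: pic_actD.
- split; first split.
  + move=> D B A x F E; exists (btens_is_pic F E).
    by elim/grothW: x => a b; rewrite !pic_act_K0_mk !pic_act_assoc.
  + move=> A x; exists (unit_is_pic str A).
    by elim/grothW: x => a b; rewrite pic_act_K0_mk !pic_act_unit.
  move=> B A e; split=> [x y|].
    by apply: groth_mapD => u v; exact: pic_actD.
  elim/pic_clsW: e => E; exists (fun x => pic_act_K0 x (pic_cls (conj_pic E))).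
    by elim/grothW=> a b; rewrite !pic_act_K0_mk !pic_act_conj_r.
  by elim/grothW=> a b; rewrite !pic_act_K0_mk !pic_act_conj_l.
Qed.
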